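(* Let $(\mathfrak g,r)$ be a finite dimensional quasitriangular Lie bialgebra over a field $\mathbf k$ of characteristic $0$, and assume that $t=r+r^{2,1}\in S^2(\mathfrak g)$ is nondegenerate. Let $r_0=(r-r^{2,1})/2$ and let $g\in\mathrm{Map}_0(\mathfrak g^*,G)$ satisfy $$(g_1)^{-1}d_2(g_1)-(g_2)^{-1}d_1(g_2)+\mathrm{Ad}(g\otimes g)^{-1}(r_0)-\langle \mathrm{id}\otimes\mathrm{id}\otimes\lambda,[(g_1)^{-1}d_3(g_1),(g_2)^{-1}d_3(g_2)]\rangle=\rho_{\mathrm{AM}}.\qquad( * )$$ Then there exists a unique isomorphism of formal Poisson manifolds $g^*(\lambda):\mathfrak g^*\to G^*$ defined by the identity $$g(\lambda)\,e^{\lambda^\vee}g(\lambda)^{-1}=L(g^*(\lambda))\,R(g^*(\lambda))^{-1},\qquad \lambda^\vee=(\lambda\otimes\mathrm{id})(t).$$ In other words, $a:\mathfrak g^*\to G$, $a(\lambda)=g(\lambda)e^{\lambda^\vee}g(\lambda)^{-1}$, and $b:G^*\to G$, $b(u)=L(u)R(u)^{-1}$, are (non-Poisson) isomorphisms of formal manifolds and $g^*(\lambda)=b^{-1}\circ a(\lambda)$. Moreover, for $\alpha\in\mathrm{Map}_0^{ham}(\mathfrak g^*,G)$, the isomorphism $(\alpha*g)^*:\mathfrak g^*\to G^*$ corresponding in this way to the solution $(\alpha*g)(\lambda)=g(\mathrm{Ad}^*(\alpha(\lambda))(\lambda))\alpha(\lambda)$ of $( * )$ satisfies $(\alpha*g)^*(\lambda)=g^*(\theta(\alpha)(\lambda))$,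 where $\theta(\alpha)$ is the automorphism $\lambda\mapsto\mathrm{Ad}^*(\alpha(\lambda))(\lambda)$ of $\mathfrak g^*$.
   Context: A finite dimensional quasitriangular Lie bialgebra $(\mathfrak g,r)$ is a finite dimensional Lie algebra $\mathfrak g$ with $r\in\mathfrak g^{\otimes 2}$ such that $t:=r+r^{2,1}$ is $\mathfrak g$-invariant and $[r^{1,2},r^{1,3}]+[r^{1,2},r^{2,3}]+[r^{1,3},r^{2,3}]=0$. The cobracket is $\delta(x)=[x\otimes1+1\otimes x,r]$; its dual is the Lie bracket of $\mathfrak g^*$. The formal manifold $\mathfrak g^*$ (formal neighborhood of $0$) has function algebra $\widehat S(\mathfrak g)=\widehat\oplus_{k\ge0}S^k(\mathfrak g)$ with Poisson bracket $\{f,h\}(\lambda)=\langle\lambda,[df(\lambda),dh(\lambda)]\rangle$. $G^*$ is the formal Poisson-Lie group with Lie bialgebra $\mathfrak g^*$: its Lie algebra is $\mathfrak g^*$, and the linearization of its Poisson bracket at the origin is the Lie bracket of $\mathfrak g$. $G$ is the formal group with Lie algebra $\mathfrak g$. $L,R:G^*\to G$ are the formal group morphisms corresponding to the Lie algebra morphisms $L,R:\mathfrak g^*\to\mathfrak g$, $L(\lambda)=(\lambda\otimes\mathrm{id})(r)$, $R(\lambda)=-(\lambda\otimes\mathrm{id})(r^{2,1})$. $\mathrm{Map}_0(\mathfrak g^*,G)$ is the set of formal maps $\lambda\mapsto e^{x(\lambda)}$ with $x\in\mathfrak g\otimes\widehat S(\mathfrak g)_{>0}$, where $\widehat S(\mathfrak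 g)_{>0}=\widehat\oplus_{k>0}S^k(\mathfrak g)$. $\mathrm{Ad}^*$ is the coadjoint action: $\langle \mathrm{Ad}^*(g)\lambda,x\rangle=\langle\lambda,\mathrm{Ad}(g^{-1})x\rangle$. Notation: for dual bases $(e_i)$, $(\varepsilon^i)$ of $\mathfrak g$, $\mathfrak g^*$, put $\theta_i(\lambda)=g^{-1}\partial_{\varepsilon^i}g(\lambda)\in\mathfrak g$, where $\partial_\xi g(\lambda)=\frac{d}{d\epsilon}|_{\epsilon=0}g(\lambda+\epsilon\xi)$. Then $g_1^{-1}d_2(g_1)=\sum_i\theta_i\otimes e_i$, $g_2^{-1}d_1(g_2)=\sum_ie_i\otimes\theta_i$, and $\langle\mathrm{id}\otimes\mathrm{id}\otimes\lambda,[g_1^{-1}d_3(g_1),g_2^{-1}d_3(g_2)]\rangle=\sum_{i,j}\langle\lambda,[e_i,e_j]\rangle\,\theta_i\otimes\theta_j$. Also $\rho_{\mathrm{AM}}(\lambda)=(\mathrm{id}\otimes\varphi(\mathrm{ad}\,\lambda^\vee))(t)$ with $\varphi(z)=-\frac1z+\frac12\coth\frac z2$ (a power series regular at $0$). $\mathrm{Map}_0^{ham}(\mathfrak g^*,G)$ is the set of $g\in\mathrm{Map}_0(\mathfrak g^*,G)$ with $g_1^{-1}d_2(g_1)-g_2^{-1}d_1(g_2)-\langle\mathrm{id}\otimes\mathrm{id}\otimes\lambda,[g_1^{-1}d_3(g_1),g_2^{-1}d_3(g_2)]\rangle=0$. *)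

(* Defs.v *)
From HB Require Import structures.
From mathcomp Require Import all_boot all_order all_algebra.
From mathcomp Require Import boolp.
From mathcomp Require Import mpoly.

Set Implicit Arguments.
Unset Strict Implicit.
Unset Printing Implicit Defensive.

Import GRing.Theory.
Local Open Scope ring_scope.

Record fps (n : nat) (K : comNzRingType) := FPS { fps_coef :> 'X_{1..n} -> K }.

Notation "{ 'fps' K [ n ] }" := (fps n K) (at level 0, K, n at level 2).

Section FpsRing.
Variables (n : nat) (K : comNzRingType).
Implicit Types (f g h : {fps K[n]}) (m : 'X_{1..n}).

Lemma fpsP f g : (forall m, f m = g m) -> f = g.
Proof. by case: f => f; case: g => g /= /funext ->. Qed.

HB.instance Definition _ := gen_eqMixin {fps K[n]}.
HB.instance Definition _ := gen_choiceMixin {fps K[n]}.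

Definition fpsC (a : K) : {fps K[n]} := FPS (fun m => if m == 0%MM then a else 0).

Definition fpsX (i : 'I_n) : {fps K[n]} := FPS (fun m => (m == U_(i)%MM)%:R).

Definition fps_add f g : {fps K[n]} := FPS (fun m => f m + g m).
Definition fps_opp f : {fps K[n]} := FPS (fun m => - f m).
Definition fps_mul f g : {fps K[n]} := FPS (fun m =>
  \sum_(d : 'X_{1..n < (mdeg m).+1, (mdeg m).+1} | m == (d.1 + d.2)%MM)
     f d.1 * g d.2).

Lemma fps_addA : associative fps_add.
Proof. by move=> f g h; apply: fpsP => m /=; rewrite addrA. Qed.
Lemma fps_addC : commutative fps_add.
Proof. by move=> f g; apply: fpsP => m /=; rewrite addrC. Qed.
Lemma fps_add0 : left_id (fpsC 0) fps_add.
Proof. by move=> f; apply: fpsP => m /=; rewrite if_same add0r. Qed.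
Lemma fps_addN : left_inverse (fpsC 0) fps_opp fps_add.
Proof. by move=> f; apply: fpsP => m /=; rewrite if_same addNr. Qed.

HB.instance Definition _ :=
  GRing.isZmodule.Build {fps K[n]} fps_addA fps_addC fps_add0 fps_addN.

Definition fps_trunc (d : nat) f : {mpoly K[n]} :=
  \sum_(m : 'X_{1..n < d}) f m *: 'X_[m].

Lemma mcoeff_fps_trunc d f m : (mdeg m < d)%N -> (fps_trunc d f)@_m = f m.
Proof.
move=> lt_md; rewrite /fps_trunc raddf_sum /= (bigD1 (BMultinom lt_md)) //=.
rewrite mcoeffZ mcoeffX eqxx mulr1 big1 ?addr0 // => m' neq.
rewrite mcoeffZ mcoeffX; case: eqP => [eq|]; last by rewrite mulr0.
by case/eqP: neq; apply: val_inj.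
Qed.

Lemma mdeg_lt_split d m (m1 m2 : 'X_{1..n}) : m = (m1 + m2)%MM ->
  (mdeg m < d)%N -> (mdeg m1 < d)%N /\ (mdeg m2 < d)%N.
Proof.
move=> ->; rewrite mdegD => lt_d.
by split; apply: leq_ltn_trans lt_d; rewrite ?leq_addr ?leq_addl.
Qed.

Lemma fps_mulE d f g m : (mdeg m < d)%N ->
  fps_mul f g m = (fps_trunc d f * fps_trunc d g)@_m.
Proof.
move=> lt_md; rewrite mcoeffM /=; apply: eq_bigr => -[m1 m2] /= /eqP eqm.
by have [lt1 lt2] := mdeg_lt_split eqm lt_md; rewrite !mcoeff_fps_trunc.
Qed.

Lemma fps_mulEl d f g (p : {mpoly K[n]}) m : (mdeg m < d)%N ->
  (forall m', (mdeg m' < d)%N -> p@_m' = f m') ->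
  (p * fps_trunc d g)@_m = fps_mul f g m.
Proof.
move=> lt_md eqp; rewrite mcoeffM /=; apply: eq_bigr => -[m1 m2] /= /eqP eqm.
by have [lt1 lt2] := mdeg_lt_split eqm lt_md; rewrite mcoeff_fps_trunc ?eqp.
Qed.

Lemma fps_mulC : commutative fps_mul.
Proof.
by move=> f g; apply: fpsP => m; rewrite !(fps_mulE _ _ (ltnSn _)) mulrC.
Qed.

Lemma fps_mulA : associative fps_mul.
Proof.
move=> f g h; apply: fpsP => m; set d := (mdeg m).+1.
rewrite [fps_mul f _]fps_mulC.
rewrite -(@fps_mulEl d _ _ (fps_trunc d g * fps_trunc d h)) //; last first.
  by move=> m' ltm'; rewrite -fps_mulE.
rewrite -(@fps_mulEl d _ _ (fps_trunc d f * fps_trunc d g)) //; last first.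
  by move=> m' ltm'; rewrite -fps_mulE.
by rewrite [in LHS]mulrC mulrA.
Qed.

Lemma fps_mul1 : left_id (fpsC 1) fps_mul.
Proof.
move=> f; apply: fpsP => m; set d := (mdeg m).+1.
rewrite -(@fps_mulEl d _ _ 1) ?mul1r ?mcoeff_fps_trunc // => m' _.
by rewrite mcoeff1 /=; case: eqP.
Qed.

Lemma fps_mulDl : left_distributive fps_mul +%R.
Proof.
move=> f g h; apply: fpsP => m /=; rewrite -big_split /=.
by apply: eq_bigr => d _; rewrite mulrDl.
Qed.

Lemma fps_1neq0 : fpsC 1 != 0.
Proof.
apply/eqP => /(congr1 (fun f : {fps K[n]} => f 0%MM)) /=.
by rewrite eqxx => /eqP; rewrite oner_eq0.
Qed.

HB.instance Definition _ := GRing.Zmodule_isComNzRing.Build {fps K[n]}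
  fps_mulA fps_mulC fps_mul1 fps_mulDl fps_1neq0.

Definition fps_der (i : 'I_n) f : {fps K[n]} :=
  FPS (fun m => f (m + U_(i))%MM *+ (m i).+1).

End FpsRing.

Arguments fpsC n {K} a.
Arguments fpsX {n} K i.

(** A formal map [K^m -> K^p] is a row of [p] power series in [m] variables,
    without constant terms ([pointed]): base points are preserved. *)

Section FormalMaps.
Variable K : comNzRingType.

Definition pointed m p (u : 'rV[{fps K[m]}]_p) := forall i, u 0 i 0%MM = 0.

(* [f(u_1, .., u_p)]; meaningful for pointed [u] only, in which case the
   monomials of [f] of degree > [mdeg mu] do not contribute to degree [mu]. *)
Definition fps_comp m p (f : {fps K[p]}) (u : 'rV[{fps K[m]}]_p) : {fps K[m]} :=
  FPS (fun mu => \sum_(nu : 'X_{1..p < (mdeg mu).+1})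
                    f nu * (\prod_(i < p) u 0 i ^+ nu i) mu).

Definition mx_comp m p q s (A : 'M[{fps K[p]}]_(q, s)) (u : 'rV[{fps K[m]}]_p) :
  'M[{fps K[m]}]_(q, s) := map_mx (fun f => fps_comp f u) A.

Definition fid n : 'rV[{fps K[n]}]_n := \row_i fpsX K i.

(* Row [i], column [j]: the coefficient of the [i]-th variable in [u_j], so
   that the differential at the origin is [v |-> v *m lin_part u]. *)
Definition lin_part m p (u : 'rV[{fps K[m]}]_p) : 'M[K]_(m, p) :=
  \matrix_(i, j) u 0 j U_(i)%MM.

Definition jac m p (u : 'rV[{fps K[m]}]_p) : 'M[{fps K[m]}]_(m, p) :=
  \matrix_(i, j) fps_der i (u 0 j).

End FormalMaps.

Arguments fid {K} n.
Notation "A \of u" := (mx_comp A u) (at level 50, left associativity).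

Section FormalManifolds.
Variable K : comNzRingType.

Definition formal_inverse m p (u : 'rV[{fps K[m]}]_p) (v : 'rV[{fps K[p]}]_m) :=
  [/\ pointed v, u \of v = fid p & v \of u = fid m].

Definition formal_iso m p (u : 'rV[{fps K[m]}]_p) :=
  pointed u /\ exists v, formal_inverse u v.

(* The bivector [P] encodes the biderivation with [{x_i, x_j} = P i j]. *)
Definition poisson_bracket n (P : 'M[{fps K[n]}]_n) (f h : {fps K[n]}) :=
  \sum_i \sum_j P i j * fps_der i f * fps_der j h.

Definition is_poisson n (P : 'M[{fps K[n]}]_n) :=
  [/\ forall f, poisson_bracket P f f = 0 &
      forall f g h, poisson_bracket P f (poisson_bracket P g h)
                  + poisson_bracket P g (poisson_bracket P h f)
                  + poisson_bracket P h (poisson_bracket P f g) = 0].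

Definition poisson_map m p (P : 'M[{fps K[m]}]_m) (Q : 'M[{fps K[p]}]_p)
    (u : 'rV[{fps K[m]}]_p) :=
  pointed u /\ forall f h,
    fps_comp (poisson_bracket Q f h) u
    = poisson_bracket P (fps_comp f u) (fps_comp h u).

(* The inverse of an invertible Poisson map is automatically Poisson. *)
Definition poisson_iso m p (P : 'M[{fps K[m]}]_m) (Q : 'M[{fps K[p]}]_p)
    (u : 'rV[{fps K[m]}]_p) :=
  poisson_map P Q u /\ formal_iso u.

Definition poisson_prod m p (P : 'M[{fps K[m]}]_m) (Q : 'M[{fps K[p]}]_p) :
    'M[{fps K[m + p]}]_(m + p) :=
  block_mx (P \of lsubmx (fid (m + p))) 0 0 (Q \of rsubmx (fid (m + p))).

End FormalManifolds.

(* The formal coordinates are arbitrary, centred at the unit. *)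

Record formal_group (K : comNzRingType) (n : nat) := FormalGroup {
  fg_mul : 'rV[{fps K[n + n]}]_n;
  fg_inv : 'rV[{fps K[n]}]_n;
  fg_mul_pointed : pointed fg_mul;
  fg_inv_pointed : pointed fg_inv;
  fg_mul1l : fg_mul \of row_mx 0 (fid n) = fid n;
  fg_mul1r : fg_mul \of row_mx (fid n) 0 = fid n;
  fg_mulA :
    let x := lsubmx (lsubmx (fid (n + n + n))) in
    let y := rsubmx (lsubmx (fid (n + n + n))) in
    let z := rsubmx (fid (n + n + n)) in
    fg_mul \of row_mx (fg_mul \of row_mx x y) z
    = fg_mul \of row_mx x (fg_mul \of row_mx y z);
  fg_mulVl : fg_mul \of row_mx fg_inv (fid n) = 0;
  fg_mulVr : fg_mul \of row_mx (fid n) fg_inv = 0 }.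

Section FormalGroups.
Variables (K : comNzRingType) (n : nat) (G : formal_group K n).

Definition gmul m (u v : 'rV[{fps K[m]}]_n) : 'rV[{fps K[m]}]_n :=
  fg_mul G \of row_mx u v.
Definition ginv m (u : 'rV[{fps K[m]}]_n) : 'rV[{fps K[m]}]_n :=
  fg_inv G \of u.

(* Structure constants of Lie(G): writing the group law as
   [x + y + B(x, y) + ..], the bracket is [B(x, y) - B(y, x)]. *)
Definition fg_lie (i j l : 'I_n) : K :=
  let mu := fg_mul G 0 l in
  mu (U_(lshift n i) + U_(rshift n j))%MM
  - mu (U_(lshift n j) + U_(rshift n i))%MM.

(* [E : Lie(G) -> G] is the exponential: [t |-> E(t x)] is the one-parameter
   subgroup with velocity [x]. Over an infinite ring it suffices to let the
   parameters range over [K]. *)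
Definition is_exponential (E : 'rV[{fps K[n]}]_n) :=
  let scaled (s : K) := fpsC n s *: fid n in
  [/\ pointed E, lin_part E = 1%:M
    & forall s t : K,
        E \of scaled (s + t) = gmul (E \of scaled s) (E \of scaled t)].

(* Matrix (acting on rows) of Ad(u), the differential at [y = 1] of
   [y |-> u y u^-1]. *)
Definition conj_map : 'rV[{fps K[n + n]}]_n :=
  gmul (fg_mul G) (ginv (lsubmx (fid (n + n)))).
Definition Ad m (u : 'rV[{fps K[m]}]_n) : 'M[{fps K[m]}]_n :=
  dsubmx (jac conj_map \of row_mx u 0).

(* Row [i] is [theta_i = u^-1 d_i u]: the velocity at [h = 0] of
   [h |-> u(lambda)^-1 u(lambda + h eps^i)]. *)
Definition log_der m (u : 'rV[{fps K[m]}]_n) : 'M[{fps K[m]}]_(m, n) :=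
  jac u *m dsubmx (jac (fg_mul G) \of row_mx (ginv u) u).

End FormalGroups.

(* [f : H -> G] is the formal group morphism integrating the linear map with
   matrix [A]. *)
Definition is_group_morphism (K : comNzRingType) (p n : nat)
    (H : formal_group K p) (G : formal_group K n)
    (A : 'M[K]_(p, n)) (f : 'rV[{fps K[p]}]_n) :=
  [/\ pointed f, lin_part f = A
    & f \of fg_mul H = gmul G (f \of lsubmx (fid (p + p)))
                              (f \of rsubmx (fid (p + p)))].

Record formal_poisson_lie_group (K : comNzRingType) (n : nat) :=
  FormalPoissonLieGroup {
    plg_group :> formal_group K n;
    plg_bivector : 'M[{fps K[n]}]_n;
    plg_poisson : is_poisson plg_bivector;
    plg_multiplicative :
      poisson_map (poisson_prod plg_bivector plg_bivector) plg_bivector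
                  (fg_mul plg_group) }.

(* [{x_i, x_j} = sum_l plg_linearization i j l * x_l + O(2)]; there is no
   constant term, by multiplicativity. *)
Definition plg_linearization (K : comNzRingType) (n : nat)
    (H : formal_poisson_lie_group K n) (i j l : 'I_n) : K :=
  plg_bivector H i j U_(l)%MM.

Definition lie_bracket (K : fieldType) (V : vectType K) (br : V -> V -> V) :=
  [/\ forall a x y z, br (a *: x + y) z = a *: br x z + br y z,
      forall a x y z, br z (a *: x + y) = a *: br z x + br z y,
      forall x, br x x = 0
    & forall x y z, br x (br y z) + br y (br z x) + br z (br x y) = 0].

Definition structure_constants (K : fieldType) (V : vectType K)
    (br : V -> V -> V) (n : nat) (e : n.-tuple V) (i j l : 'I_n) : K :=
  coord e l (br e`_i e`_j).

Section LieAlgebra.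
Variables (K : fieldType) (n : nat) (c : 'I_n -> 'I_n -> 'I_n -> K).

(* A matrix [M] stands for the tensor [sum_(i, j) M i j e_i (x) e_j]; this is
   [e_l (x) 1 + 1 (x) e_l, M]. *)
Definition ad_tensor (l : 'I_n) (M : 'M[K]_n) : 'M[K]_n :=
  \matrix_(i, j) \sum_a (c l a i * M a j + c l a j * M i a).

(* Coefficient of [e_i (x) e_j (x) e_l] in
   [r12, r13] + [r12, r23] + [r13, r23]. *)
Definition cybe (r : 'M[K]_n) (i j l : 'I_n) : K :=
  \sum_a \sum_b (r a j * r b l * c a b i
               + r i a * r b l * c a b j
               + r i a * r j b * c a b l).

Definition quasitriangular (r : 'M[K]_n) :=
  (forall l, ad_tensor l (r + r^T) = 0) /\ (forall i j l, cybe r i j l = 0).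

(* Structure constants of the dual of the coboundary cobracket:
   [eps^i, eps^j] = sum_l (dual_constants r i j l) eps^l. *)
Definition dual_constants (r : 'M[K]_n) (i j l : 'I_n) : K := ad_tensor l r i j.

(* Kirillov-Kostant-Souriau bivector on [g^*], with coordinates [x_i = e_i]. *)
Definition kks : 'M[{fps K[n]}]_n :=
  \matrix_(i, j) \sum_l fpsC n (c i j l) * fpsX K l.

(* [x |-> [v, x]], acting on rows. *)
Definition ad_mx m (v : 'rV[{fps K[m]}]_n) : 'M[{fps K[m]}]_n :=
  \matrix_(j, l) \sum_i v 0 i * fpsC m (c i j l).

End LieAlgebra.

Section AlekseevMeinrenken.
Variable K : fieldType.

(* Coefficients of the power series [b(z) / a(z)], for [a(0) != 0]. *)
Fixpoint quot_coefs (b a : nat -> K) (m : nat) : seq K :=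
  let s := if m is m'.+1 then quot_coefs b a m' else [::] in
  rcons s ((b m - \sum_(i < m) s`_i * a (m - i)%N) / a 0%N).
Definition series_quot (b a : nat -> K) (m : nat) : K := (quot_coefs b a m)`_m.

Lemma series_quotP (b a : nat -> K) (m : nat) : a 0%N != 0 ->
  \sum_(i < m.+1) series_quot b a i * a (m - i)%N = b m.
Proof.
move=> a0; have sz p : size (quot_coefs b a p) = p.+1.
  by elim: p => [//|p IH]; rewrite /= size_rcons IH.
have nthE p i : (i <= p)%N -> (quot_coefs b a p)`_i = series_quot b a i.
  elim: p => [|p IH]; first by rewrite leqn0 => /eqP ->.
  rewrite leq_eqVlt => /predU1P[-> //|lt_ip].
  by rewrite /= nth_rcons sz lt_ip IH.
rewrite big_ord_recr /= subnn.
suff -> : series_quot b a m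
    = (b m - \sum_(i < m) series_quot b a i * a (m - i)%N) / a 0%N.
  by rewrite divfK // addrC subrK.
rewrite /series_quot; case: m => [|m]; first by rewrite /= !big_ord0.
rewrite [in LHS]/= nth_rcons sz ltnn eqxx; congr ((_ - _) / _).
apply: eq_bigr => i _; have := ltn_ord i; rewrite ltnS => le_im.
by rewrite (nthE _ _ le_im).
Qed.

Definition cosh_half (m : nat) : K := if odd m then 0 else (2 ^ m * m`!)%:R^-1.
(* [2 sinh(z/2) / z] *)
Definition sinhc_half (m : nat) : K :=
  if odd m then 0 else (2 ^ m * m.+1`!)%:R^-1.

(* [phi(z) = -1/z + coth(z/2)/2]. As [z * coth(z/2)/2] is the quotient of the
   two series above, which starts with 1, subtracting [1/z] amounts to dropping
   the constant term of this quotient before dividing by [z]. *)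
Definition phi (m : nat) : K := series_quot cosh_half sinhc_half m.+1.

(* [sum_m a_m A^m] for [A] without constant terms: only the powers up to the
   degree of [mu] contribute to the coefficient of [mu]. *)
Definition mx_series (a : nat -> K) p n (A : 'M[{fps K[p]}]_n) :
    'M[{fps K[p]}]_n :=
  \matrix_(i, j) FPS (fun mu => \sum_(m < (mdeg mu).+1) a m * (A ^+ m) i j mu).

Definition tens p n (M : 'M[K]_n) : 'M[{fps K[p]}]_n := map_mx (fpsC p) M.

(* [lambda^vee = (lambda (x) id)(t)] *)
Definition vee n (t : 'M[K]_n) : 'rV[{fps K[n]}]_n := fid n *m tens n t.

Definition rho_AM n (c : 'I_n -> 'I_n -> 'I_n -> K) (t : 'M[K]_n) :
    'M[{fps K[n]}]_n :=
  tens n t *m mx_series phi (ad_mx c (vee t)).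

End AlekseevMeinrenken.

(** Formal maps [g^* -> G]. The coordinates on [g^*] are the basis elements
    [e_i], and those on [G] have differentials at 1 dual to [(e_i)]. *)

Section Maps.
Variables (K : fieldType) (n : nat) (c : 'I_n -> 'I_n -> 'I_n -> K).
Variables (G : formal_group K n) (E : 'rV[{fps K[n]}]_n).
Implicit Types (g al : 'rV[{fps K[n]}]_n) (r : 'M[K]_n).

Definition Map0 g := exists2 x : 'rV[{fps K[n]}]_n, pointed x & g = E \of x.

(* g1^-1 d2(g1) - g2^-1 d1(g2) - <id (x) id (x) lambda, [g1^-1 d3(g1), g2^-1 d3(g2)]> *)
Definition ham_defect g : 'M[{fps K[n]}]_n :=
  let th := log_der G g in th^T - th - th^T *m kks c *m th.

Definition Map0_ham al := Map0 al /\ ham_defect al = 0.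

Definition Ad2 m (u : 'rV[{fps K[m]}]_n) (M : 'M[{fps K[m]}]_n) :=
  (Ad G u)^T *m M *m Ad G u.

Definition vertex_IRF_eq r g :=
  let r0 := 2^-1 *: (r - r^T) in
  ham_defect g + Ad2 (ginv G g) (tens n r0) = rho_AM c (r + r^T).

(* [lambda |-> Ad^*(al(lambda))(lambda)]: its pairing with [e_l] is
   [<lambda, Ad(al(lambda)^-1) e_l>]. *)
Definition coad_map al : 'rV[{fps K[n]}]_n := fid n *m (Ad G (ginv G al))^T.

(* [(al * g)(lambda) = g(Ad^*(al(lambda))(lambda)) al(lambda)] *)
Definition gauge al g : 'rV[{fps K[n]}]_n := gmul G (g \of coad_map al) al.

(* [a(lambda) = g(lambda) exp(lambda^vee) g(lambda)^-1] *)
Definition a_map r g : 'rV[{fps K[n]}]_n :=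
  gmul G (gmul G g (E \of vee (r + r^T))) (ginv G g).

(* [b(u) = L(u) R(u)^-1] *)
Definition b_map (L R : 'rV[{fps K[n]}]_n) : 'rV[{fps K[n]}]_n :=
  gmul G L (ginv G R).

(* [y] is an isomorphism of formal Poisson manifolds [g^* -> H] such that
   [g(lambda) exp(lambda^vee) g(lambda)^-1 = L(y(lambda)) R(y(lambda))^-1]. *)
Definition is_gstar (H : formal_poisson_lie_group K n)
    (L R : 'rV[{fps K[n]}]_n) r g (y : 'rV[{fps K[n]}]_n) :=
  poisson_iso (kks c) (plg_bivector H) y /\
  a_map r g = gmul G (L \of y) (ginv G (R \of y)).

End Maps.

(* Main.v *)
(* Let [P] be the linear Poisson bivector of [g^*] and [P_H] that of [G^*]. The
   Semenov-Tian-Shansky bivector of [G] is, in the left trivialization and with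
   [A = Ad(u^-1)],
     [sts u = A^T r A + A^T r^T - r A - r^T].
   - Since [P_H] is multiplicative, [(log_der L)^T P_H (log_der R)] and its three
     analogues are 1-cocycles on [G^*]. The classical Yang-Baxter equation says
     that their linearizations are those of explicit coboundaries, with which
     they thus coincide; hence [b] sends [P_H] to [sts].
   - With [X = exp(lambda^vee)] and [z = ad(lambda^vee)], Euler's equation yields
     [Ad X = e^z] and [log_der X = t (1 - e^-z)/z]. Conjugating the equation
     satisfied by [g] with [Ad(X^-1) - 1], one gets that [a] sends [P] to [sts]
     as well.
   - The linear parts of [a] and [b] both equal [t]. So both maps are invertible
     and [b^-1 o a] is a Poisson isomorphism.
   - For [al] in [Map_0^ham], [tau = Ad^*(al) lambda] has Jacobian
     [(1 - log_der(al) P) Ad(al^-1)^T] and sends [P] to itself, and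
     [a_(al * g) = a_g o tau] by the naturality of the exponential. *)

Require Import Defs.
From HB Require Import structures.
From mathcomp Require Import all_boot all_order all_algebra.
From mathcomp Require Import mpoly ring.
From mathcomp Require boolp.

Set Implicit Arguments.
Unset Strict Implicit.
Unset Printing Implicit Defensive.

Import GRing.Theory.
Local Open Scope ring_scope.

(** * Formal power series *)

Section FpsTheory.
Variables (n : nat) (K : comNzRingType).
Implicit Types (f g h : {fps K[n]}) (m : 'X_{1..n}) (p q : {mpoly K[n]}).

Lemma fps_coefD f g m : (f + g) m = f m + g m. Proof. by []. Qed.
Lemma fps_coefN f m : (- f) m = - f m. Proof. by []. Qed.
Lemma fps_coefB f g m : (f - g) m = f m - g m. Proof. by []. Qed.
Lemma fps_coef0 m : (0 : {fps K[n]}) m = 0.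
Proof. by rewrite /= if_same. Qed.

Lemma fps_coefM f g m : (f * g) m =
  \sum_(d : 'X_{1..n < (mdeg m).+1, (mdeg m).+1} | m == (d.1 + d.2)%MM)
     f d.1 * g d.2.
Proof. by []. Qed.

Lemma fps_coef_sum I (r : seq I) (P : pred I) (F : I -> {fps K[n]}) m :
  (\sum_(i <- r | P i) F i) m = \sum_(i <- r | P i) F i m.
Proof. by apply: (big_morph (fun f : {fps K[n]} => f m)); rewrite ?fps_coef0. Qed.

Lemma fpsC_is_additive : zmod_morphism (@fpsC n K).
Proof.
by move=> a b; apply: fpsP => m; rewrite fps_coefB /=; case: eqP; rewrite ?subr0.
Qed.

Lemma fpsC_is_multiplicative : GRing.monoid_morphism (@fpsC n K).
Proof.
split=> // a b; apply: fpsP => m; rewrite fps_coefM /=.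
have [->|m0] := eqVneq m 0%MM.
  have lt0 : (mdeg (0 : 'X_{1..n})%MM < (mdeg (0 : 'X_{1..n})%MM).+1)%N by [].
  rewrite (bigD1 (BMultinom lt0, BMultinom lt0)) /= ?addm0 ?eqxx //.
  rewrite big1 ?addr0 // => -[[d1 l1] [d2 l2]] /= /andP[/eqP e] ne.
  case: eqP => [e1|]; last by rewrite mul0r.
  case: eqP => [e2|]; last by rewrite mulr0.
  by case/negP: ne; apply/eqP; congr (_, _); apply: val_inj.
rewrite big1 // => -[d1 d2] /= /eqP e.
case: eqP => [e1|]; last by rewrite mul0r.
case: eqP => [e2|]; last by rewrite mulr0.
by case/eqP: m0; rewrite e e1 e2 addm0.
Qed.

HB.instance Definition _ := GRing.isZmodMorphism.Build K {fps K[n]}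
  (@fpsC n K) fpsC_is_additive.
HB.instance Definition _ := GRing.isMonoidMorphism.Build K {fps K[n]}
  (@fpsC n K) fpsC_is_multiplicative.

Definition emb p : {fps K[n]} := FPS (fun m => p@_m).

Lemma emb_is_additive : zmod_morphism emb.
Proof. by move=> p q; apply: fpsP => m; rewrite fps_coefB /= mcoeffB. Qed.

Lemma emb_is_multiplicative : GRing.monoid_morphism emb.
Proof.
split=> [|p q]; apply: fpsP => m; last by rewrite /= mcoeffM.
by rewrite /= mcoeff1; case: eqP.
Qed.

HB.instance Definition _ := GRing.isZmodMorphism.Build {mpoly K[n]} {fps K[n]}
  emb emb_is_additive.
HB.instance Definition _ := GRing.isMonoidMorphism.Build {mpoly K[n]} {fps K[n]}
  emb emb_is_multiplicative.

Lemma embC a : emb a%:MP = fpsC n a.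
Proof. by apply: fpsP => m /=; rewrite mcoeffC; case: eqP => _; rewrite ?mulr1 ?mulr0. Qed.

Lemma embZ a p : emb (a *: p) = fpsC n a * emb p.
Proof. by rewrite -mul_mpolyC rmorphM /= embC. Qed.

Lemma embX i : emb 'X_i = fpsX K i.
Proof. by apply: fpsP => m /=; rewrite mcoeffX eq_sym. Qed.

Lemma emb_XE m : emb 'X_[m] = \prod_i fpsX K i ^+ m i.
Proof.
rewrite mpolyXE_id rmorph_prod; apply: eq_bigr => i _.
by rewrite rmorphXn /= embX.
Qed.

Definition ford d f := forall m, (mdeg m < d)%N -> f m = 0.

Lemma ford0 d : ford d 0. Proof. by move=> m _; rewrite fps_coef0. Qed.
Lemma ford_0 f : ford 0 f. Proof. by []. Qed.
Lemma fordD d f g : ford d f -> ford d g -> ford d (f + g).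
Proof. by move=> hf hg m lt; rewrite fps_coefD hf ?hg ?addr0. Qed.
Lemma fordN d f : ford d f -> ford d (- f).
Proof. by move=> hf m lt; rewrite fps_coefN hf ?oppr0. Qed.
Lemma fordB d f g : ford d f -> ford d g -> ford d (f - g).
Proof. by move=> hf hg; apply: fordD => //; apply: fordN. Qed.
Lemma ford_sum d I (r : seq I) (P : pred I) (F : I -> {fps K[n]}) :
  (forall i, P i -> ford d (F i)) -> ford d (\sum_(i <- r | P i) F i).
Proof. by move=> h; elim/big_ind: _ => //; [exact: ford0|exact: fordD]. Qed.
Lemma fordW d d' f : (d' <= d)%N -> ford d f -> ford d' f.
Proof. by move=> le hf m lt; apply: hf; apply: leq_trans le. Qed.

Lemma fordM d e f g : ford d f -> ford e g -> ford (d + e) (f * g).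
Proof.
move=> hf hg m lt; rewrite fps_coefM big1 // => -[d1 d2] /= /eqP em.
have [lt1|le1] := ltnP (mdeg d1) d; first by rewrite hf ?mul0r.
have [lt2|le2] := ltnP (mdeg d2) e; first by rewrite hg ?mulr0.
by have := leq_add le1 le2; rewrite -mdegD -(eqP (introT eqP em)) leqNgt lt.
Qed.

Lemma fordMl d f g : ford d g -> ford d (f * g).
Proof. by rewrite -[d]add0n; apply: fordM. Qed.
Lemma fordMr d f g : ford d f -> ford d (f * g).
Proof. by rewrite -{2}[d]addn0 => h; apply: fordM. Qed.

Lemma ford1 f : f 0%MM = 0 -> ford 1 f.
Proof. by move=> h m; rewrite ltnS leqn0 mdeg_eq0 => /eqP->. Qed.

Lemma fordX d f k : ford d f -> ford (k * d) (f ^+ k).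
Proof.
move=> h; elim: k => [|k IH]; first by rewrite mul0n.
by rewrite exprS mulSn; apply: fordM.
Qed.

Lemma ford_eq f g : (forall d, ford d (f - g)) -> f = g.
Proof.
move=> h; apply: fpsP => m; apply/eqP; rewrite -subr_eq0 -fps_coefB.
by apply/eqP/(h (mdeg m).+1).
Qed.

Lemma fps_coefM0 f g : (f * g) 0%MM = f 0%MM * g 0%MM.
Proof.
have h f' : ford 1 (f' - fpsC n (f' 0%MM)).
  by apply: ford1; rewrite fps_coefB /= eqxx subrr.
have -> : f * g = fpsC n (f 0%MM * g 0%MM) + (f - fpsC n (f 0%MM)) * g
  + fpsC n (f 0%MM) * (g - fpsC n (g 0%MM)) by rewrite rmorphM /=; ring.
rewrite !fps_coefD (fordMr _ (h f)) ?mdeg0 // (fordMl _ (h g)) ?mdeg0 //.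
by rewrite /= eqxx !addr0.
Qed.

Lemma ford_trunc d f : ford d (f - emb (fps_trunc d f)).
Proof. by move=> m lt; rewrite fps_coefB /= mcoeff_fps_trunc ?subrr. Qed.

Lemma fps_ind (S : {fps K[n]} -> Prop) :
  (forall a, S (fpsC n a)) -> (forall i, S (fpsX K i)) ->
  (forall f g, S f -> S g -> S (f + g)) ->
  (forall f g, S f -> S g -> S (f * g)) ->
  (forall f, (forall d, exists2 g, S g & ford d (f - g)) -> S f) ->
  forall f, S f.
Proof.
move=> hC hX hD hM hL f; apply: hL => d.
exists (emb (fps_trunc d f)); last exact: ford_trunc.
elim/mpolyind: (fps_trunc d f) => [|a m p _ _ IH].
  by rewrite rmorph0; apply: (hC 0).
rewrite rmorphD /= embZ emb_XE; apply/hD => //; apply: (hM) => //.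
elim/big_ind: _ => [|f1 g1|i _]; [exact: (hC 1)|exact: hM|].
by elim: (m i) => [|k IHk]; [exact: (hC 1)|rewrite exprS; apply: hM].
Qed.

Lemma fps_derD i : {morph @fps_der n K i : f g / f + g}.
Proof. by move=> f g; apply: fpsP => m /=; rewrite mulrnDl. Qed.
Lemma fps_derC i (a : K) : fps_der i (fpsC n a) = 0.
Proof.
apply: fpsP => m; rewrite fps_coef0 /= ifN ?mul0rn // -mdeg_eq0 mdegD mdeg1.
by rewrite addn1.
Qed.
Lemma fps_derX (i j : 'I_n) : fps_der i (fpsX K j) = (i == j)%:R.
Proof.
apply: fpsP => m; have [<-|ne] := eqVneq i j.
  rewrite /= -{2}[U_(i)%MM]add0m eqm_add2r; have [->|_] := eqVneq m 0%MM; by rewrite ?mnmE ?mul0rn.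
rewrite mulr0n fps_coef0 /=; case: eqP => [e|]; last by rewrite mul0rn.
move/(congr1 (fun m' : 'X_{1..n} => m' i)): e.
by rewrite mnmDE !mnm1E eqxx eq_sym (negPf ne) addn1.
Qed.
HB.instance Definition _ i := GRing.isNmodMorphism.Build {fps K[n]} {fps K[n]}
  (@fps_der n K i) (conj (fps_derC i 0) (@fps_derD i)).

Lemma ford_der d i f : ford d.+1 f -> ford d (fps_der i f).
Proof.
by move=> h m lt; rewrite /= h ?mul0rn // mdegD mdeg1 addn1 ltnS.
Qed.

Lemma fps_derM i f g : fps_der i (f * g) = fps_der i f * g + f * fps_der i g.
Proof.
have embD p : fps_der i (emb p) = emb p^`M(i).
  by apply: fpsP => m /=; rewrite mcoeff_deriv.
apply: ford_eq => d; set L := (X in ford d X).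
pose p := fps_trunc d.+1 f; pose q := fps_trunc d.+1 g.
have hf := @ford_trunc d.+1 f; have hg := @ford_trunc d.+1 g.
rewrite -/p -/q in hf hg.
have -> : L = (fps_der i (f * g - emb p * emb q)
    - (fps_der i (f - emb p) * g + (f - emb p) * fps_der i g
       + fps_der i (emb p) * (g - emb q) + emb p * fps_der i (g - emb q))).
  rewrite /L !raddfB /= -!rmorphM /= !embD mderivM rmorphD !rmorphM /=; ring.
apply: fordB.
  apply: ford_der; have -> : f * g - emb p * emb q
    = (f - emb p) * g + emb p * (g - emb q) by ring.
  by apply: fordD; [apply: fordMr|apply: fordMl].
apply: fordD; last by apply: fordMl; apply: ford_der.
apply: fordD; last by apply: fordMl; apply: fordW hg.
apply: fordD; first by apply: fordMr; apply: ford_der.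
by apply: fordMr; apply: fordW hf.
Qed.

Lemma fps_der_comm i j f : fps_der i (fps_der j f) = fps_der j (fps_der i f).
Proof.
apply: fpsP => m /=; rewrite -!mulrnA !mnmDE !mnm1E -!addmA [(U_(j) + _)%MM]addmC.
have [->//|ne] := eqVneq i j.
by rewrite !addn0 mulnC.
Qed.

Lemma coef_X_der i f m : (fpsX K i * fps_der i f) m = f m *+ m i.
Proof.
have [mi0|mi] := posnP (m i).
  rewrite mi0 mulr0n fps_coefM big1 // => -[d1 d2] /= /eqP em.
  case: eqP => [e|]; last by rewrite mul0r.
  by have := congr1 (fun m' : 'X_{1..n} => m' i) em; rewrite e mnmDE mnm1E eqxx mi0.
pose d := (mdeg m).+1.
have le : (U_(i) <= m)%MM by apply/mnm_lepP => j; rewrite mnm1E; case: eqP => // <-.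
have -> : (fpsX K i * fps_der i f) m = ('X_i * fps_trunc d (fps_der i f))@_m.
  by symmetry; apply: fps_mulEl => // m' _; rewrite mcoeffX eq_sym.
rewrite mulrC -[in LHS](submK le) addmC mcoeffMX mcoeff_fps_trunc /=; last first.
  by rewrite ltnS -{2}(submK le) mdegD leq_addr.
by rewrite submK // mnmBE mnm1E eqxx subn1 prednK.
Qed.

End FpsTheory.

(** * Composition, chain rule and formal inverses *)

Section Coefficients.
Variables (n : nat) (K : comNzRingType).
Implicit Types (f g h : {fps K[n]}) (m : 'X_{1..n}).

Lemma fps_coefCM a f m : (fpsC n a * f) m = a * f m.
Proof.
have {1}-> : (fpsC n a * f) m = (a%:MP * fps_trunc (mdeg m).+1 f)@_m.
  by symmetry; apply: fps_mulEl => // m' _; rewrite mcoeffC /=; case: eqP;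
    rewrite ?mulr1 ?mulr0.
by rewrite mcoeffCM mcoeff_fps_trunc.
Qed.

Lemma ford_prod I (r : seq I) (d : I -> nat) (F : I -> {fps K[n]}) :
  (forall i, ford (d i) (F i)) -> ford (\sum_(i <- r) d i)%N (\prod_(i <- r) F i).
Proof.
move=> h; elim: r => [|i r IH]; first by rewrite !big_nil.
by rewrite !big_cons; apply: fordM.
Qed.

End Coefficients.

Section Composition.
Variable K : comNzRingType.

Lemma pointed_ford m p (u : 'rV[{fps K[m]}]_p) i : pointed u -> ford 1 (u 0 i).
Proof. by move=> hu; apply: ford1. Qed.

Lemma fps_compD m p (f g : {fps K[p]}) (u : 'rV[{fps K[m]}]_p) :
  fps_comp (f + g) u = fps_comp f u + fps_comp g u.
Proof.
apply: fpsP => mu; rewrite fps_coefD /= -big_split /=.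
by apply: eq_bigr => nu _; rewrite mulrDl.
Qed.
Lemma fps_comp0 m p (u : 'rV[{fps K[m]}]_p) : fps_comp 0 u = 0.
Proof.
apply: fpsP => mu; rewrite fps_coef0 /= big1 // => nu _.
by rewrite if_same mul0r.
Qed.
Lemma fps_compN m p (f : {fps K[p]}) (u : 'rV[{fps K[m]}]_p) :
  fps_comp (- f) u = - fps_comp f u.
Proof. by apply/eqP; rewrite -addr_eq0 -fps_compD addNr fps_comp0. Qed.
Lemma fps_compB m p (f g : {fps K[p]}) (u : 'rV[{fps K[m]}]_p) :
  fps_comp (f - g) u = fps_comp f u - fps_comp g u.
Proof. by rewrite fps_compD fps_compN. Qed.
Lemma fps_comp_sum m p (u : 'rV[{fps K[m]}]_p) I (r : seq I) (P : pred I)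
    (F : I -> {fps K[p]}) :
  fps_comp (\sum_(i <- r | P i) F i) u = \sum_(i <- r | P i) fps_comp (F i) u.
Proof.
apply: (big_morph (fun f => fps_comp f u)) => [f g|]; first exact: fps_compD.
exact: fps_comp0.
Qed.

Lemma ford_comp d m p (f : {fps K[p]}) (u : 'rV[{fps K[m]}]_p) :
  ford d f -> ford d (fps_comp f u).
Proof.
move=> hf mu lt /=; rewrite big1 // => -[nu lnu] _ /=.
by rewrite hf ?mul0r //; apply: leq_trans lt.
Qed.

Section Pointed.
Variables (m p : nat) (u : 'rV[{fps K[m]}]_p).
Hypothesis hu : pointed u.

Let ev := mmap (fpsC m : K -> _) (u 0).

Let ev_ord d (q : {mpoly K[p]}) :
  (forall nu, (mdeg nu < d)%N -> q@_nu = 0) -> ford d (ev q).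
Proof.
move=> h; apply: ford_sum => nu _.
have [lt|le] := ltnP (mdeg nu) d.
  by rewrite h // rmorph0 mul0r; apply: ford0.
apply: fordMl; apply: (fordW le); rewrite mdegE; apply: ford_prod => i.
by rewrite -{1}[nu i]muln1; apply: fordX; apply: pointed_ford.
Qed.

Let comp_ev f mu : fps_comp f u mu = ev (fps_trunc (mdeg mu).+1 f) mu.
Proof.
rewrite /fps_trunc /ev raddf_sum fps_coef_sum /=; apply: eq_bigr => nu _.
by rewrite mmapZ mmapX fps_coefCM.
Qed.

Let comp_emb q : fps_comp (emb q) u = ev q.
Proof.
apply: fpsP => mu; rewrite comp_ev; apply/eqP; rewrite -subr_eq0 -fps_coefB.
rewrite -raddfB; apply/eqP; apply: (@ev_ord (mdeg mu).+1) => // nu lt.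
by rewrite mcoeffB mcoeff_fps_trunc // subrr.
Qed.

Lemma fps_compM f g : fps_comp (f * g) u = fps_comp f u * fps_comp g u.
Proof.
apply: ford_eq => d.
have hf := @ford_trunc _ _ d f; have hg := @ford_trunc _ _ d g.
set a := fps_trunc d f in hf; set b := fps_trunc d g in hg.
have -> : fps_comp f u = ev a + fps_comp (f - emb a) u.
  by rewrite -comp_emb -fps_compD addrC subrK.
have -> : fps_comp g u = ev b + fps_comp (g - emb b) u.
  by rewrite -comp_emb -fps_compD addrC subrK.
have -> : f * g = emb a * emb b + (f - emb a) * g + emb a * (g - emb b) by ring.
have evM : ev (a * b) = ev a * ev b by rewrite /ev rmorphM.
rewrite 2!fps_compD -rmorphM comp_emb evM.
set x := fps_comp ((f - _) * g) u; set y := fps_comp (emb a * _) u.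
have E (X Y P Q A B : {fps K[m]}) :
  X * Y + A + B - (X + P) * (Y + Q) = A + B - X * Q - P * (Y + Q) by ring.
rewrite E.
apply: fordB; last by apply: fordMr; apply: ford_comp.
apply: fordB; last by apply: fordMl; apply: ford_comp.
apply: fordD; apply: ford_comp; first exact: fordMr.
exact: fordMl.
Qed.

Lemma fps_compC a : fps_comp (fpsC p a) u = fpsC m a.
Proof. by rewrite -embC comp_emb /ev mmapC. Qed.

Lemma fps_comp1 : fps_comp 1 u = 1.
Proof. exact: (fps_compC 1). Qed.

Lemma fps_compX i : fps_comp (fpsX K i) u = u 0 i.
Proof. by rewrite -embX comp_emb /ev mmapX mmap1U. Qed.

Lemma fps_comp_coef0 f : fps_comp f u 0%MM = f 0%MM.
Proof.
have h : ford 1 (f - fpsC p (f 0%MM)).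
  by apply: ford1; rewrite fps_coefB /= eqxx subrr.
have := @ford_comp _ _ _ _ u h 0%MM; rewrite mdeg0 fps_compB fps_coefB fps_compC.
by rewrite [X in _ - X]/= eqxx => /(_ isT)/eqP; rewrite subr_eq0 => /eqP.
Qed.

End Pointed.

Lemma pointed_comp m p q (u : 'rV[{fps K[m]}]_p) (v : 'rV[{fps K[p]}]_q) :
  pointed u -> pointed v -> pointed (v \of u).
Proof. by move=> hu hv i; rewrite mxE fps_comp_coef0. Qed.

Lemma pointed0 m p : pointed (0 : 'rV[{fps K[m]}]_p).
Proof. by move=> i; rewrite mxE fps_coef0. Qed.

Lemma pointed_fid m : pointed (fid m : 'rV[{fps K[m]}]_m).
Proof.
by move=> i; rewrite mxE /= eq_sym -mdeg_eq0 mdeg1.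
Qed.

Lemma pointed_row_mx m p q (u : 'rV[{fps K[m]}]_p) (v : 'rV[{fps K[m]}]_q) :
  pointed u -> pointed v -> pointed (row_mx u v).
Proof. by move=> hu hv i; rewrite mxE; case: split. Qed.

Lemma pointed_mulmx m p q (u : 'rV[{fps K[m]}]_p) (A : 'M[{fps K[m]}]_(p, q)) :
  pointed u -> pointed (u *m A).
Proof.
move=> hu i; rewrite mxE fps_coef_sum big1 // => j _.
by rewrite fps_coefM0 hu mul0r.
Qed.

Lemma pointed_lsubmx m p q (u : 'rV[{fps K[m]}]_(p + q)) :
  pointed u -> pointed (lsubmx u).
Proof. by move=> hu i; rewrite mxE. Qed.
Lemma pointed_rsubmx m p q (u : 'rV[{fps K[m]}]_(p + q)) :
  pointed u -> pointed (rsubmx u).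
Proof. by move=> hu i; rewrite mxE. Qed.

Lemma fps_compA m p q (f : {fps K[q]}) (u : 'rV[{fps K[p]}]_q)
    (v : 'rV[{fps K[m]}]_p) : pointed u -> pointed v ->
  fps_comp (fps_comp f u) v = fps_comp f (u \of v).
Proof.
move=> hu hv; have huv := pointed_comp hv hu.
elim/fps_ind: f => [a|i|f g hf hg|f g hf hg|f h].
- by rewrite !fps_compC.
- by rewrite !fps_compX // mxE.
- by rewrite !fps_compD hf hg.
- by rewrite !fps_compM // hf hg.
apply: ford_eq => d; have [g hg ofg] := h d.
rewrite -(subrK g f); move: (f - g) ofg => e oe.
rewrite !fps_compD hg opprD addrACA subrr addr0.
by apply: fordB; do ?apply: ford_comp.
Qed.

Lemma mx_compA m p q s t (A : 'M[{fps K[q]}]_(s, t)) (u : 'rV[{fps K[p]}]_q)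
    (v : 'rV[{fps K[m]}]_p) : pointed u -> pointed v ->
  (A \of u) \of v = A \of (u \of v).
Proof. by move=> hu hv; apply/matrixP => i j; rewrite !mxE fps_compA. Qed.

Lemma fid_of m p (u : 'rV[{fps K[m]}]_p) : pointed u -> fid p \of u = u.
Proof. by move=> hu; apply/rowP => i; rewrite !mxE fps_compX. Qed.

Lemma fps_comp_fid m (f : {fps K[m]}) : fps_comp f (fid m) = f.
Proof.
have hf := @pointed_fid m.
elim/fps_ind: f => [a|i|f g ef eg|f g ef eg|f h].
- by rewrite fps_compC.
- by rewrite fps_compX // mxE.
- by rewrite fps_compD ef eg.
- by rewrite fps_compM // ef eg.
apply: ford_eq => d; have [g hg ofg] := h d.
rewrite -(subrK g f); move: (f - g) ofg => e oe.
rewrite fps_compD hg opprD addrACA subrr addr0.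
by apply: fordB => //; apply: ford_comp.
Qed.

Lemma mx_comp_fid m q s (A : 'M[{fps K[m]}]_(q, s)) : A \of fid m = A.
Proof. by apply/matrixP => i j; rewrite mxE fps_comp_fid. Qed.

Section MxComp.
Variables (m p : nat) (u : 'rV[{fps K[m]}]_p).

Lemma mx_compD q s (A B : 'M_(q, s)) : (A + B) \of u = (A \of u) + (B \of u).
Proof. by apply/matrixP => i j; rewrite !mxE fps_compD. Qed.
Lemma mx_compN q s (A : 'M_(q, s)) : (- A) \of u = - (A \of u).
Proof. by apply/matrixP => i j; rewrite !mxE fps_compN. Qed.
Lemma mx_compB q s (A B : 'M_(q, s)) : (A - B) \of u = (A \of u) - (B \of u).
Proof. by rewrite mx_compD mx_compN. Qed.
Lemma mx_comp0 q s : (0 : 'M_(q, s)) \of u = 0.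
Proof. by apply/matrixP => i j; rewrite !mxE fps_comp0. Qed.
Lemma mx_comp_tr q s (A : 'M_(q, s)) : A^T \of u = (A \of u)^T.
Proof. by apply/matrixP => i j; rewrite !mxE. Qed.
Lemma mx_comp_row q s t (A : 'M_(q, s)) (B : 'M_(q, t)) :
  row_mx A B \of u = row_mx (A \of u) (B \of u).
Proof. exact: map_row_mx. Qed.
Lemma mx_comp_lsub q s t (A : 'M_(q, s + t)) : lsubmx A \of u = lsubmx (A \of u).
Proof. exact: map_lsubmx. Qed.
Lemma mx_comp_rsub q s t (A : 'M_(q, s + t)) : rsubmx A \of u = rsubmx (A \of u).
Proof. exact: map_rsubmx. Qed.
Lemma mx_comp_usub q s t (A : 'M_(s + t, q)) : usubmx A \of u = usubmx (A \of u).
Proof. exact: map_usubmx. Qed.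
Lemma mx_comp_dsub q s t (A : 'M_(s + t, q)) : dsubmx A \of u = dsubmx (A \of u).
Proof. exact: map_dsubmx. Qed.

Hypothesis hu : pointed u.

Lemma mx_compM q s t (A : 'M_(q, s)) (B : 'M_(s, t)) :
  (A *m B) \of u = (A \of u) *m (B \of u).
Proof.
apply/matrixP => i j; rewrite !mxE fps_comp_sum.
by apply: eq_bigr => k _; rewrite fps_compM // !mxE.
Qed.
Lemma mx_comp1 q : (1%:M : 'M_q) \of u = 1%:M.
Proof.
by apply/matrixP => i j; rewrite !mxE; case: eqP => _; rewrite ?fps_comp1 ?fps_comp0.
Qed.

End MxComp.

Lemma fps_der_comp m p i (f : {fps K[p]}) (u : 'rV[{fps K[m]}]_p) : pointed u ->
  fps_der i (fps_comp f u)
  = \sum_j fps_der i (u 0 j) * fps_comp (fps_der j f) u.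
Proof.
move=> hu; elim/fps_ind: f => [a|l|f g hf hg|f g hf hg|f h].
- rewrite fps_compC // fps_derC big1 // => j _.
  by rewrite fps_derC fps_comp0 mulr0.
- rewrite fps_compX // (bigD1 l) //= fps_derX eqxx fps_comp1 // mulr1.
  rewrite big1 ?addr0 // => j ne; rewrite fps_derX (negPf ne).
  by rewrite fps_comp0 mulr0.
- rewrite fps_compD fps_derD hf hg -big_split; apply: eq_bigr => j _.
  by rewrite fps_derD fps_compD mulrDr.
- rewrite fps_compM // fps_derM hf hg mulr_suml mulr_sumr -big_split /=.
  apply: eq_bigr => j _; rewrite fps_derM fps_compD !fps_compM //; ring.
apply: ford_eq => d; have [g hg ofg] := h d.+1.
rewrite -(subrK g f); move: (f - g) ofg => e oe.
rewrite fps_compD fps_derD hg -addrA -sumrB.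
apply: fordD; first by apply: ford_der; apply: ford_comp.
apply: ford_sum => j _; rewrite fps_derD fps_compD mulrDr opprD addrCA.
rewrite subrr addr0; apply/fordN/fordMl/ford_comp.
exact: ford_der.
Qed.

Lemma jac_comp m p q (v : 'rV[{fps K[p]}]_q) (u : 'rV[{fps K[m]}]_p) :
  pointed u -> jac (v \of u) = jac u *m (jac v \of u).
Proof.
move=> hu; apply/matrixP => i j; rewrite !mxE fps_der_comp //.
by apply: eq_bigr => k _; rewrite !mxE.
Qed.

Lemma jac_row_mx m p q (u : 'rV[{fps K[m]}]_p) (v : 'rV[{fps K[m]}]_q) :
  jac (row_mx u v) = row_mx (jac u) (jac v).
Proof. by apply/matrixP => i j; rewrite !mxE; case: split => k; rewrite mxE. Qed.

Lemma jac_fid m : jac (fid m) = 1%:M :> 'M[{fps K[m]}]_m.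
Proof. by apply/matrixP => i j; rewrite !mxE fps_derX. Qed.

Lemma jac0 m p : jac (0 : 'rV[{fps K[m]}]_p) = 0.
Proof. by apply/matrixP => i j; rewrite !mxE raddf0. Qed.

Definition mxcoef m q s (mu : 'X_{1..m}) (A : 'M[{fps K[m]}]_(q, s)) : 'M[K]_(q, s) :=
  map_mx (fun f : {fps K[m]} => f mu) A.

Lemma mxcoef0M m q s t (A : 'M[{fps K[m]}]_(q, s)) (B : 'M_(s, t)) :
  mxcoef 0%MM (A *m B) = mxcoef 0%MM A *m mxcoef 0%MM B.
Proof.
apply/matrixP => i j; rewrite !mxE fps_coef_sum.
by apply: eq_bigr => k _; rewrite fps_coefM0 !mxE.
Qed.

Lemma mxcoef0_comp m p q s (A : 'M[{fps K[p]}]_(q, s)) (u : 'rV[{fps K[m]}]_p) :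
  pointed u -> mxcoef 0%MM (A \of u) = mxcoef 0%MM A.
Proof. by move=> hu; apply/matrixP => i j; rewrite !mxE fps_comp_coef0. Qed.

Lemma mxcoef0_jac m p (u : 'rV[{fps K[m]}]_p) : mxcoef 0%MM (jac u) = lin_part u.
Proof. by apply/matrixP => i j; rewrite !mxE /= add0m mnmE mulr1n. Qed.

End Composition.

#[local] Arguments fps_comp : simpl never.
#[local] Arguments fps_der : simpl never.
#[local] Arguments ford : simpl never.

Section MatrixOrder.
Variables (n : nat) (K : comNzRingType).

Definition mord d q s (A : 'M[{fps K[n]}]_(q, s)) := forall i j, ford d (A i j).

Lemma mordD d q s (A B : 'M_(q, s)) : mord d A -> mord d B -> mord d (A + B).
Proof. by move=> hA hB i j; rewrite mxE; apply: fordD. Qed.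
Lemma mordN d q s (A : 'M_(q, s)) : mord d A -> mord d (- A).
Proof. by move=> hA i j; rewrite mxE; apply: fordN. Qed.
Lemma mordB d q s (A B : 'M_(q, s)) : mord d A -> mord d B -> mord d (A - B).
Proof. by move=> hA hB; apply/mordD => //; apply: mordN. Qed.
Lemma mord0 d q s : mord d (0 : 'M_(q, s)).
Proof. by move=> i j; rewrite mxE; apply: ford0. Qed.
Lemma mordM d e q s t (A : 'M_(q, s)) (B : 'M_(s, t)) :
  mord d A -> mord e B -> mord (d + e) (A *m B).
Proof.
by move=> hA hB i j; rewrite mxE; apply: ford_sum => k _; apply: fordM.
Qed.
Lemma mordMr d q s t (A : 'M_(q, s)) (B : 'M_(s, t)) : mord d A -> mord d (A *m B).
Proof. by move=> h; rewrite -[d]addn0; apply: mordM => // i j; apply: ford_0. Qed.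
Lemma mordMl d q s t (A : 'M_(q, s)) (B : 'M_(s, t)) : mord d B -> mord d (A *m B).
Proof. by move=> h; rewrite -[d]add0n; apply: mordM => // i j; apply: ford_0. Qed.
Lemma mordW d d' q s (A : 'M_(q, s)) : (d' <= d)%N -> mord d A -> mord d' A.
Proof. by move=> le h i j; apply: fordW le _. Qed.
Lemma mord_eq q s (A B : 'M_(q, s)) : (forall d, mord d (A - B)) -> A = B.
Proof.
move=> h; apply/matrixP => i j; apply: ford_eq => d.
by have := h d i j; rewrite !mxE.
Qed.
Lemma mord_eq0 q s (A : 'M_(q, s)) :
  mxcoef 0%MM A = 0 -> (forall d, mord d.+1 A -> mord d.+2 A) -> A = 0.
Proof.
move=> h0 hS; apply: mord_eq => -[|d]; first by move=> i j; apply: ford_0.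
rewrite subr0; elim: d => [|d]; last exact: hS.
by move=> i j; apply: ford1; move/matrixP/(_ i j): h0; rewrite !mxE.
Qed.
Lemma mord1 q s (A : 'M_(q, s)) : mxcoef 0%MM A = 0 -> mord 1 A.
Proof. by move=> h i j; apply: ford1; move/matrixP/(_ i j): h; rewrite !mxE. Qed.
Lemma mord_pointed q (u : 'rV_q) : pointed u -> mord 1 u.
Proof. by move=> hu i j; rewrite ord1; apply: ford1. Qed.

End MatrixOrder.

Lemma mord_comp d m p q s (K : comNzRingType) (A : 'M[{fps K[p]}]_(q, s))
  (u : 'rV[{fps K[m]}]_p) : mord d A -> mord d (A \of u).
Proof. by move=> h i j; rewrite mxE; apply: ford_comp. Qed.

Section InverseFunction.
Variable K : comNzRingType.

Lemma ford_comp_sub d m p (f : {fps K[p]}) (v w : 'rV[{fps K[m]}]_p) :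
  pointed v -> pointed w -> mord d (v - w) ->
  ford d.+1 (fps_comp f v - fps_comp f w
             - \sum_j fpsC m (f U_(j)%MM) * (v 0 j - w 0 j)).
Proof.
move=> hv hw hd.
have ov j : ford d (v 0 j - w 0 j) by have := hd 0 j; rewrite !mxE.
have coefD (f1 g1 : {fps K[p]}) j : fpsC m ((f1 + g1) U_(j)%MM) * (v 0 j - w 0 j)
  = fpsC m (f1 U_(j)%MM) * (v 0 j - w 0 j) + fpsC m (g1 U_(j)%MM) * (v 0 j - w 0 j).
  by rewrite fps_coefD rmorphD mulrDl.
elim/fps_ind: f => [a|i|f g hf hg|f g hf hg|f h].
- rewrite !fps_compC // subrr sub0r; apply/fordN; rewrite big1 => [|j _].
    exact: ford0.
  by rewrite /= ifN ?raddf0 ?mul0r // -mdeg_eq0 mdeg1.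
- rewrite !fps_compX // (bigD1 i) //= eqxx rmorph1 mul1r big1 => [|j ne].
    by rewrite addr0 subrr; apply: ford0.
  rewrite (_ : _ == _ = false) ?raddf0 ?mul0r //; apply/eqP => e.
  move/(congr1 (fun m' : 'X_{1..p} => m' j)): e.
  by rewrite !mnm1E eqxx eq_sym (negPf ne).
- rewrite !fps_compD (eq_bigr _ (fun j _ => coefD f g j)) big_split.
  set x := \sum_j _ in hf *; set y := \sum_j _ in hg *.
  rewrite (_ : _ - (x + y) = (fps_comp f v - fps_comp f w - x)
    + (fps_comp g v - fps_comp g w - y)); last by ring.
  exact: fordD.
- rewrite !fps_compM //.
  have e j : fpsC m ((f * g) U_(j)%MM) * (v 0 j - w 0 j)
     = fpsC m (g 0%MM) * (fpsC m (f U_(j)%MM) * (v 0 j - w 0 j))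
     + fpsC m (f 0%MM) * (fpsC m (g U_(j)%MM) * (v 0 j - w 0 j)).
    have -> : (f * g) U_(j)%MM = f U_(j)%MM * g 0%MM + f 0%MM * g U_(j)%MM.
      have := congr1 (fun h : {fps K[p]} => h 0%MM) (fps_derM j f g).
      rewrite fps_coefD !fps_coefM0 /=.
      by rewrite add0m mnmE !mulr1n -fps_coefM.
    by rewrite rmorphD !rmorphM /=; ring.
  rewrite (eq_bigr _ (fun j _ => e j)) big_split /= -!mulr_sumr.
  set x := \sum_j _ in hf *; set y := \sum_j _ in hg *.
  have xd : ford d x by apply: ford_sum => j _; apply: fordMl.
  have yd : ford d y by apply: ford_sum => j _; apply: fordMl.
  have o1 (h : {fps K[p]}) (u : 'rV_p) : pointed u ->
      ford 1 (fps_comp h u - fpsC m (h 0%MM)).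
    move=> hu; apply: ford1; rewrite fps_coefB fps_comp_coef0 //.
    by rewrite /= eqxx subrr.
  have -> : fps_comp f v * fps_comp g v - fps_comp f w * fps_comp g w
     - (fpsC m (g 0%MM) * x + fpsC m (f 0%MM) * y)
   = (fps_comp f v - fps_comp f w - x) * fps_comp g v
     + fps_comp f w * (fps_comp g v - fps_comp g w - y)
     + x * (fps_comp g v - fpsC m (g 0%MM))
     + (fps_comp f w - fpsC m (f 0%MM)) * y by ring.
  apply: fordD; last by rewrite -add1n; apply: fordM => //; apply: o1.
  apply: fordD; last by rewrite -addn1; apply: fordM => //; apply: o1.
  by apply: fordD; [apply: fordMr|apply: fordMl].
have [g hg og] := h d.+2.
rewrite -(subrK g f); move: (f - g) og => e oe.
rewrite !fps_compD (eq_bigr _ (fun j _ => coefD e g j)) big_split; set y := \sum_j _ in hg *.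
set x := \sum_j _; rewrite (_ : _ - (x + y) = (fps_comp e v - fps_comp e w - x)
    + (fps_comp g v - fps_comp g w - y)); last by ring.
apply: fordD => //; apply: fordB.
  by apply: fordB; apply: ford_comp; apply: fordW oe.
apply: ford_sum => j _; rewrite oe ?mdeg1 // raddf0 mul0r.
exact: ford0.
Qed.

Lemma right_inverse_fun n (u : 'rV[{fps K[n]}]_n) (B : 'M[K]_n) :
  pointed u -> B *m lin_part u = 1%:M ->
  exists2 v : 'rV[{fps K[n]}]_n, pointed v & u \of v = fid n.
Proof.
move=> hu hB; pose tA := map_mx (fpsC n) (lin_part u).
pose tB := map_mx (fpsC n) B.
pose N := u - fid n *m tA.
have pf := @pointed_fid K n.
have hN : pointed N.
  move=> i; rewrite mxE fps_coefD hu add0r mxE fps_coefN.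
  by rewrite (pointed_mulmx tA pf) oppr0.
have compN (v : 'rV[{fps K[n]}]_n) : pointed v -> N \of v = u \of v - v *m tA.
  move=> hv; have tAv : tA \of v = tA.
    by apply/matrixP => i j; rewrite !mxE fps_compC.
  have fv := fid_of hv.
  rewrite /N mx_compB.
  rewrite (mx_compM hv).
  rewrite fv.
  by rewrite tAv.
have linN i j : N 0 j U_(i)%MM = 0.
  have e l : (fid n 0 l * tA l j) U_(i)%MM = lin_part u l j * (l == i)%:R.
    rewrite mulrC /tA [map_mx _ _ _ _]mxE fps_coefCM; congr (_ * _).
    by rewrite mxE /fpsX /= eq_mnm1 eq_sym.
  rewrite /N mxE fps_coefD mxE fps_coefN mxE fps_coef_sum.
  rewrite (eq_bigr _ (fun l _ => e l)) (bigD1 i) //= eqxx mulr1 big1.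
    by rewrite addr0 mxE subrr.
  by move=> l ne; rewrite (negPf ne) mulr0.
clearbody N.
have subN d (v w : 'rV[{fps K[n]}]_n) : pointed v -> pointed w -> mord d (v - w) ->
    mord d.+1 ((N \of v) - (N \of w)).
  move=> hv hw hd i j; rewrite ord1 !mxE.
  suff e : \sum_l fpsC n (N 0 j U_(l)%MM) * (v 0 l - w 0 l) = 0.
    by have h := ford_comp_sub (N 0 j) hv hw hd; rewrite e subr0 in h; apply: h.
  by rewrite big1 // => l _; rewrite linN raddf0 mul0r.
pose F (v : 'rV[{fps K[n]}]_n) := (fid n - (N \of v)) *m tB.
pose v_ k := iter k F 0.
have hF v : pointed v -> pointed (F v).
  move=> hv; apply: pointed_mulmx => i; rewrite mxE fps_coefD pf add0r mxE.
  by rewrite fps_coefN pointed_comp ?oppr0.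
have hv_ k : pointed (v_ k).
  by elim: k => [|k IH]; [apply: pointed0|apply: hF].
have FB v w : F v - F w = - ((N \of v) - (N \of w)) *m tB.
  rewrite /F -mulmxBl opprB [_ - fid n]addrC addrACA subrr add0r opprB.
  by rewrite [- _ + _]addrC.
have E k : v_ k.+1 = F (v_ k) by [].
have dv k : mord k.+1 (v_ k.+1 - v_ k).
  elim: k => [|k IH]; first by rewrite subr0; apply/mord_pointed/(hv_ 1%N).
  by rewrite [v_ k.+2]E [X in _ - X]E FB; apply/mordMr/mordN/subN => //; apply: hv_.
pose v : 'rV[{fps K[n]}]_n := \row_j FPS (fun mu => v_ (mdeg mu) 0 j mu).
have vv k : mord k.+1 (v - v_ k).
  move=> i j mu; rewrite ltnS ord1 !mxE fps_coefB /=.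
  elim: k => [|k IH]; first by rewrite leqn0 => /eqP->; rewrite subrr.
  rewrite leq_eqVlt ltnS => /predU1P[->|le]; first by rewrite subrr.
  have := dv k 0 j mu; rewrite ltnS => /(_ le).
  by rewrite !mxE fps_coefB => /eqP; rewrite subr_eq0 => /eqP->; apply: IH.
have hv : pointed v by move=> j; rewrite mxE /= mdeg0 /= mxE fps_coef0.
exists v => //.
have vF : v = F v.
  apply: mord_eq => d.
  have -> : v - F v = (v - v_ d.+1) + (F (v_ d) - F v) by rewrite -E addrA subrK.
  apply: mordD; first by apply: mordW (vv d.+1); rewrite !leqW.
  rewrite FB; apply/mordMr/mordN; apply: (@mordW _ _ d.+2); first by rewrite !leqW.
  by apply: subN => //; rewrite -opprB; apply: mordN.
have := compN v hv; have vtA : v *m tA = fid n - (N \of v).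
  by rewrite {1}vF /F -mulmxA -map_mxM hB map_mx1 mulmx1.
rewrite vtA => e; rewrite -[u \of v](subrK (fid n - (N \of v))) -e.
by rewrite addrC subrK.
Qed.

Lemma lin_part_comp m p q (v : 'rV[{fps K[p]}]_q) (u : 'rV[{fps K[m]}]_p) :
  pointed u -> lin_part (v \of u) = lin_part u *m lin_part v.
Proof.
by move=> hu; rewrite -!mxcoef0_jac jac_comp // mxcoef0M mxcoef0_comp.
Qed.

Lemma lin_part_fid n : lin_part (fid n) = 1%:M :> 'M[K]_n.
Proof.
by rewrite -mxcoef0_jac jac_fid; apply/matrixP => i j; rewrite !mxE; case: eqP;
  rewrite ?fps_coef0 //= eqxx.
Qed.

Lemma inverse_fun n (u : 'rV[{fps K[n]}]_n) (B : 'M[K]_n) :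
  pointed u -> B *m lin_part u = 1%:M -> exists v, formal_inverse u v.
Proof.
move=> hu hB; have [v hv uv] := right_inverse_fun hu hB.
have lv : lin_part u *m lin_part v = 1%:M.
  by apply: mulmx1C; rewrite -lin_part_comp // uv lin_part_fid.
have [w hw vw] := right_inverse_fun hv lv.
exists v; split=> //; suff -> : u = w by [].
by rewrite -[LHS]mx_comp_fid -vw -mx_compA // uv fid_of.
Qed.

End InverseFunction.

(** * Differential calculus on a formal group *)

Section MatrixDerivative.
Variable K : comNzRingType.

Definition mxder m (i : 'I_m) q s (A : 'M[{fps K[m]}]_(q, s)) : 'M_(q, s) :=
  map_mx (fps_der i) A.

Lemma mxderD m (i : 'I_m) q s (A B : 'M_(q, s)) :
  mxder i (A + B) = mxder i A + mxder i B.
Proof. by apply/matrixP => a b; rewrite !mxE fps_derD. Qed.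
Lemma mxderM m (i : 'I_m) q s t (A : 'M_(q, s)) (B : 'M_(s, t)) :
  mxder i (A *m B) = mxder i A *m B + A *m mxder i B.
Proof.
apply/matrixP => a b; rewrite !mxE raddf_sum -big_split /=.
by apply: eq_bigr => k _; rewrite fps_derM !mxE.
Qed.
Lemma mxder_tr m (i : 'I_m) q s (A : 'M_(q, s)) : mxder i A^T = (mxder i A)^T.
Proof. by apply/matrixP => a b; rewrite !mxE. Qed.
Lemma mxder_const m (i : 'I_m) q s (A : 'M[K]_(q, s)) :
  mxder i (map_mx (fpsC m) A) = 0.
Proof. by apply/matrixP => a b; rewrite !mxE fps_derC. Qed.
Lemma mxderZ m (i : 'I_m) q s f (A : 'M_(q, s)) :
  mxder i (f *: A) = fps_der i f *: A + f *: mxder i A.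
Proof. by apply/matrixP => a b; rewrite !mxE fps_derM. Qed.
Lemma mxder_sum m (i : 'I_m) q s I (r : seq I) (P : pred I) (F : I -> 'M_(q, s)) :
  mxder i (\sum_(j <- r | P j) F j) = \sum_(j <- r | P j) mxder i (F j).
Proof.
apply: (big_morph (@mxder m i q s)) => [A B|]; first exact: mxderD.
by apply/matrixP => a b; rewrite !mxE raddf0.
Qed.

Lemma mxder_comp m p (i : 'I_m) q s (A : 'M_(q, s)) (u : 'rV[{fps K[m]}]_p) :
  pointed u -> mxder i (A \of u) = \sum_j jac u i j *: (mxder j A \of u).
Proof.
move=> hu; apply/matrixP => a b; rewrite !mxE fps_der_comp // summxE.
by apply: eq_bigr => j _; rewrite !mxE.
Qed.

Lemma mxcoef0_der_comp m p (i : 'I_m) q s (A : 'M_(q, s))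
    (u : 'rV[{fps K[m]}]_p) : pointed u ->
  mxcoef 0%MM (mxder i (A \of u))
  = \sum_j lin_part u i j *: mxcoef 0%MM (mxder j A).
Proof.
move=> hu; rewrite mxder_comp //; apply/matrixP => a b; rewrite !mxE !summxE.
rewrite fps_coef_sum; apply: eq_bigr => j _; rewrite !mxE fps_coefM0.
rewrite fps_comp_coef0 //; congr (_ * _).
by rewrite /fps_der /= add0m mnmE mulr1n.
Qed.

Lemma mxcoefD m mu q s (A B : 'M[{fps K[m]}]_(q, s)) :
  mxcoef mu (A + B) = mxcoef mu A + mxcoef mu B.
Proof. by apply/matrixP => a b; rewrite !mxE. Qed.
Lemma mxcoefN m mu q s (A : 'M[{fps K[m]}]_(q, s)) : mxcoef mu (- A) = - mxcoef mu A.
Proof. by apply/matrixP => a b; rewrite !mxE. Qed.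
Lemma mxcoef0_1 m q : mxcoef 0%MM (1%:M : 'M[{fps K[m]}]_q) = 1%:M.
Proof.
by apply/matrixP => a b; rewrite !mxE; case: eqP; rewrite ?fps_coef0 //= eqxx.
Qed.
Lemma mxcoef_0 m mu q s : mxcoef mu (0 : 'M[{fps K[m]}]_(q, s)) = 0.
Proof. by apply/matrixP => a b; rewrite !mxE fps_coef0. Qed.
Lemma mxcoef0_const m q s (A : 'M[K]_(q, s)) : mxcoef 0%MM (map_mx (fpsC m) A) = A.
Proof. by apply/matrixP => a b; rewrite !mxE /= eqxx. Qed.
Lemma mxcoef_tr m mu q s (A : 'M[{fps K[m]}]_(q, s)) : mxcoef mu A^T = (mxcoef mu A)^T.
Proof. by apply/matrixP => a b; rewrite !mxE. Qed.
Lemma mxcoef0_pointed m q (u : 'rV[{fps K[m]}]_q) : pointed u -> mxcoef 0%MM u = 0.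
Proof. by move=> hu; apply/matrixP => a b; rewrite !mxE ord1 hu. Qed.

Lemma fps_comp_at0 m p (f : {fps K[p]}) :
  fps_comp f (0 : 'rV[{fps K[m]}]_p) = fpsC m (f 0%MM).
Proof.
have h0 := @pointed0 K m p.
elim/fps_ind: f => [a|i|f g hf hg|f g hf hg|f h].
- by rewrite fps_compC //= eqxx.
- by rewrite fps_compX // mxE /= eq_sym -mdeg_eq0 mdeg1 raddf0.
- by rewrite fps_compD hf hg -rmorphD.
- by rewrite fps_compM // hf hg -rmorphM fps_coefM0.
apply: ford_eq => d; have [g hg og] := h d.+1.
rewrite -(subrK g f); move: (f - g) og => e oe.
rewrite fps_compD hg fps_coefD rmorphD opprD addrACA subrr addr0.
apply: fordB; last by rewrite oe ?mdeg0 // raddf0; apply: ford0.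
by apply: ford_comp; apply: fordW oe.
Qed.

Lemma mx_comp_at0 m p q s (A : 'M[{fps K[p]}]_(q, s)) :
  A \of (0 : 'rV[{fps K[m]}]_p) = map_mx (fpsC m) (mxcoef 0%MM A).
Proof. by apply/matrixP => i j; rewrite !mxE fps_comp_at0. Qed.

Lemma mx_comp_const m p q s (A : 'M[K]_(q, s)) (u : 'rV[{fps K[m]}]_p) :
  pointed u -> map_mx (fpsC p) A \of u = map_mx (fpsC m) A.
Proof. by move=> hu; apply/matrixP => i j; rewrite !mxE fps_compC. Qed.

Lemma lin_part_row_mx m p q (u : 'rV[{fps K[m]}]_p) (v : 'rV[{fps K[m]}]_q) :
  lin_part (row_mx u v) = row_mx (lin_part u) (lin_part v).
Proof. by apply/matrixP => i j; rewrite !mxE; case: split => k; rewrite mxE. Qed.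
Lemma lin_part0 m p : lin_part (0 : 'rV[{fps K[m]}]_p) = 0.
Proof. by apply/matrixP => i j; rewrite !mxE fps_coef0. Qed.

Lemma jac_lfid p q : jac (lsubmx (fid (p + q)) : 'rV[{fps K[p + q]}]_p) = col_mx 1%:M 0.
Proof.
apply/matrixP => i j; rewrite !mxE fps_derX.
case: splitP => k ek; rewrite !mxE -!val_eqE /= ek //.
by rewrite gtn_eqF // ltn_addr.
Qed.
Lemma jac_rfid p q : jac (rsubmx (fid (p + q)) : 'rV[{fps K[p + q]}]_q) = col_mx 0 1%:M.
Proof.
apply/matrixP => i j; rewrite !mxE fps_derX.
case: splitP => k ek; rewrite !mxE -!val_eqE /= ek ?eqn_add2l //.
by rewrite ltn_eqF // ltn_addr.
Qed.

Lemma pointed_lfid p q : pointed (lsubmx (fid (p + q)) : 'rV[{fps K[p + q]}]_p).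
Proof. exact/pointed_lsubmx/pointed_fid. Qed.
Lemma pointed_rfid p q : pointed (rsubmx (fid (p + q)) : 'rV[{fps K[p + q]}]_q).
Proof. exact/pointed_rsubmx/pointed_fid. Qed.

Lemma lfid_of m p q (u : 'rV[{fps K[m]}]_p) (v : 'rV[{fps K[m]}]_q) :
  pointed u -> pointed v -> lsubmx (fid (p + q)) \of row_mx u v = u.
Proof.
move=> hu hv; rewrite mx_comp_lsub fid_of ?row_mxKl //.
exact: pointed_row_mx.
Qed.
Lemma rfid_of m p q (u : 'rV[{fps K[m]}]_p) (v : 'rV[{fps K[m]}]_q) :
  pointed u -> pointed v -> rsubmx (fid (p + q)) \of row_mx u v = v.
Proof.
move=> hu hv; rewrite mx_comp_rsub fid_of ?row_mxKr //.
exact: pointed_row_mx.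
Qed.

End MatrixDerivative.

Section GroupPoints.
Variables (K : comNzRingType) (n : nat) (G : formal_group K n).
Local Notation "u ** v" := (gmul G u v) (at level 40, left associativity).
Local Notation inv := (ginv G).

Lemma pointed_gmul m (u v : 'rV[{fps K[m]}]_n) : pointed u -> pointed v -> pointed (u ** v).
Proof. by move=> hu hv; apply: pointed_comp (fg_mul_pointed G); apply: pointed_row_mx. Qed.
Lemma pointed_ginv m (u : 'rV[{fps K[m]}]_n) : pointed u -> pointed (inv u).
Proof. by move=> hu; apply: pointed_comp (fg_inv_pointed G). Qed.
Hint Resolve pointed_gmul pointed_ginv pointed_row_mx pointed_fid pointed0
  pointed_lfid pointed_rfid fg_mul_pointed fg_inv_pointed : core.

Lemma gmul_of m p (u v : 'rV[{fps K[p]}]_n) (w : 'rV[{fps K[m]}]_p) :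
  pointed u -> pointed v -> pointed w ->
  (u ** v) \of w = (u \of w) ** (v \of w).
Proof. by move=> hu hv hw; rewrite /gmul mx_compA ?mx_comp_row //; auto. Qed.
Lemma ginv_of m p (u : 'rV[{fps K[p]}]_n) (w : 'rV[{fps K[m]}]_p) :
  pointed u -> pointed w -> inv u \of w = inv (u \of w).
Proof. by move=> hu hw; rewrite /ginv mx_compA. Qed.

Lemma gmul0g m (u : 'rV[{fps K[m]}]_n) : pointed u -> 0 ** u = u.
Proof.
move=> hu; have := congr1 (fun A => A \of u) (fg_mul1l G).
by rewrite /= mx_compA ?mx_comp_row ?mx_comp0 ?fid_of //; auto.
Qed.
Lemma gmulg0 m (u : 'rV[{fps K[m]}]_n) : pointed u -> u ** 0 = u.
Proof.
move=> hu; have := congr1 (fun A => A \of u) (fg_mul1r G).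
by rewrite /= mx_compA ?mx_comp_row ?mx_comp0 ?fid_of //; auto.
Qed.
Lemma gmulVg m (u : 'rV[{fps K[m]}]_n) : pointed u -> inv u ** u = 0.
Proof.
move=> hu; have := congr1 (fun A => A \of u) (fg_mulVl G).
by rewrite /= mx_compA ?mx_comp_row ?mx_comp0 ?fid_of //; auto.
Qed.
Lemma gmulgV m (u : 'rV[{fps K[m]}]_n) : pointed u -> u ** inv u = 0.
Proof.
move=> hu; have := congr1 (fun A => A \of u) (fg_mulVr G).
by rewrite /= mx_compA ?mx_comp_row ?mx_comp0 ?fid_of //; auto.
Qed.
Lemma gmulA m (u v w : 'rV[{fps K[m]}]_n) : pointed u -> pointed v -> pointed w ->
  u ** (v ** w) = u ** v ** w.
Proof.
move=> hu hv hw; have := congr1 (fun A => A \of row_mx (row_mx u v) w) (fg_mulA G).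
have hl : pointed (lsubmx (lsubmx (fid (n + n + n) : 'rV[{fps K[_]}]_(n+n+n)))).
  by apply/pointed_lsubmx.
have hr : pointed (rsubmx (lsubmx (fid (n + n + n) : 'rV[{fps K[_]}]_(n+n+n)))).
  by apply/pointed_rsubmx.
set x := lsubmx (lsubmx _) in hl *; set y := rsubmx (lsubmx _) in hr *.
set z := rsubmx _; have hz : pointed z by [].
have ex : x \of row_mx (row_mx u v) w = u.
  by rewrite mx_comp_lsub lfid_of ?row_mxKl; auto.
have ey : y \of row_mx (row_mx u v) w = v.
  by rewrite mx_comp_rsub lfid_of ?row_mxKr; auto.
have ez : z \of row_mx (row_mx u v) w = w by rewrite rfid_of; auto.
rewrite -!/(gmul G _ _) !gmul_of ?ex ?ey ?ez; auto.
Qed.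

Lemma gmulK m (u v : 'rV[{fps K[m]}]_n) : pointed u -> pointed v -> u ** v ** inv v = u.
Proof. by move=> hu hv; rewrite -gmulA ?gmulgV ?gmulg0; auto. Qed.
Lemma gmulKV m (u v : 'rV[{fps K[m]}]_n) : pointed u -> pointed v -> u ** inv v ** v = u.
Proof. by move=> hu hv; rewrite -gmulA ?gmulVg ?gmulg0; auto. Qed.
Lemma ginvK m (u : 'rV[{fps K[m]}]_n) : pointed u -> inv (inv u) = u.
Proof.
move=> hu; rewrite -[LHS]gmul0g; auto.
by rewrite -(gmulgV hu) gmulK; auto.
Qed.
Lemma ginvM m (u v : 'rV[{fps K[m]}]_n) : pointed u -> pointed v ->
  inv (u ** v) = inv v ** inv u.
Proof.
move=> hu hv; rewrite -[RHS](@gmulK _ _ (u ** v)); auto.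
by rewrite gmulA ?gmulKV ?gmulVg ?gmul0g; auto.
Qed.
Lemma ginv0 m : inv (0 : 'rV[{fps K[m]}]_n) = 0.
Proof. by rewrite -[LHS]gmulg0 ?gmulVg; auto. Qed.

Lemma gmulE m (u v : 'rV[{fps K[m]}]_n) : u ** v = fg_mul G \of row_mx u v.
Proof. by []. Qed.

#[local] Opaque gmul ginv mx_comp.

Definition mul_dl m (u v : 'rV[{fps K[m]}]_n) : 'M_n := usubmx (jac (fg_mul G) \of row_mx u v).
Definition mul_dr m (u v : 'rV[{fps K[m]}]_n) : 'M_n := dsubmx (jac (fg_mul G) \of row_mx u v).

Lemma mul_dl_of m p (u v : 'rV[{fps K[p]}]_n) (w : 'rV[{fps K[m]}]_p) :
  pointed u -> pointed v -> pointed w -> mul_dl u v \of w = mul_dl (u \of w) (v \of w).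
Proof. by move=> hu hv hw; rewrite /mul_dl mx_comp_usub mx_compA ?mx_comp_row; auto. Qed.
Lemma mul_dr_of m p (u v : 'rV[{fps K[p]}]_n) (w : 'rV[{fps K[m]}]_p) :
  pointed u -> pointed v -> pointed w -> mul_dr u v \of w = mul_dr (u \of w) (v \of w).
Proof. by move=> hu hv hw; rewrite /mul_dr mx_comp_dsub mx_compA ?mx_comp_row; auto. Qed.

Lemma jac_gmul m (u v : 'rV[{fps K[m]}]_n) : pointed u -> pointed v ->
  jac (u ** v) = jac u *m mul_dl u v + jac v *m mul_dr u v.
Proof.
move=> hu hv; rewrite gmulE jac_comp; last by auto.
by rewrite jac_row_mx -[in LHS](vsubmxK (jac (fg_mul G) \of _)) mul_row_col.
Qed.

Lemma mul_dlg0 m (u : 'rV[{fps K[m]}]_n) : pointed u -> mul_dl u 0 = 1%:M.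
Proof.
move=> hu; have hf := @pointed_fid K n; have h0 := @pointed0 K n n.
have := jac_gmul hf h0; rewrite gmulg0 // jac0 mul0mx addr0 jac_fid mul1mx.
move/(congr1 (fun A => A \of u)); rewrite mul_dl_of // mx_comp1 // fid_of // mx_comp0.
by [].
Qed.
Lemma mul_dr0g m (u : 'rV[{fps K[m]}]_n) : pointed u -> mul_dr 0 u = 1%:M.
Proof.
move=> hu; have hf := @pointed_fid K n; have h0 := @pointed0 K n n.
have := jac_gmul h0 hf; rewrite gmul0g // jac0 mul0mx add0r jac_fid mul1mx.
move/(congr1 (fun A => A \of u)); rewrite mul_dr_of // mx_comp1 // fid_of // mx_comp0.
by [].
Qed.

(* Differentiating [(ab)c = a(bc)] with respect to [a], [b] and [c]. *)
Lemma mul_d_assoc m (a b c : 'rV[{fps K[m]}]_n) : pointed a -> pointed b -> pointed c ->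
  [/\ mul_dl a b *m mul_dl (a ** b) c = mul_dl a (b ** c),
      mul_dr a b *m mul_dl (a ** b) c = mul_dl b c *m mul_dr a (b ** c)
    & mul_dr (a ** b) c = mul_dr b c *m mul_dr a (b ** c)].
Proof.
move=> ha hb hc.
have hl : pointed (lsubmx (lsubmx (fid (n + n + n) : 'rV[{fps K[_]}]_(n+n+n)))).
  by apply/pointed_lsubmx.
have hr : pointed (rsubmx (lsubmx (fid (n + n + n) : 'rV[{fps K[_]}]_(n+n+n)))).
  by apply/pointed_rsubmx.
set x := lsubmx (lsubmx _) in hl *; set y := rsubmx (lsubmx _) in hr *.
pose z : 'rV[{fps K[n + n + n]}]_n := rsubmx (fid (n + n + n)).
have hz : pointed z by exact: pointed_rfid.
have ex : x \of row_mx (row_mx a b) c = a.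
  by rewrite mx_comp_lsub lfid_of ?row_mxKl; auto.
have ey : y \of row_mx (row_mx a b) c = b.
  by rewrite mx_comp_rsub lfid_of ?row_mxKr; auto.
have ez : z \of row_mx (row_mx a b) c = c by rewrite rfid_of; auto.
have jl : forall q s t (A : 'M[{fps K[q]}]_(1, s + t)), jac (lsubmx A) = lsubmx (jac A).
  by move=> q s t A; apply/matrixP => i j; rewrite !mxE.
have jr : forall q s t (A : 'M[{fps K[q]}]_(1, s + t)), jac (rsubmx A) = rsubmx (jac A).
  by move=> q s t A; apply/matrixP => i j; rewrite !mxE.
have jx : jac x = col_mx (col_mx 1%:M 0) 0.
  rewrite jl jac_lfid; apply/matrixP => i j; rewrite !mxE.
  case: split => k; rewrite !mxE //.
  case: splitP => l el; rewrite !mxE -!val_eqE /= el //.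
  by rewrite gtn_eqF // ltn_addr.
have jy : jac y = col_mx (col_mx 0 1%:M) 0.
  rewrite jr jac_lfid; apply/matrixP => i j; rewrite !mxE.
  case: split => k; rewrite !mxE //.
  case: splitP => l el; rewrite !mxE -!val_eqE /= el ?eqn_add2l //.
  by rewrite ltn_eqF // ltn_addr.
have jz : jac z = col_mx 0 1%:M by rewrite jac_rfid.
have := congr1 (@jac _ _ _) (gmulA hl hr hz).
rewrite !jac_gmul; auto.
rewrite jx jy jz !(add_col_mx, mul_col_mx, mul1mx, mul0mx, addr0, add0r).
move=> /eq_col_mx[/eq_col_mx[e1 e2] e3].
have hw : pointed (row_mx (row_mx a b) c) by auto.
split; [move/esym: e1|move/esym: e2|move/esym: e3];
  move/(congr1 (fun A => A \of row_mx (row_mx a b) c));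
  rewrite ?mx_compM // ?mul_dl_of ?mul_dr_of ?gmul_of ?ex ?ey ?ez; auto.
Qed.

Lemma log_derE m (u : 'rV[{fps K[m]}]_n) : log_der G u = jac u *m mul_dr (inv u) u.
Proof. by []. Qed.

#[local] Opaque mul_dl mul_dr.

Lemma mul_dr_inv m (u : 'rV[{fps K[m]}]_n) : pointed u ->
  mul_dr (inv u) u *m mul_dr u 0 = 1%:M.
Proof.
move=> hu; have [] := mul_d_assoc hu (pointed_ginv hu) hu.
by rewrite gmulgV ?gmulVg // mul_dr0g // => _ _ ->.
Qed.

Lemma AdE m (u : 'rV[{fps K[m]}]_n) : pointed u ->
  Ad G u = mul_dr u 0 *m mul_dl u (inv u).
Proof.
move=> hu; rewrite /Ad /conj_map.
have -> : fg_mul G = lsubmx (fid (n + n)) ** rsubmx (fid (n + n)).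
  by rewrite gmulE hsubmxK mx_comp_fid.
set x := lsubmx _; set y := rsubmx _.
have hx : pointed x by exact: pointed_lfid.
have hy : pointed y by exact: pointed_rfid.
rewrite -mx_comp_dsub !jac_gmul; auto.
rewrite jac_comp // jac_lfid jac_rfid.
rewrite !(add_col_mx, mul_col_mx, mul1mx, mul0mx, addr0, add0r) col_mxKd.
rewrite mx_compM ?mul_dl_of ?mul_dr_of ?gmul_of ?ginv_of; auto.
by rewrite lfid_of ?rfid_of ?gmulg0; auto.
Qed.

Lemma Ad_of m p (u : 'rV[{fps K[p]}]_n) (w : 'rV[{fps K[m]}]_p) :
  pointed u -> pointed w -> Ad G u \of w = Ad G (u \of w).
Proof.
move=> hu hw; rewrite !AdE //; last by apply: pointed_comp.
by rewrite mx_compM ?mul_dl_of ?mul_dr_of ?ginv_of ?mx_comp0; auto.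
Qed.

Lemma log_der_of m p (u : 'rV[{fps K[p]}]_n) (w : 'rV[{fps K[m]}]_p) :
  pointed u -> pointed w -> log_der G (u \of w) = jac w *m (log_der G u \of w).
Proof.
move=> hu hw; rewrite !log_derE mx_compM // mul_dr_of ?ginv_of; auto.
by rewrite jac_comp // mulmxA.
Qed.

Lemma Ad0 m : Ad G (0 : 'rV[{fps K[m]}]_n) = 1%:M.
Proof. by rewrite AdE ?ginv0 ?mul_dlg0 ?mul_dr0g ?mulmx1; auto. Qed.

Lemma AdM m (u v : 'rV[{fps K[m]}]_n) : pointed u -> pointed v ->
  Ad G (u ** v) = Ad G v *m Ad G u.
Proof.
move=> hu hv; rewrite !AdE ?ginvM; auto.
have hiu := pointed_ginv hu; have hiv := pointed_ginv hv.
have [_ e1 _] := mul_d_assoc hu hv hiv.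
have [_ _ e2] := mul_d_assoc hu hv (@pointed0 K m n).
have [e3 _ _] := mul_d_assoc (pointed_gmul hu hv) hiv hiu.
have huv := pointed_gmul hu hv.
rewrite (gmulgV hv) in e1. rewrite (gmulg0 hv) in e2. rewrite (gmulK hu hv) in e3.
by rewrite e2 -e3 !mulmxA -[mul_dr v 0 *m _ *m mul_dr u 0]mulmxA -e1 !mulmxA.
Qed.

Lemma AdV m (u : 'rV[{fps K[m]}]_n) : pointed u -> Ad G (inv u) *m Ad G u = 1%:M.
Proof. by move=> hu; rewrite -AdM ?gmulgV ?Ad0; auto. Qed.
Lemma AdKV m (u : 'rV[{fps K[m]}]_n) : pointed u -> Ad G u *m Ad G (inv u) = 1%:M.
Proof. by move=> hu; rewrite -AdM ?gmulVg ?Ad0; auto. Qed.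

Lemma M_log_der m (u v : 'rV[{fps K[m]}]_n) : pointed u -> pointed v ->
  mul_dl u v *m mul_dr (inv (u ** v)) (u ** v) = mul_dr (inv u) u *m Ad G (inv v) /\
  mul_dr u v *m mul_dr (inv (u ** v)) (u ** v) = mul_dr (inv v) v.
Proof.
move=> hu hv; have hiu := pointed_ginv hu; have hiv := pointed_ginv hv.
rewrite (AdE hiv). rewrite (ginvK hv). rewrite (ginvM hu hv).
have [_ e1 e2] := mul_d_assoc (pointed_gmul hiv hiu) hu hv.
have [_ _ e3] := mul_d_assoc hiv hiu hu.
rewrite (gmulKV hiv hu) in e1. rewrite (gmulKV hiv hu) in e2. rewrite (gmulVg hu) in e3.
split; last by rewrite -e2.
by rewrite -e1 e3 mulmxA.
Qed.

Lemma log_der_mul m (u v : 'rV[{fps K[m]}]_n) : pointed u -> pointed v ->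
  log_der G (u ** v) = log_der G u *m Ad G (inv v) + log_der G v.
Proof.
move=> hu hv; have [e1 e2] := M_log_der hu hv.
by rewrite !log_derE jac_gmul // mulmxDl -!mulmxA e1 e2.
Qed.

Lemma log_der0 m : log_der G (0 : 'rV[{fps K[m]}]_n) = 0.
Proof. by rewrite log_derE jac0 mul0mx. Qed.

Lemma log_der_inv m (u : 'rV[{fps K[m]}]_n) : pointed u ->
  log_der G (inv u) = - (log_der G u *m Ad G u).
Proof.
move=> hu; apply/eqP; rewrite -addr_eq0 addrC -{2}(ginvK hu).
by rewrite -log_der_mul ?gmulgV ?log_der0; auto.
Qed.

End GroupPoints.

#[local] Transparent gmul ginv mx_comp mul_dl mul_dr.

Section PartialDerivatives.
Variables (K : comNzRingType) (p q : nat).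
Local Notation X := (lsubmx (fid (p + q)) : 'rV[{fps K[p + q]}]_p).
Local Notation Y := (rsubmx (fid (p + q)) : 'rV[{fps K[p + q]}]_q).

Lemma mxder_rX s t (A : 'M_(s, t)) j : mxder (rshift p j) (A \of X) = 0.
Proof.
rewrite mxder_comp ?big1 // => [l _|]; last exact: pointed_lfid.
by rewrite jac_lfid col_mxEd mxE scale0r.
Qed.
Lemma mxder_lY s t (A : 'M_(s, t)) j : mxder (lshift q j) (A \of Y) = 0.
Proof.
rewrite mxder_comp ?big1 // => [l _|]; last exact: pointed_rfid.
by rewrite jac_rfid col_mxEu mxE scale0r.
Qed.
Lemma mxder_lX s t (A : 'M_(s, t)) j : mxder (lshift q j) (A \of X) = mxder j A \of X.
Proof.
rewrite mxder_comp; last exact: pointed_lfid.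
rewrite jac_lfid (bigD1 j) //= col_mxEu mxE eqxx scale1r big1 ?addr0 // => l ne.
by rewrite col_mxEu mxE eq_sym (negPf ne) scale0r.
Qed.
Lemma mxder_rY s t (A : 'M_(s, t)) j : mxder (rshift p j) (A \of Y) = mxder j A \of Y.
Proof.
rewrite mxder_comp; last exact: pointed_rfid.
rewrite jac_rfid (bigD1 j) //= col_mxEd mxE eqxx scale1r big1 ?addr0 // => l ne.
by rewrite col_mxEd mxE eq_sym (negPf ne) scale0r.
Qed.
End PartialDerivatives.

Lemma mx_comp_sum (K : comNzRingType) m p q s (u : 'rV[{fps K[m]}]_p) I (r : seq I)
    (P : pred I) (F : I -> 'M[{fps K[p]}]_(q, s)) :
  (\sum_(i <- r | P i) F i) \of u = \sum_(i <- r | P i) (F i \of u).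
Proof.
apply: (big_morph (fun A : 'M_(q, s) => A \of u)) => [A B|]; first exact: mx_compD.
exact: mx_comp0.
Qed.
Lemma mx_compZ (K : comNzRingType) m p q s (u : 'rV[{fps K[m]}]_p) f
    (A : 'M[{fps K[p]}]_(q, s)) : pointed u ->
  (f *: A) \of u = fps_comp f u *: (A \of u).
Proof. by move=> hu; apply/matrixP => i j; rewrite !mxE fps_compM. Qed.

Section Adjoint.
Variables (K : fieldType) (n : nat) (G : formal_group K n).
Local Notation "u ** v" := (gmul G u v) (at level 40, left associativity).
Local Notation inv := (ginv G).
Local Notation c := (fg_lie G).
Local Notation X := (lsubmx (fid (n + n)) : 'rV[{fps K[n + n]}]_n).
Local Notation Y := (rsubmx (fid (n + n)) : 'rV[{fps K[n + n]}]_n).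

Definition ad_basis (l : 'I_n) : 'M[K]_n := \matrix_(j, k) c l j k.

Lemma ad_mxE m (v : 'rV[{fps K[m]}]_n) :
  ad_mx c v = \sum_l v 0 l *: map_mx (fpsC m) (ad_basis l).
Proof.
apply/matrixP => i j; rewrite !mxE summxE; apply: eq_bigr => l _.
by rewrite !mxE.
Qed.

Let U : 'M[{fps K[n]}]_n := Ad G (fid n).
Let U' l := mxcoef 0%MM (mxder l U).

Let pf := @pointed_fid K n.
Let p0 := @pointed0 K n n.
Let pX := @pointed_lfid K n n.
Let pY := @pointed_rfid K n n.

Let Ad_U m (u : 'rV[{fps K[m]}]_n) : pointed u -> Ad G u = U \of u.
Proof. by move=> hu; rewrite Ad_of // fid_of. Qed.

Let dU2 m (u : 'rV[{fps K[m]}]_n) j : pointed u ->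
  mxder j U \of u
  = \sum_l mul_dr G (inv u) u j l *: (map_mx (fpsC m) (U' l) *m Ad G u).
Proof.
move=> hu; have hiu := pointed_ginv G hu; have hw := pointed_row_mx hiu hu.
have pXY := pointed_gmul G pX pY.
have := congr1 (fun A => mxder (rshift n j) A) (AdM G pX pY).
rewrite (Ad_U pXY) (Ad_U pX) (Ad_U pY) mxderM mxder_rX mxder_rY mulmx0 addr0.
rewrite (mxder_comp _ _ pXY) => /(congr1 (fun A => A \of row_mx (inv u) u)).
rewrite (mx_compM hw) !(mx_compA _ _ hw) // (lfid_of hiu hu) (rfid_of hiu hu) mx_comp_sum.
move/(congr1 (fun A => A *m Ad G u)).
rewrite -(Ad_U hiu) -mulmxA (AdV G hu) mulmx1 => <-.
rewrite mulmx_suml; apply: eq_bigr => l _; rewrite (mx_compZ _ _ hw).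
rewrite (mx_compA _ pXY hw) (gmul_of G pX pY hw) (lfid_of hiu hu) (rfid_of hiu hu).
rewrite (gmulVg G hu) mx_comp_at0 -scalemxAl; congr (_ *: _).
rewrite (jac_gmul G pX pY) jac_lfid jac_rfid !mul_col_mx !mul0mx !mul1mx.
rewrite add_col_mx col_mxEd add0r.
have -> : forall A : 'M[{fps K[n + n]}]_n,
  fps_comp (A j l) (row_mx (inv u) u) = (A \of row_mx (inv u) u) j l.
  by move=> A; rewrite mxE.
by rewrite (mul_dr_of G pX pY hw) (lfid_of hiu hu) (rfid_of hiu hu).
Qed.

Let dU1 m (u : 'rV[{fps K[m]}]_n) j : pointed u ->
  mxder j U \of u
  = \sum_l mul_dl G u (inv u) j l *: (Ad G u *m map_mx (fpsC m) (U' l)).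
Proof.
move=> hu; have hiu := pointed_ginv G hu; have hw := pointed_row_mx hu hiu.
have pXY := pointed_gmul G pX pY.
have := congr1 (fun A => mxder (lshift n j) A) (AdM G pX pY).
rewrite (Ad_U pXY) (Ad_U pX) (Ad_U pY) mxderM mxder_lX mxder_lY mul0mx add0r.
rewrite (mxder_comp _ _ pXY) => /(congr1 (fun A => A \of row_mx u (inv u))).
rewrite (mx_compM hw) !(mx_compA _ _ hw) // (lfid_of hu hiu) (rfid_of hu hiu) mx_comp_sum.
move/(congr1 (fun A => Ad G u *m A)).
rewrite -(Ad_U hiu) mulmxA (AdKV G hu) mul1mx => <-.
rewrite mulmx_sumr; apply: eq_bigr => l _; rewrite (mx_compZ _ _ hw).
rewrite (mx_compA _ pXY hw) (gmul_of G pX pY hw) (lfid_of hu hiu) (rfid_of hu hiu).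
rewrite (gmulgV G hu) mx_comp_at0 -scalemxAr; congr (_ *: _).
rewrite (jac_gmul G pX pY) jac_lfid jac_rfid !mul_col_mx !mul0mx !mul1mx.
rewrite add_col_mx col_mxEu addr0.
have -> : forall A : 'M[{fps K[n + n]}]_n,
  fps_comp (A j l) (row_mx u (inv u)) = (A \of row_mx u (inv u)) j l.
  by move=> A; rewrite mxE.
by rewrite (mul_dl_of G pX pY hw) (lfid_of hu hiu) (rfid_of hu hiu).
Qed.

Definition mul_coef2 s t (k : 'I_n) : K := fps_der s (fps_der t (fg_mul G 0 k)) 0%MM.

Lemma mul_coef2C s t k : mul_coef2 s t k = mul_coef2 t s k.
Proof. by rewrite /mul_coef2 fps_der_comm. Qed.

Lemma fg_lieE i j k : c i j k
  = mul_coef2 (lshift n i) (rshift n j) k - mul_coef2 (lshift n j) (rshift n i) k.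
Proof.
by rewrite /fg_lie /mul_coef2 /fps_der /= !add0m !mnm1E !mnm0E !eq_lrshift !mulr1n.
Qed.

Lemma lin_part_mul : lin_part (fg_mul G) = col_mx 1%:M 1%:M.
Proof.
rewrite -mxcoef0_jac -[jac _]vsubmxK.
have /(congr1 (mxcoef 0%MM)) := mul_dlg0 G p0; rewrite /mul_dl row_mx0 -mx_comp_usub.
rewrite mxcoef0_comp ?mxcoef0_1; last exact: pointed0.
have /(congr1 (mxcoef 0%MM)) := mul_dr0g G p0; rewrite /mul_dr row_mx0 -mx_comp_dsub.
rewrite mxcoef0_comp ?mxcoef0_1; last exact: pointed0.
by move=> e2 e1; rewrite /mxcoef map_col_mx; congr col_mx; [apply: e1|apply: e2].
Qed.

Lemma mxcoef0_mul_dl m (u v : 'rV[{fps K[m]}]_n) : pointed u -> pointed v ->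
  mxcoef 0%MM (mul_dl G u v) = 1%:M.
Proof.
move=> hu hv; rewrite /mul_dl -mx_comp_usub mxcoef0_comp; last exact: pointed_row_mx.
by rewrite /mxcoef map_usubmx -/(mxcoef _ _) mxcoef0_jac lin_part_mul col_mxKu.
Qed.
Lemma mxcoef0_mul_dr m (u v : 'rV[{fps K[m]}]_n) : pointed u -> pointed v ->
  mxcoef 0%MM (mul_dr G u v) = 1%:M.
Proof.
move=> hu hv; rewrite /mul_dr -mx_comp_dsub mxcoef0_comp; last exact: pointed_row_mx.
by rewrite /mxcoef map_dsubmx -/(mxcoef _ _) mxcoef0_jac lin_part_mul col_mxKd.
Qed.

Lemma lin_part_ginv m (u : 'rV[{fps K[m]}]_n) : pointed u ->
  lin_part (inv u) = - lin_part u.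
Proof.
move=> hu; have hiu := pointed_ginv G hu.
have := congr1 (fun u => mxcoef 0%MM (jac u)) (gmulgV G hu).
rewrite /= (jac_gmul G hu hiu) jac0 mxcoef_0 mxcoefD !mxcoef0M.
rewrite mxcoef0_mul_dl // mxcoef0_mul_dr // !mulmx1 !mxcoef0_jac => /eqP.
by rewrite addrC addr_eq0 => /eqP.
Qed.

Lemma lin_part_gmul m (u v : 'rV[{fps K[m]}]_n) : pointed u -> pointed v ->
  lin_part (u ** v) = lin_part u + lin_part v.
Proof.
move=> hu hv; rewrite -[LHS]mxcoef0_jac (jac_gmul G hu hv) mxcoefD !mxcoef0M.
by rewrite mxcoef0_mul_dl // mxcoef0_mul_dr // !mulmx1 !mxcoef0_jac.
Qed.

Lemma M1_coef1 m (u v : 'rV[{fps K[m]}]_n) l j k : pointed u -> pointed v ->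
  mxder l (mul_dl G u v) j k 0%MM
  = \sum_s (lin_part u l s * mul_coef2 (lshift n s) (lshift n j) k
          + lin_part v l s * mul_coef2 (lshift n j) (rshift n s) k).
Proof.
move=> hu hv; rewrite /mul_dl -mx_comp_usub.
have := mxcoef0_der_comp l (usubmx (jac (fg_mul G))) (pointed_row_mx hu hv).
move/matrixP/(_ j k); rewrite mxE => ->.
rewrite summxE lin_part_row_mx big_split_ord [RHS]big_split.
congr (_ + _); apply: eq_bigr => s _.
  by rewrite mxE row_mxEl !mxE.
by rewrite mxE row_mxEr !mxE mul_coef2C.
Qed.
Lemma M2_coef1 m (u v : 'rV[{fps K[m]}]_n) l j k : pointed u -> pointed v ->
  mxder l (mul_dr G u v) j k 0%MM
  = \sum_s (lin_part u l s * mul_coef2 (lshift n s) (rshift n j) k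
          + lin_part v l s * mul_coef2 (rshift n s) (rshift n j) k).
Proof.
move=> hu hv; rewrite /mul_dr -mx_comp_dsub.
have := mxcoef0_der_comp l (dsubmx (jac (fg_mul G))) (pointed_row_mx hu hv).
move/matrixP/(_ j k); rewrite mxE => ->.
rewrite summxE lin_part_row_mx big_split_ord [RHS]big_split.
congr (_ + _); apply: eq_bigr => s _.
  by rewrite mxE row_mxEl !mxE.
by rewrite mxE row_mxEr !mxE.
Qed.

Let sum_delta l (F : 'I_n -> K) : \sum_s (1%:M : 'M[K]_n) l s * F s = F l.
Proof.
rewrite (bigD1 l) //= mxE eqxx mul1r big1 ?addr0 // => s ne.
by rewrite mxE eq_sym (negPf ne) mul0r.
Qed.

Lemma mul_coef2_ll l j k : mul_coef2 (lshift n l) (lshift n j) k = 0.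
Proof.
have := M1_coef1 l j k pf p0; rewrite mul_dlg0 // big_split /= lin_part_fid sum_delta.
rewrite lin_part0 [X in _ + X]big1 ?addr0 => [<-|s _]; last by rewrite mxE mul0r.
by rewrite mxE mxE; case: eqP; rewrite ?raddf0 ?fps_coef0 // (fps_derC _ 1) fps_coef0.
Qed.
Lemma mul_coef2_rr l j k : mul_coef2 (rshift n l) (rshift n j) k = 0.
Proof.
have := M2_coef1 l j k p0 pf; rewrite mul_dr0g // big_split /= lin_part_fid sum_delta.
rewrite lin_part0 [X in X + _]big1 ?add0r => [<-|s _]; last by rewrite mxE mul0r.
by rewrite mxE mxE; case: eqP; rewrite ?raddf0 ?fps_coef0 // (fps_derC _ 1) fps_coef0.
Qed.

Lemma Ad_coef1 l : U' l = ad_basis l.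
Proof.
have pif := pointed_ginv G pf.
rewrite /U' /U (AdE G pf) mxderM mxcoefD !mxcoef0M mxcoef0_mul_dl // mxcoef0_mul_dr //.
rewrite mulmx1 mul1mx; apply/matrixP => j k.
rewrite mxE mxE M2_coef1 // [in X in _ + X]mxE M1_coef1 //.
rewrite lin_part_ginv // lin_part0 lin_part_fid !big_split /= !sum_delta.
rewrite mul_coef2_ll [X in _ + X + _]big1 => [|s _]; last by rewrite mxE mul0r.
under [X in _ + (_ + X)]eq_bigr do rewrite mxE mulNr.
by rewrite sumrN sum_delta addr0 add0r mxE fg_lieE.
Qed.

Lemma der_Ad m (u : 'rV[{fps K[m]}]_n) i : pointed u ->
  mxder i (Ad G u) = ad_mx c (row i (log_der G u)) *m Ad G u.
Proof.
move=> hu; rewrite {1}(Ad_U hu) mxder_comp // ad_mxE mulmx_suml.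
under eq_bigr do rewrite dU2 // scaler_sumr.
rewrite exchange_big /=; apply: eq_bigr => l _.
under eq_bigr do rewrite scalerA.
rewrite -scaler_suml -scalemxAl Ad_coef1; congr (_ *: _).
by rewrite log_derE !mxE.
Qed.

Lemma ad_Ad m (u v : 'rV[{fps K[m]}]_n) : pointed u ->
  ad_mx c v *m Ad G u = Ad G u *m ad_mx c (v *m Ad G u).
Proof.
move=> hu; pose w := v *m mul_dr G u 0.
have wV : v = w *m mul_dr G (inv u) u.
  by rewrite -mulmxA (mulmx1C (mul_dr_inv G hu)) mulmx1.
have wR : v *m Ad G u = w *m mul_dl G u (inv u) by rewrite (AdE G hu) mulmxA.
rewrite wR {1}wV !ad_mxE mulmx_suml mulmx_sumr.
have e j : \sum_l mul_dr G (inv u) u j l *: (map_mx (fpsC m) (ad_basis l) *m Ad G u)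
  = \sum_l mul_dl G u (inv u) j l *: (Ad G u *m map_mx (fpsC m) (ad_basis l)).
  transitivity (mxder j U \of u).
    by rewrite (dU2 j hu); apply: eq_bigr => l _; rewrite Ad_coef1.
  by rewrite (dU1 j hu); apply: eq_bigr => l _; rewrite Ad_coef1.
transitivity (\sum_j w 0 j *: (\sum_l mul_dr G (inv u) u j l *:
    (map_mx (fpsC m) (ad_basis l) *m Ad G u))).
  under [RHS]eq_bigr do rewrite scaler_sumr; rewrite exchange_big /=.
  apply: eq_bigr => l _; rewrite mxE -scalemxAl scaler_suml.
  by apply: eq_bigr => j _; rewrite scalerA.
under eq_bigr do rewrite e scaler_sumr; rewrite exchange_big /=.
apply: eq_bigr => l _; rewrite [(w *m _) _ _]mxE -scalemxAr scaler_suml.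
by apply: eq_bigr => j _; rewrite scalerA.
Qed.

End Adjoint.

Lemma addmxE (V : zmodType) q s (A B : 'M[V]_(q, s)) i j : (A + B) i j = A i j + B i j.
Proof. by rewrite mxE. Qed.
Lemma oppmxE (V : zmodType) q s (A : 'M[V]_(q, s)) i j : (- A) i j = - A i j.
Proof. by rewrite mxE. Qed.

Section MaurerCartan.
Variables (K : fieldType) (n : nat) (G : formal_group K n).
Local Notation "u ** v" := (gmul G u v) (at level 40, left associativity).
Local Notation inv := (ginv G).
Local Notation c := (fg_lie G).

(* [log_der] is invariant under left translations: differentiate at [x = y] the
   expression of [log_der u] at [y] through [w(x, y) = u(x)^-1 u(y)]. *)
Lemma maurer_cartan m (u : 'rV[{fps K[m]}]_n) i j : pointed u ->
  mxder i (row j (log_der G u)) - mxder j (row i (log_der G u))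
  = - (row j (log_der G u) *m ad_mx c (row i (log_der G u))).
Proof.
move=> hu; set th := log_der G u.
pose X : 'rV[{fps K[m + m]}]_m := lsubmx (fid (m + m)).
pose Y : 'rV[{fps K[m + m]}]_m := rsubmx (fid (m + m)).
have pX : pointed X := @pointed_lfid K m m.
have pY : pointed Y := @pointed_rfid K m m.
have pf := @pointed_fid K m; have pfn := @pointed_fid K n.
have pif := pointed_ginv G pfn.
pose D : 'rV[{fps K[m]}]_(m + m) := row_mx (fid m) (fid m).
have pD : pointed D by apply: pointed_row_mx.
have XD : X \of D = fid m by apply: lfid_of.
have YD : Y \of D = fid m by apply: rfid_of.
have puX := pointed_comp pX hu; have puY := pointed_comp pY hu.
have piuX := pointed_ginv G puX.
pose w := inv (u \of X) ** (u \of Y).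
have pw : pointed w by apply: pointed_gmul.
have wD : w \of D = 0.
  rewrite /w (gmul_of G piuX puY pD) (ginv_of G puX pD) !(mx_compA _ _ pD) // XD YD.
  by rewrite mx_comp_fid gmulVg.
pose V : 'M[{fps K[n]}]_n := mul_dr G (inv (fid n)) (fid n).
have rowE k : row k th \of Y = row (rshift m k) (jac w) *m (V \of w).
  have Vw : V \of w = mul_dr G (inv w) w.
    by rewrite /V (mul_dr_of G pif pfn pw) (ginv_of G pfn pw) (fid_of pw).
  rewrite Vw -row_mul -log_derE (log_der_mul G piuX puY) (log_der_inv G puX).
  rewrite (log_der_of G hu pX) (log_der_of G hu pY) jac_lfid jac_rfid !mul_col_mx.
  rewrite !(mulNmx, mul_col_mx, mul0mx, mul1mx) opp_col_mx add_col_mx rowKd.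
  by rewrite oppr0 add0r; apply: map_row.
have V0 : V \of (w \of D) = 1%:M.
  by rewrite wD mx_comp_at0 mxcoef0_mul_dr // map_mx1.
have rowD k : row (rshift m k) (jac w) \of D = row k th.
  have := congr1 (fun A => A \of D) (rowE k).
  rewrite /= (mx_compA (row k th) pY pD) YD mx_comp_fid (mx_compM pD).
  by rewrite (mx_compA V pw pD) V0 mulmx1.
pose V' p := mxcoef 0%MM (mxder p V).
pose S a b := mxder (rshift m a) (row (rshift m b) (jac w)) \of D.
have SC a b : S a b = S b a.
  by rewrite /S; congr (_ \of _); apply/matrixP => x l; rewrite !mxE fps_der_comm.
have dE a b : mxder a (row b th)
    = S a b + row b th *m \sum_p th a p *: map_mx (fpsC m) (V' p).
  have := congr1 (fun A => mxder (rshift m a) A \of D) (rowE b).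
  rewrite /= mxder_rY (mx_compA _ pY pD) YD mx_comp_fid => ->.
  rewrite mxderM mx_compD !(mx_compM pD) (mx_compA _ pw pD) V0 mulmx1 rowD.
  congr (_ + _ *m _); rewrite (mxder_comp _ _ pw) mx_comp_sum.
  apply: eq_bigr => p _; rewrite (mx_compZ _ _ pD) (mx_compA _ pw pD) wD.
  rewrite mx_comp_at0; congr (_ *: _).
  by have /rowP/(_ p) := rowD a; rewrite !mxE.
rewrite !dE SC opprD addrACA subrr add0r.
have V'E p q l : V' p q l = - mul_coef2 G (lshift n p) (rshift n q) l.
  rewrite mxE M2_coef1 // lin_part_ginv // lin_part_fid (bigD1 p) //= big1.
    by rewrite addr0 !mxE eqxx mul_coef2_rr mulr0 addr0 mulN1r.
  by move=> s ne; rewrite mul_coef2_rr mulr0 !mxE eq_sym (negPf ne) oppr0 mul0r addr0.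
clear rowE rowD; clearbody th V'; apply/rowP => l.
have E a b : (row b th *m \sum_p th a p *: map_mx (fpsC m) (V' p)) 0 l
    = \sum_q \sum_p th b q * (th a p * fpsC m (V' p q l)).
  rewrite mxE; apply: eq_bigr => q _; rewrite summxE mulr_sumr.
  by apply: eq_bigr => p _; rewrite !mxE.
have E' : (row j th *m ad_mx c (row i th)) 0 l
    = \sum_q \sum_p th j q * (th i p * fpsC m (c p q l)).
  rewrite mxE; apply: eq_bigr => q _; rewrite !mxE mulr_sumr.
  by apply: eq_bigr => p _; rewrite mxE.
rewrite !(addmxE, oppmxE) !E E' [X in _ - X]exchange_big -sumrB -sumrN; apply: eq_bigr => q _.
rewrite -sumrB -sumrN; apply: eq_bigr => p _.
rewrite !V'E fg_lieE rmorphB !rmorphN /=; ring.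
Qed.

End MaurerCartan.

Section CharZero.
Variable K : fieldType.
Hypothesis char0 : [pchar K] =i pred0.

Lemma natr_neq0 k : k.+1%:R != 0 :> K.
Proof. by rewrite ((pcharf0P K).1 char0). Qed.

Lemma mulrn_eq0 (a : K) k : a *+ k.+1 = 0 -> a = 0.
Proof. by rewrite -mulr_natr => /eqP; rewrite mulf_eq0 (negPf (natr_neq0 k)) orbF => /eqP. Qed.

Lemma der0_const m (f : {fps K[m]}) :
  (forall i, fps_der i f = 0) -> f = fpsC m (f 0%MM).
Proof.
move=> h; apply: fpsP => mu /=; case: eqP => [->//|/eqP].
rewrite -mdeg_eq0 mdegE sum_nat_eq0 negb_forall => /existsP[i /=].
rewrite -lt0n => mi; have le : (U_(i) <= mu)%MM.
  by apply/mnm_lepP => j; rewrite mnm1E; case: eqP => // <-.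
have := congr1 (fun g : {fps K[m]} => g (mu - U_(i))%MM) (h i).
by rewrite fps_coef0 /fps_der /= submK // => /mulrn_eq0.
Qed.

Lemma mxder0_const m q s (A : 'M[{fps K[m]}]_(q, s)) :
  (forall i, mxder i A = 0) -> A = map_mx (fpsC m) (mxcoef 0%MM A).
Proof.
move=> h; apply/matrixP => a b; rewrite !mxE; apply: der0_const => i.
by have /matrixP/(_ a b) := h i; rewrite !mxE.
Qed.

Section InvariantTensor.
Variables (n : nat) (G : formal_group K n) (t : 'M[K]_n).
Hypothesis t_inv : forall l, ad_tensor (fg_lie G) l t = 0.

Lemma ad_tensorE l (M : 'M[K]_n) :
  ad_tensor (fg_lie G) l M = (ad_basis G l)^T *m M + M *m ad_basis G l.
Proof.
apply/matrixP => i j; rewrite !mxE -big_split; apply: eq_bigr => a _.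
by rewrite !mxE [_ * M i a]mulrC.
Qed.

Lemma ad_invariant m (v : 'rV[{fps K[m]}]_n) :
  (ad_mx (fg_lie G) v)^T *m tens m t = - (tens m t *m ad_mx (fg_lie G) v).
Proof.
apply/eqP; rewrite -addr_eq0 ad_mxE linear_sum mulmx_suml mulmx_sumr -big_split.
rewrite big1 // => l _; rewrite linearZ /= -scalemxAl -scalemxAr -scalerDr.
by rewrite map_trmx /tens -!map_mxM -map_mxD -ad_tensorE t_inv map_mx0 scaler0.
Qed.

Lemma Ad_invariant m (u : 'rV[{fps K[m]}]_n) : pointed u ->
  (Ad G u)^T *m tens m t *m Ad G u = tens m t.
Proof.
move=> hu; rewrite [LHS]mxder0_const => [|i].
  rewrite !mxcoef0M mxcoef_tr mxcoef0_const.
  suff -> : mxcoef 0%MM (Ad G u) = 1%:M by rewrite trmx1 mul1mx mulmx1.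
  have hiu := pointed_ginv G hu; have p0 := @pointed0 K m n.
  by rewrite (AdE G hu) mxcoef0M mxcoef0_mul_dl // mxcoef0_mul_dr // mulmx1.
rewrite !mxderM mxder_tr (mxder_const i t) mulmx0 addr0 !(der_Ad G i hu).
have := ad_invariant (row i (log_der G u)).
move: (ad_mx _ _) (Ad G u) (tens m t) => D A T e; rewrite trmx_mul.
transitivity (A^T *m (D^T *m T + T *m D) *m A).
  by rewrite mulmxDr mulmxDl !mulmxA.
by rewrite e addNr mulmx0 mul0mx.
Qed.

End InvariantTensor.

End CharZero.

(** * Power series in a matrix without constant term *)

Section EulerOperator.
Variables (K : comNzRingType) (m : nat).

Definition euler q s (A : 'M[{fps K[m]}]_(q, s)) : 'M_(q, s) :=
  \sum_i fpsX K i *: mxder i A.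

Lemma euler_coef q s (A : 'M_(q, s)) i j mu : euler A i j mu = A i j mu *+ mdeg mu.
Proof.
rewrite /euler summxE fps_coef_sum mdegE -sumrMnr; apply: eq_bigr => k _.
by rewrite !mxE coef_X_der.
Qed.

Lemma eulerD q s (A B : 'M_(q, s)) : euler (A + B) = euler A + euler B.
Proof.
by rewrite -big_split; apply: eq_bigr => i _; rewrite mxderD scalerDr.
Qed.
Lemma eulerN q s (A : 'M_(q, s)) : euler (- A) = - euler A.
Proof.
rewrite /euler -sumrN; apply: eq_bigr => i _; rewrite -scalerN; congr (_ *: _).
by apply/matrixP => a b; rewrite !mxE raddfN.
Qed.
Lemma eulerB q s (A B : 'M_(q, s)) : euler (A - B) = euler A - euler B.
Proof. by rewrite eulerD eulerN. Qed.
Lemma eulerM q s t (A : 'M_(q, s)) (B : 'M_(s, t)) :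
  euler (A *m B) = euler A *m B + A *m euler B.
Proof.
rewrite mulmx_suml mulmx_sumr -big_split; apply: eq_bigr => i _.
by rewrite mxderM scalerDr -scalemxAl -scalemxAr.
Qed.
Lemma euler_const q s (A : 'M[K]_(q, s)) : euler (map_mx (fpsC m) A) = 0.
Proof. by rewrite /euler big1 // => i _; rewrite mxder_const scaler0. Qed.
Lemma euler0 q s : euler (0 : 'M_(q, s)) = 0.
Proof. by rewrite -(subrr (0 : 'M_(q, s))) eulerB !subrr. Qed.
Lemma eulerZC q s a (A : 'M_(q, s)) : euler (fpsC m a *: A) = fpsC m a *: euler A.
Proof.
rewrite /euler scaler_sumr; apply: eq_bigr => i _.
by rewrite mxderZ fps_derC scale0r add0r !scalerA mulrC.
Qed.
Lemma mord_euler d q s (A : 'M_(q, s)) : mord d A -> mord d (euler A).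
Proof. by move=> h i j mu lt; rewrite euler_coef h ?mul0rn. Qed.

Lemma euler_row q (u : 'rV[{fps K[m]}]_q) : euler u = fid m *m jac u.
Proof.
rewrite mulmx_sum_row; apply: eq_bigr => i _.
by rewrite mxE; congr (_ *: _); apply/rowP => j; rewrite !mxE.
Qed.

End EulerOperator.

Section EulerChar0.
Variable K : fieldType.
Hypothesis char0 : [pchar K] =i pred0.

Lemma natmul_inj (a : K) p q : p != q -> a *+ p = a *+ q -> a = 0.
Proof.
have lt_case (i j : nat) : (i < j)%N -> a *+ i = a *+ j -> a = 0.
  move=> lt e; have d0 : (j - i = (j - i).-1.+1)%N by rewrite prednK // subn_gt0.
  apply: (@mulrn_eq0 K char0 a (j - i).-1); rewrite -d0.
  by rewrite mulrnBr ?(ltnW lt) // e subrr.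
by case: (ltngtP p q) => [lt _|lt _ /esym|->]; [apply: lt_case|apply: lt_case|].
Qed.

Lemma euler_eq0 m q s (A : 'M[{fps K[m]}]_(q, s)) :
  mxcoef 0%MM A = 0 -> (forall d, mord d.+1 A -> mord d.+2 (euler A)) -> A = 0.
Proof.
move=> h0 hS; apply: mord_eq0 => // d hd i j mu lt.
have := hS d hd i j mu lt; rewrite euler_coef.
have [->|] := eqVneq mu 0%MM; first by move/matrixP/(_ i j): h0; rewrite !mxE.
by rewrite -mdeg_eq0; case: (mdeg mu) => // k _ /(mulrn_eq0 char0).
Qed.

Lemma euler_plus1_eq0 m q s (A : 'M[{fps K[m]}]_(q, s)) :
  (forall d, mord d A -> mord d.+1 (euler A + A)) -> A = 0.
Proof.
move=> hS.
have step d : mord d A -> mord d.+1 A.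
  move=> hd i j mu lt; have := hS d hd i j mu lt.
  by rewrite addmxE fps_coefD euler_coef -mulrSr => /(mulrn_eq0 char0).
apply: mord_eq => d; rewrite subr0; elim: d => [|d]; last exact: step.
by move=> i j; apply: ford_0.
Qed.

End EulerChar0.

Lemma mx_conjX (R : comNzRingType) n (A B B' : 'M[R]_n) m : B' *m B = 1%:M ->
  (B *m A *m B') ^+ m = B *m A ^+ m *m B'.
Proof.
move=> BB; elim: m => [|m IH]; first by rewrite !expr0 mulmx1 (mulmx1C BB).
by rewrite !exprS IH -!mulmxE -!mulmxA (mulmxA B') BB mul1mx !mulmxA.
Qed.

Lemma mx_commuteX (R : comNzRingType) n (A Z : 'M[R]_n) m : A *m Z = Z *m A ->
  A ^+ m *m Z = Z *m A ^+ m.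
Proof.
move=> AZ; elim: m => [|m IH]; first by rewrite expr0 mul1mx mulmx1.
by rewrite exprS -!mulmxE -mulmxA IH !mulmxA AZ.
Qed.

Section MatrixSeries.
Variables (K : fieldType) (p n : nat).
Implicit Types (A : 'M[{fps K[p]}]_n) (a b : nat -> K).

Definition mx_psum a N A : 'M[{fps K[p]}]_n := \sum_(m < N) fpsC p (a m) *: A ^+ m.

Lemma mordX A m : mord 1 A -> mord m (A ^+ m).
Proof.
move=> hA; elim: m => [|m IH]; first by move=> i j; apply: ford_0.
by rewrite exprS -add1n; apply: mordM.
Qed.

Lemma mx_series_psum a A N : mord 1 A -> mord N (mx_series a A - mx_psum a N A).
Proof.
move=> hA i j mu lt; rewrite addmxE oppmxE fps_coefB mxE /=.
rewrite /mx_psum summxE fps_coef_sum.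
rewrite (big_ord_widen N (fun m => a m * (A ^+ m) i j mu)) //.
rewrite [X in _ - X](bigID (fun m : 'I_N => (m < (mdeg mu).+1)%N)) /=.
rewrite [X in _ - (_ + X)]big1 ?addr0 => [|m]; last first.
  by rewrite -leqNgt mxE fps_coefCM => le; rewrite mordX ?mulr0.
rewrite -sumrB big1 // => m _.
by rewrite mxE fps_coefCM subrr.
Qed.

End MatrixSeries.

Lemma mxsub_split3 (R : comNzRingType) q s (X Y Z Q T : 'M[R]_(q, s)) :
  X - (Y + Z) = X - (Q + T) - (Y - Q) - (Z - T).
Proof. by apply/matrixP => i j; rewrite !(addmxE, oppmxE); ring. Qed.

Lemma mxmul_split (R : comNzRingType) q (X Y P Q Z W : 'M[R]_q) :
  X *m Y - Z = (X - P) *m Y + P *m (Y - Q) + (P *m Q - W) - (Z - W).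
Proof.
rewrite mulmxBl mulmxBr; move: (X *m Y) (P *m Y) (P *m Q) => A B C.
by apply/matrixP => i j; rewrite !(addmxE, oppmxE); ring.
Qed.

Section MatrixSeriesMaps.
Variable K : fieldType.

Lemma mx_series_map p p' n n' q s t (L : 'M[{fps K[p]}]_n -> 'M[{fps K[q]}]_(s, t))
    (M : 'M[{fps K[p']}]_n' -> 'M[{fps K[q]}]_(s, t)) A B (a b : nat -> K) :
  mord 1 A -> mord 1 B ->
  L 0 = 0 -> M 0 = 0 ->
  {morph L : x y / x + y} -> {morph M : x y / x + y} ->
  (forall d Z, mord d Z -> mord d (L Z)) -> (forall d Z, mord d Z -> mord d (M Z)) ->
  (forall m, L (fpsC p (a m) *: A ^+ m) = M (fpsC p' (b m) *: B ^+ m)) ->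
  L (mx_series a A) = M (mx_series b B).
Proof.
move=> hA hB L0 M0 LD MD hL hM e; apply: mord_eq => N.
have hLs : L (mx_psum a N A) = M (mx_psum b N B).
  rewrite (big_morph _ LD L0) (big_morph _ MD M0).
  by apply: eq_bigr => m _; apply: e.
have -> : L (mx_series a A) = L (mx_series a A - mx_psum a N A) + L (mx_psum a N A).
  by rewrite -LD subrK.
have -> : M (mx_series b B) = M (mx_series b B - mx_psum b N B) + M (mx_psum b N B).
  by rewrite -MD subrK.
rewrite hLs opprD addrACA subrr addr0; apply: mordB; first exact/hL/mx_series_psum.
exact/hM/mx_series_psum.
Qed.

Section Fixed.
Variables (p n : nat) (A : 'M[{fps K[p]}]_n).
Hypothesis hA : mord 1 A.
Implicit Types a b : nat -> K.

Lemma mx_series_add a b :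
  mx_series (fun m => a m + b m) A = mx_series a A + mx_series b A.
Proof.
apply: mord_eq => N.
have -> : mx_series (fun m => a m + b m) A - (mx_series a A + mx_series b A)
  = (mx_series (fun m => a m + b m) A - mx_psum (fun m => a m + b m) N A)
    - (mx_series a A - mx_psum a N A) - (mx_series b A - mx_psum b N A).
  have -> : mx_psum (fun m => a m + b m) N A = mx_psum a N A + mx_psum b N A.
    by rewrite -big_split; apply: eq_bigr => m _; rewrite rmorphD scalerDl.
  exact: mxsub_split3.
by apply: mordB; [apply: mordB|]; apply: mx_series_psum.
Qed.

Lemma mx_series_opp a : mx_series (fun m => - a m) A = - mx_series a A.
Proof.
apply: (@mx_series_map p p n n p n n id (fun Z => - Z) A A) => //.
- exact: oppr0.
- exact: opprD.
- by move=> d Z hZ; apply: mordN.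
- by move=> m; rewrite rmorphN scaleNr.
Qed.

Lemma mx_series0 a : mxcoef 0%MM (mx_series a A) = (a 0%N)%:M.
Proof.
apply/matrixP => i j; rewrite !mxE /= mdeg0 big_ord1 expr0.
rewrite mxE; case: eqP => _; first by rewrite /= eqxx mulr1.
by rewrite fps_coef0 mulr0.
Qed.

Definition shift_coef a m := if m is m'.+1 then a m' else 0.

Lemma mulmx_series a : A *m mx_series a A = mx_series (shift_coef a) A.
Proof.
apply: mord_eq => N; apply: (@mordW _ _ N.+1) => //.
have e : A *m mx_psum a N A = mx_psum (shift_coef a) N.+1 A.
  rewrite /mx_psum big_ord_recl /= rmorph0 scale0r add0r mulmx_sumr.
  by apply: eq_bigr => m _; rewrite -scalemxAr /= /bump /= add1n exprS.
have -> : A *m mx_series a A - mx_series (shift_coef a) A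
  = A *m (mx_series a A - mx_psum a N A)
    - (mx_series (shift_coef a) A - mx_psum (shift_coef a) N.+1 A).
  by rewrite mulmxBr e addrC opprB addrA subrK [_ + A *m _]addrC.
apply: mordB; last exact: mx_series_psum.
by rewrite -add1n; apply: mordM => //; apply: mx_series_psum.
Qed.

Lemma mx_seriesC a : A *m mx_series a A = mx_series a A *m A.
Proof.
apply: (@mx_series_map p p n n p n n (fun Z => A *m Z) (fun Z => Z *m A) A A) => //.
- exact: mulmx0.
- exact: mul0mx.
- by move=> x y; rewrite mulmxDr.
- by move=> x y; rewrite mulmxDl.
- by move=> d Z; apply: mordMl.
- by move=> d Z; apply: mordMr.
- by move=> m; rewrite -scalemxAr -scalemxAl -[A *m _]exprS -[_ *m A]exprSr.
Qed.

Lemma mx_series_commute a b :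
  mx_series a A *m mx_series b A = mx_series b A *m mx_series a A.
Proof.
apply: (@mx_series_map p p n n p n n (fun Z => Z *m mx_series b A)
  (fun Z => mx_series b A *m Z) A A) => //.
- exact: mul0mx.
- exact: mulmx0.
- by move=> x y; rewrite mulmxDl.
- by move=> x y; rewrite mulmxDr.
- by move=> d Z; apply: mordMr.
- by move=> d Z; apply: mordMl.
move=> m; rewrite -scalemxAr -scalemxAl; congr (_ *: _).
exact: mx_commuteX (mx_seriesC b).
Qed.

Lemma mx_series_mul a b :
  mx_series a A *m mx_series b A
  = mx_series (fun m => \sum_(i < m.+1) a i * b (m - i)%N) A.
Proof.
set ab := fun m : nat => _; apply: mord_eq => N.
pose F i j := fpsC p (a i * b j) *: A ^+ (i + j).
have hF : mord N (mx_psum a N A *m mx_psum b N A - mx_psum ab N A).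
  have -> : mx_psum a N A *m mx_psum b N A = \sum_(i < N) \sum_(j < N) F i j.
    rewrite mulmx_suml; apply: eq_bigr => i _; rewrite mulmx_sumr.
    apply: eq_bigr => j _; rewrite -scalemxAr -scalemxAl scalerA /F rmorphM exprD.
    by rewrite mulrC.
  have -> : mx_psum ab N A
      = \sum_(i < N) \sum_(j < N | (i + j < N)%N) F i j.
    transitivity (\sum_(m < N) \sum_(i < N | (i <= m)%N) F i (m - i)%N).
      apply: eq_bigr => m _; rewrite rmorph_sum scaler_suml.
      rewrite (big_ord_widen N (fun i => fpsC p (a i * b (m - i)%N) *: A ^+ m)) //.
      by apply: eq_bigr => i; rewrite ltnS => le; rewrite /F subnKC.
    rewrite (exchange_big_dep xpredT) //=.
    apply: eq_bigr => i _.
    rewrite -[LHS](big_mkord (fun m => (i <= m)%N) (fun m => F i (m - i)%N)).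
    rewrite -[RHS](big_mkord (fun j => (i + j < N)%N) (fun j => F i j)).
    rewrite (@big_cat_nat _ _ _ i) //=; last exact: ltnW.
    rewrite big_nat_cond big_pred0 ?Monoid.mul1m => [|m]; last first.
      by apply/negbTE/negP => /andP[/andP[_ lt]]; rewrite leqNgt lt.
    rewrite [RHS](@big_cat_nat _ _ _ (N - i)) ?leq_subr //=.
    rewrite [X in _ = _ + X]big_nat_cond [X in _ = _ + X]big_pred0 ?addr0 => [|m];
      last first.
      by apply/negbTE/negP => /andP[/andP[le _]]; rewrite ltnNge -leq_subLR le.
    rewrite -{1}[i : nat]add0n big_addn big_nat_cond [RHS]big_nat_cond.
    apply: eq_big => [m|m _]; last by rewrite addnK.
    by rewrite leq_addl andbT -ltn_subRL; case: (m < N - i)%N; rewrite ?andbF.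
  rewrite -sumrB; elim/big_ind: _ => [|? ?|i _]; [exact: mord0|exact: mordD|].
  rewrite (bigID (fun j : 'I_N => (i + j < N)%N)) /= addrAC subrr add0r.
  elim/big_ind: _ => [|? ?|j]; [exact: mord0|exact: mordD|].
  rewrite -leqNgt => le x y; rewrite mxE.
  have h := fordW le (@mordX K p n A (i + j)%N hA x y).
  exact: (fordMl (fpsC p (a i * b j)) h).
have -> : mx_series a A *m mx_series b A - mx_series ab A
  = (mx_series a A - mx_psum a N A) *m mx_series b A
    + mx_psum a N A *m (mx_series b A - mx_psum b N A)
    + (mx_psum a N A *m mx_psum b N A - mx_psum ab N A)
    - (mx_series ab A - mx_psum ab N A).
  exact: mxmul_split.
apply: mordB; last exact: mx_series_psum.
apply: mordD => //; apply: mordD; first exact/mordMr/mx_series_psum.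
exact/mordMl/mx_series_psum.
Qed.

Lemma euler_mx_series a : euler A = A ->
  euler (mx_series a A) = mx_series (fun m => m%:R * a m) A.
Proof.
move=> eA.
have eX m : euler (A ^+ m) = fpsC p m%:R *: A ^+ m.
  elim: m => [|m IH].
    by rewrite rmorph0 scale0r expr0 -[1](map_mx1 (fpsC p : {rmorphism K -> _})) euler_const.
  rewrite exprS -mulmxE eulerM eA IH -scalemxAr mulrS.
  have -> : fpsC p (1 + m%:R : K) = 1 + fpsC p (m%:R : K) by rewrite rmorphD.
  by rewrite scalerDl scale1r.
apply: (@mx_series_map p p n n p n n (@euler K p n n) id A A) => //.
- exact: euler0.
- exact: eulerD.
- by move=> d Z; apply: mord_euler.
- by move=> m; rewrite eulerZC eX scalerA rmorphM mulrC.
Qed.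

Lemma tr_mx_series (T : 'M_n) a : A^T *m T = - (T *m A) ->
  (mx_series a A)^T *m T = T *m mx_series (fun m => (-1) ^+ m * a m) A.
Proof.
move=> h.
have hX m : (A ^+ m)^T *m T = fpsC p ((-1) ^+ m) *: (T *m A ^+ m).
  elim: m => [|m IH]; first by rewrite !expr0 trmx1 mul1mx mulmx1 rmorph1 scale1r.
  have -> : (A ^+ m.+1)^T = A^T *m (A ^+ m)^T by rewrite exprSr -trmx_mul.
  rewrite -mulmxA IH -scalemxAr (mulmxA A^T) h mulNmx -mulmxA.
  have -> : A *m A ^+ m = A ^+ m.+1 by rewrite exprS.
  by rewrite [(-1) ^+ m.+1]exprS mulN1r rmorphN scaleNr scalerN.
apply: (@mx_series_map p p n n p n n (fun Z => Z^T *m T) (fun Z => T *m Z) A A) => //.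
- by rewrite trmx0 mul0mx.
- exact: mulmx0.
- by move=> x y; rewrite linearD mulmxDl.
- by move=> x y; rewrite mulmxDr.
- by move=> d Z hZ; apply: mordMr => i j; rewrite mxE.
- by move=> d Z; apply: mordMl.
- by move=> m; rewrite linearZ /= -scalemxAl hX scalerA -scalemxAr rmorphM mulrC.
Qed.

Lemma mx_series_conj (B B' : 'M_n) a : B' *m B = 1%:M ->
  mx_series a (B *m A *m B') = B *m mx_series a A *m B'.
Proof.
move=> BB.
apply: (@mx_series_map p p n n p n n id (fun Z => B *m Z *m B') _ A) => //.
- exact/mordMr/mordMl.
- by rewrite mulmx0 mul0mx.
- by move=> x y; rewrite mulmxDr mulmxDl.
- by move=> d Z hZ; apply/mordMr/mordMl.
move=> m; rewrite -scalemxAr -scalemxAl; congr (_ *: _).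
exact: mx_conjX.
Qed.

End Fixed.

Lemma mx_series_of m p n (A : 'M[{fps K[p]}]_n) (u : 'rV[{fps K[m]}]_p) (a : nat -> K) :
  mord 1 A -> pointed u -> mx_series a A \of u = mx_series a (A \of u).
Proof.
move=> hA hu.
apply: (@mx_series_map p m n n m n n (fun Z => Z \of u) id A (A \of u)) => //.
- exact: mord_comp.
- exact: mx_comp0.
- by move=> x y; rewrite mx_compD.
- by move=> d Z; apply: mord_comp.
move=> k; rewrite mx_compZ // fps_compC //; congr (_ *: _).
elim: k => [|k IH]; first by rewrite !expr0 mx_comp1.
by rewrite !exprS -!mulmxE mx_compM // IH.
Qed.

End MatrixSeriesMaps.

(** * The exponential map *)

Section Scaling.
Variables (K : comNzRingType) (n : nat).

Definition scaling (s : K) : 'rV[{fps K[n]}]_n := fpsC n s *: fid n.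

Lemma pointed_scaling s : pointed (scaling s).
Proof. by move=> i; rewrite mxE fps_coefM0 pointed_fid mulr0. Qed.

Lemma fps_comp_scaling s (f : {fps K[n]}) mu :
  fps_comp f (scaling s) mu = s ^+ mdeg mu * f mu.
Proof.
have hs := pointed_scaling s.
elim/fps_ind: f mu => [a|i|f g hf hg|f g hf hg|f h] mu.
- rewrite fps_compC //=; case: eqP => [->|_]; last by rewrite mulr0.
  by rewrite mdeg0 mul1r.
- rewrite fps_compX // mxE fps_coefCM mxE /=; case: eqP => [->|_].
    by rewrite mdeg1.
  by rewrite !mulr0.
- by rewrite fps_compD !fps_coefD hf hg mulrDr.
- rewrite fps_compM // !fps_coefM mulr_sumr; apply: eq_bigr => -[d1 d2] /eqP em.
  have -> : s ^+ mdeg mu = s ^+ mdeg d1 * s ^+ mdeg d2 by rewrite -exprD -mdegD -em.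
  rewrite hf hg; ring.
have [g hg og] := h (mdeg mu).+1.
rewrite -(subrK g f); move: (f - g) og => e oe.
rewrite fps_compD !fps_coefD hg mulrDr (ford_comp _ oe) // oe //.
by rewrite mulr0.
Qed.

Lemma ford2 (f : {fps K[n]}) : f 0%MM = 0 ->
  (forall i, fps_der i f 0%MM = 0) -> ford 2 f.
Proof.
move=> f0 f1 mu; rewrite ltnS leq_eqVlt ltnS leqn0 => /orP[|]; last first.
  by rewrite mdeg_eq0 => /eqP->.
rewrite mdeg_eq1 => /existsP[i /eqP->].
by have := f1 i; rewrite /fps_der /= add0m mnm0E mulr1n.
Qed.

End Scaling.

Lemma double_Ad_identity (R : comNzRingType) q s (x : 'M[R]_(q, s)) (A : 'M_s) :
  (1 + 1) *: x *m (A *m A) - (1 + 1) *: x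
  = (1 + 1) *: ((1 + 1) *: (x *m A - x) + (x *m A - x) *m (A - 1%:M)).
Proof.
rewrite -scalemxAl -scalerBr !scalerDl !scale1r mulmxBr mulmx1 mulmxBl mulmxA.
move: (x *m A *m A) (x *m A) => u v.
by apply/matrixP => i j; rewrite !(addmxE, oppmxE); ring.
Qed.

Lemma double_log_der_identity (R : comNzRingType) q s (u h x : 'M[R]_(q, s)) :
  u + h - (1 + 1) *: x = (1 + 1) *: (h - x) + (u - x - (h - x)).
Proof.
by rewrite !scalerDl !scale1r; apply/matrixP => i j; rewrite !(addmxE, oppmxE); ring.
Qed.

Section Exponential.
Variable K : fieldType.
Hypothesis char0 : [pchar K] =i pred0.
Variables (n : nat) (G : formal_group K n) (E : 'rV[{fps K[n]}]_n).
Hypothesis E_exp : is_exponential G E.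
Local Notation c := (fg_lie G).
Local Notation x := (fid n : 'rV[{fps K[n]}]_n).

Lemma fg_lieN i j l : c i j l = - c j i l.
Proof. by rewrite /fg_lie opprB. Qed.

Lemma ad_mx_self m (v : 'rV[{fps K[m]}]_n) : v *m ad_mx c v = 0.
Proof.
apply/rowP => l; rewrite !mxE.
have e : \sum_j v 0 j * ad_mx c v j l
   = \sum_j \sum_i v 0 j * v 0 i * fpsC m (c i j l).
  apply: eq_bigr => j _; rewrite mxE mulr_sumr.
  by apply: eq_bigr => i _; rewrite mulrA.
have S0 : \sum_j v 0 j * ad_mx c v j l = - \sum_j v 0 j * ad_mx c v j l.
  rewrite {2}e exchange_big -sumrN e; apply: eq_bigr => i _; rewrite -sumrN.
  by apply: eq_bigr => j _; rewrite fg_lieN raddfN; ring.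
apply: fpsP => mu; rewrite fps_coef0.
apply: (@mulrn_eq0 K char0 _ 1); rewrite mulr2n -fps_coefD.
by rewrite {2}S0 subrr fps_coef0.
Qed.

Lemma pointed_exp : pointed E. Proof. by case: E_exp. Qed.
Let pE := pointed_exp.

Lemma exp_double : E \of scaling n (1 + 1) = gmul G E E.
Proof.
have s1 : fpsC n (1 : K) *: x = x by rewrite scale1r.
by case: E_exp => _ _ /(_ 1 1); rewrite s1 mx_comp_fid.
Qed.

Lemma mxcoef0_log_der m (u : 'rV[{fps K[m]}]_n) : pointed u ->
  mxcoef 0%MM (log_der G u) = lin_part u.
Proof.
move=> hu; have hiu := pointed_ginv G hu.
by rewrite log_derE mxcoef0M mxcoef0_mul_dr // mulmx1 mxcoef0_jac.
Qed.

Lemma mxcoef0_Ad m (u : 'rV[{fps K[m]}]_n) : pointed u -> mxcoef 0%MM (Ad G u) = 1%:M.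
Proof.
move=> hu; have hiu := pointed_ginv G hu; have p0 := @pointed0 K m n.
by rewrite (AdE G hu) mxcoef0M mxcoef0_mul_dl // mxcoef0_mul_dr // mulmx1.
Qed.

Lemma mxder_ad_mx m i (v : 'rV[{fps K[m]}]_n) :
  mxder i (ad_mx c v) = ad_mx c (mxder i v).
Proof.
rewrite !ad_mxE mxder_sum; apply: eq_bigr => l _.
by rewrite mxderZ mxder_const scaler0 addr0 mxE.
Qed.

Lemma ad_mx_sum m I (r : seq I) (P : pred I) (F : I -> 'rV[{fps K[m]}]_n) :
  ad_mx c (\sum_(i <- r | P i) F i) = \sum_(i <- r | P i) ad_mx c (F i).
Proof.
apply: (big_morph (@ad_mx K n c m)) => [u v|]; rewrite !ad_mxE.
  by rewrite -big_split; apply: eq_bigr => l _; rewrite mxE scalerDl.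
by rewrite big1 // => l _; rewrite mxE scale0r.
Qed.

Lemma ad_mxZ m f (v : 'rV[{fps K[m]}]_n) : ad_mx c (f *: v) = f *: ad_mx c v.
Proof.
by rewrite !ad_mxE scaler_sumr; apply: eq_bigr => l _; rewrite mxE scalerA.
Qed.

Let Ad_exp_order2 : mord 2 (Ad G E - 1%:M - ad_mx c x).
Proof.
have one : (1%:M : 'M[{fps K[n]}]_n) = map_mx (fpsC n) 1%:M.
  by apply/matrixP => i j; rewrite !mxE; case: eqP; rewrite ?raddf0 ?rmorph1.
have ad0 m (v : 'rV[{fps K[m]}]_n) : mxcoef 0%MM (ad_mx c v)
    = \sum_l v 0 l 0%MM *: ad_basis G l.
  apply/matrixP => i j; rewrite !mxE summxE fps_coef_sum.
  by apply: eq_bigr => l _; rewrite fps_coefM0 !mxE /= eqxx.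
move=> i j; apply: ford2 => [|k].
  have : mxcoef 0%MM (Ad G E - 1%:M - ad_mx c x) = 0.
    rewrite !mxcoefD !mxcoefN mxcoef0_Ad // mxcoef0_1 subrr add0r ad0.
    rewrite big1 ?oppr0 // => l _; have -> : x 0 l 0%MM = 0 by exact: (@pointed_fid K n l).
    by rewrite scale0r.
  by move/matrixP/(_ i j); rewrite !mxE.
have : mxcoef 0%MM (mxder k (Ad G E - 1%:M - ad_mx c x)) = 0.
  have derN (A : 'M[{fps K[n]}]_n) : mxder k (- A) = - mxder k A.
    by apply/matrixP => a b; rewrite !mxE raddfN.
  rewrite !mxderD !derN one mxder_const oppr0 addr0 (der_Ad G k pE) mxder_ad_mx.
  rewrite mxcoefD mxcoefN mxcoef0M mxcoef0_Ad // mulmx1 !ad0 -sumrB.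
  rewrite big1 // => l _; rewrite -scalerBl.
  have e : row k (log_der G E) 0 l 0%MM = (k == l)%:R.
    have <- : mxcoef 0%MM (log_der G E) k l = (k == l)%:R.
      rewrite (mxcoef0_log_der pE); case: E_exp => _ -> _.
      by rewrite mxE.
    have rE (A : 'M[{fps K[n]}]_n) : row k A 0 l = A k l by rewrite mxE.
    by rewrite rE [RHS]mxE.
  have -> : mxder k x 0 l 0%MM = (k == l)%:R.
    rewrite !mxE fps_derX; case: eqP => _ /=; by rewrite ?fps_coef0 ?eqxx.
  by rewrite e subrr scale0r.
by move/matrixP/(_ i j); rewrite !mxE.
Qed.

Let two_pow d e : d != e -> forall a : K, (1 + 1) ^+ d * a = (1 + 1) ^+ e * a -> a = 0.
Proof.
move=> de a; rewrite -[1 + 1]/(2%:R) -!natrX !mulr_natl; apply: natmul_inj => //.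
by rewrite eqn_exp2l.
Qed.

Let scaling_x : x \of scaling n (1 + 1) = fpsC n (1 + 1) *: x.
Proof. by rewrite (fid_of (@pointed_scaling K n (1 + 1))). Qed.

Let coef_double q s (A : 'M[{fps K[n]}]_(q, s)) i j mu :
  (A \of scaling n (1 + 1)) i j mu = (1 + 1) ^+ mdeg mu * A i j mu.
Proof. by rewrite mxE fps_comp_scaling. Qed.

(* By the doubling formula, [k = x . Ad(exp x) - x] satisfies
   [k(2x) = 4 k(x)] up to higher order terms, whereas [k] starts in degree 3. *)
Lemma exp_Ad_fixed : x *m Ad G E = x.
Proof.
have p2 := @pointed_scaling K n (1 + 1).
pose A := Ad G E; pose k := x *m A - x.
have mA : mord 1 (A - 1%:M).
  by apply: mord1; rewrite mxcoefD mxcoefN mxcoef0_Ad // mxcoef0_1 subrr.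
have k2 : k \of scaling n (1 + 1) = fpsC n (1 + 1) *: (fpsC n (1 + 1) *: k + k *m (A - 1%:M)).
  rewrite /k mx_compB (mx_compM p2) scaling_x (Ad_of G pE p2) exp_double (AdM G pE pE).
  have two : fpsC n (1 + 1 : K) = 1 + 1 by rewrite rmorphD.
  by rewrite /scaling two; apply: double_Ad_identity.
have k3 : mord 3 k.
  have -> : k = x *m (A - 1%:M - ad_mx c x).
    by rewrite !mulmxBr ad_mx_self mulmx1 subr0.
  rewrite -[3%N]/(1 + 2)%N; apply: mordM Ad_exp_order2.
  exact/mord_pointed/pointed_fid.
suff k0 : forall d, mord d.+3 k.
  apply: mord_eq => -[|[|[|d]]]; [|exact: (mordW _ k3)|exact: (mordW _ k3)|exact: k0].
  by move=> i j; apply: ford_0.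
elim=> // d IH i j mu lt.
have := coef_double k i j mu; rewrite k2.
have hz : (k *m (A - 1%:M)) i j mu = 0.
  by apply: (mordM IH mA); rewrite addn1.
rewrite mxE fps_coefCM addmxE fps_coefD hz addr0 mxE fps_coefCM mulrA -expr2.
have [ltd|] := ltnP (mdeg mu) d.+3; first by move=> _; apply: IH.
by case: (mdeg mu) => [|[|[|e]]] // _ /two_pow; apply.
Qed.

(* The doubling formula gives [h(2x) = h(x) (1 + Ad(exp(-x)))] for
   [h = x . log_der exp], whose only solution is [h = x]. *)
Lemma exp_log_der : x *m log_der G E = x.
Proof.
have p2 := @pointed_scaling K n (1 + 1); have piE := pointed_ginv G pE.
pose A := Ad G (ginv G E); pose h := x *m log_der G E; pose k := h - x.
have xA : x *m A = x by rewrite -{1}exp_Ad_fixed -mulmxA (AdKV G pE) mulmx1.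
have mA : mord 1 (A - 1%:M).
  by apply: mord1; rewrite mxcoefD mxcoefN mxcoef0_Ad // mxcoef0_1 subrr.
have h2 : h \of scaling n (1 + 1) = h *m A + h.
  rewrite (mx_compM p2) scaling_x -scalemxAl.
  have jac2 : jac (scaling n (1 + 1)) = fpsC n (1 + 1) *: (1%:M : 'M[{fps K[n]}]_n).
    rewrite -jac_fid; apply/matrixP => i j; rewrite !mxE fps_derM fps_derC.
    by rewrite mul0r add0r.
  have := log_der_of G pE p2.
  rewrite exp_double (log_der_mul G pE pE) jac2 -scalemxAl mul1mx.
  by move/(congr1 (fun Z => x *m Z)); rewrite mulmxDr mulmxA -scalemxAr => <-.
have k2 : k \of scaling n (1 + 1) = fpsC n (1 + 1) *: k + k *m (A - 1%:M).
  rewrite /k mx_compB scaling_x h2 mulmxBr mulmx1 mulmxBl xA.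
  have two : fpsC n (1 + 1 : K) = 1 + 1 by rewrite rmorphD.
  by rewrite /scaling two; apply: double_log_der_identity.
have k3 : mord 2 k.
  have -> : k = x *m (log_der G E - 1%:M) by rewrite mulmxBr mulmx1.
  rewrite -[2%N]/(1 + 1)%N; apply: mordM; first exact/mord_pointed/pointed_fid.
  apply: mord1; rewrite mxcoefD mxcoefN mxcoef0_log_der // mxcoef0_1.
  by case: E_exp => _ -> _; rewrite subrr.
suff k0 : forall d, mord d.+2 k.
  suff : k = 0 by move/eqP; rewrite subr_eq0 => /eqP.
  apply: mord_eq => -[|[|d]]; rewrite subr0; [|exact: (mordW _ k3)|exact: k0].
  by move=> i j; apply: ford_0.
elim=> // d IH i j mu lt.
have := coef_double k i j mu; rewrite k2.
have hz : (k *m (A - 1%:M)) i j mu = 0.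
  by apply: (mordM IH mA); rewrite addn1.
rewrite addmxE fps_coefD hz addr0 mxE fps_coefCM.
have [ltd|] := ltnP (mdeg mu) d.+2; first by move=> _; apply: IH.
by case: (mdeg mu) => [|[|e]] // _; rewrite -{1}[1 + 1]expr1 => /two_pow; apply.
Qed.

End Exponential.

Section HalfExponentials.
Variable K : fieldType.
Hypothesis char0 : [pchar K] =i pred0.

Lemma mx_half_inj m q s (A B : 'M[{fps K[m]}]_(q, s)) : A + A = B + B -> A = B.
Proof.
move/matrixP => e; apply/matrixP => i j; apply: fpsP => mu; apply/eqP.
have := congr1 (fun f : {fps K[m]} => f mu) (e i j).
rewrite !mxE !fps_coefD -!mulr2n => /eqP; rewrite -subr_eq0 -mulrnBl.
by move=> /eqP/(mulrn_eq0 char0)/eqP; rewrite subr_eq0.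
Qed.

Lemma eq_mx_series p n (A : 'M[{fps K[p]}]_n) (a b : nat -> K) :
  (forall m, a m = b m) -> mx_series a A = mx_series b A.
Proof.
move=> e; apply/matrixP => i j; rewrite !mxE; apply: fpsP => mu /=.
by apply: eq_bigr => m _; rewrite e.
Qed.

Lemma mx_series_delta0 p n (A : 'M[{fps K[p]}]_n) :
  mx_series (fun m => (m == 0)%:R) A = 1%:M.
Proof.
apply/matrixP => i j; rewrite [LHS]mxE; apply: fpsP => mu /=.
rewrite big_ord_recl big1 => [|m _]; last by rewrite mul0r.
by rewrite addr0 mul1r expr0.
Qed.

(* Coefficients of [exp(z/2)] and [exp(-z/2)]. *)
Definition exp_half (m : nat) : K := (2 ^ m * m`!)%:R^-1.
Definition exp_mhalf (m : nat) : K := (-1) ^+ m * exp_half m.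

Let natK k : (0 < k)%N -> k%:R != 0 :> K.
Proof. by case: k => // k _; apply: natr_neq0. Qed.

Let invK (a b k : nat) : (0 < a)%N -> (0 < b)%N -> (a = k * b)%N ->
  k%:R * a%:R^-1 = b%:R^-1 :> K.
Proof.
move=> a0 b0 e; apply: (mulIf (natK b0)); rewrite mulVf ?natK //.
by rewrite mulrAC -natrM -e divff ?natK.
Qed.

Let pf_gt0 m k : (0 < 2 ^ m * k`!)%N.
Proof. by rewrite muln_gt0 expn_gt0 fact_gt0. Qed.

Lemma coef_sinh m : shift_coef (sinhc_half K) m = exp_half m - exp_mhalf m.
Proof.
case: m => [|m]; first by rewrite /exp_mhalf expr0 mul1r subrr.
rewrite /= /sinhc_half /exp_mhalf -signr_odd /=; case: (odd m) => /=.
  by rewrite expr0 mul1r subrr.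
rewrite expr1 mulN1r opprK -mulr2n /exp_half -[RHS]mulr_natl.
symmetry; apply: invK => //.
by rewrite expnS -mulnA.
Qed.

Lemma coef_cosh m : cosh_half K m + cosh_half K m = exp_half m + exp_mhalf m.
Proof.
rewrite /cosh_half /exp_mhalf -signr_odd; case: (odd m) => /=.
  by rewrite expr1 mulN1r subrr addr0.
by rewrite expr0 mul1r.
Qed.

Lemma coef_euler_sinhc m :
  m%:R * sinhc_half K m + sinhc_half K m = cosh_half K m.
Proof.
rewrite /sinhc_half /cosh_half; case: (odd m); first by rewrite mulr0 addr0.
rewrite -{2}[_^-1]mul1r -mulrDl -[_ + 1](natrD K m 1) addn1; apply: invK => //.
by rewrite factS mulnCA.
Qed.

Lemma coef_euler_exp m :
  m%:R * exp_half m + m%:R * exp_half m = shift_coef exp_half m.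
Proof.
rewrite -mulrDl -natrD addnn -mul2n; case: m => [|m]; first by rewrite muln0 mul0r.
by apply: invK => //; rewrite expnS factS mulnACA.
Qed.

Lemma coef_euler_mexp m :
  m%:R * exp_mhalf m + m%:R * exp_mhalf m = - shift_coef exp_mhalf m.
Proof.
rewrite /exp_mhalf !(mulrCA m%:R) -mulrDr coef_euler_exp.
by case: m => [|m] /=; rewrite ?mulr0 ?oppr0 // exprS mulN1r mulNr.
Qed.

Variables (p n : nat) (D : 'M[{fps K[p]}]_n).
Hypotheses (D1 : mord 1 D) (eD : euler D = D).
Local Notation h := (mx_series exp_half D).
Local Notation h' := (mx_series exp_mhalf D).
Local Notation S := (mx_series (sinhc_half K) D).
Local Notation C := (mx_series (cosh_half K) D).
Local Notation Phi := (mx_series (phi K) D).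

Lemma mx_sinh : D *m S = h - h'.
Proof.
rewrite (mulmx_series D1) (eq_mx_series D coef_sinh).
by rewrite (mx_series_add D1) (mx_series_opp D1).
Qed.

Lemma mx_cosh : C + C = h + h'.
Proof. by rewrite -!(mx_series_add D1); apply: eq_mx_series => m; apply: coef_cosh. Qed.

Lemma euler_sinhc : euler S + S = C.
Proof.
rewrite (euler_mx_series D1 _ eD) -(mx_series_add D1).
by apply: eq_mx_series => m; apply: coef_euler_sinhc.
Qed.

Lemma euler_exp : euler h + euler h = D *m h.
Proof.
rewrite (euler_mx_series D1 _ eD) -(mx_series_add D1) (mulmx_series D1).
by apply: eq_mx_series => m; apply: coef_euler_exp.
Qed.

Lemma euler_mexp : euler h' + euler h' = - (D *m h').
Proof.
rewrite (euler_mx_series D1 _ eD) -(mx_series_add D1) (mulmx_series D1).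
by rewrite -(mx_series_opp D1); apply: eq_mx_series => m; apply: coef_euler_mexp.
Qed.

Lemma mx_phi : S + S *m (D *m Phi) = C.
Proof.
pose Q := series_quot (cosh_half K) (sinhc_half K).
have s0 : sinhc_half K 0 = 1 by rewrite /sinhc_half /= invr1.
have s0' : sinhc_half K 0 != 0 by rewrite s0 oner_eq0.
have QE : mx_series Q D = 1%:M + D *m Phi.
  rewrite (mulmx_series D1) -(mx_series_delta0 D) -(mx_series_add D1).
  apply: eq_mx_series => -[|m] /=; last by rewrite add0r.
  have := series_quotP (cosh_half K) 0 s0'; rewrite big_ord1 s0 mulr1 -/Q => ->.
  by rewrite addr0 /cosh_half /= invr1.
rewrite -{1}[S]mulmx1 -mulmxDr -QE (mx_series_commute D1) (mx_series_mul D1).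
by apply: eq_mx_series => m; apply: series_quotP.
Qed.

Lemma mx_expV : h *m h' = 1%:M.
Proof.
have hC := mx_seriesC D1 exp_half.
apply/eqP; rewrite -subr_eq0; apply/eqP; apply: (euler_eq0 char0).
  rewrite mxcoefD mxcoefN mxcoef0_1 mxcoef0M !mx_series0.
  by rewrite /exp_mhalf /exp_half expr0 invr1 mul1r mulmx1 subrr.
suff -> : euler (h *m h' - 1%:M) = 0 by move=> d _; apply: mord0.
have e1 : euler (1%:M : 'M[{fps K[p]}]_n) = 0.
  by rewrite -(map_mx1 (fpsC p : {rmorphism K -> _})) euler_const.
rewrite eulerB e1 subr0 eulerM; apply: mx_half_inj; rewrite addr0.
rewrite addrACA -mulmxDl -mulmxDr euler_exp euler_mexp mulmxN mulmxA hC subrr.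
exact: erefl.
Qed.

End HalfExponentials.

Lemma half_exp_algebra (R : comNzRingType) n (N Z U T h h' S C D Phi A : 'M[R]_n) :
  N = (T *m h *m h - T) *m Phi *m (A - 1%:M) -> Z = T *m h *m S *m (1%:M - A) ->
  U = T *m h *m h ->
  A = h' *m h' -> h *m h' = 1%:M -> D *m S = S *m D ->
  S *m h = h *m S -> S *m h' = h' *m S -> C *m h = h *m C -> C *m h' = h' *m C ->
  D *m S = h - h' -> C + C = h + h' -> S + S *m (D *m Phi) = C ->
  N + N = Z + Z - (U - T *m A).
Proof.
move=> NE ZE UE AE hh sC Sh Sh' Ch Ch' DS CC SQ; have h'h := mulmx1C hh.
pose d := h - h'.
have hd : h *m d = d *m h by rewrite mulmxBr mulmxBl hh h'h.
have h2 : h *m h - 1%:M = h *m (S *m D) by rewrite -sC DS mulmxBr hh.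
have A1 : 1%:M - A = d *m h' by rewrite AE mulmxBl hh.
have SDP : S *m (D *m Phi) = C - S by rewrite -SQ addrC addKr.
have dC : d *m h' *m h = d by rewrite -mulmxA h'h mulmx1.
have key B : B *m h = h *m B -> h *m B *m (d *m h') = B *m d.
  move=> Bh; rewrite -Bh -mulmxA [h *m (d *m h')]mulmxA hd -[d *m h *m h']mulmxA.
  by rewrite hh mulmx1.
have N1 : N = - (T *m ((C - S) *m d)).
  have -> : N = T *m (h *m h - 1%:M) *m Phi *m (A - 1%:M).
    by rewrite NE (mulmxBr T) mulmx1 mulmxA.
  rewrite h2 -(opprB 1%:M A) A1 mulmxN; congr (- _).
  rewrite -!mulmxA (mulmxA D) (mulmxA S) SDP -(key (C - S)) ?mulmxA //.
  by rewrite mulmxBl mulmxBr Ch Sh.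
rewrite ZE UE N1 A1 -!(mulmxA T) (key S Sh).
have -> : T *m (h *m h) - T *m A = T *m ((C + C) *m d).
  rewrite -mulmxBr CC AE; congr (_ *m _).
  by rewrite /d mulmxDl !mulmxBr hh h'h addrA subrK.
clearbody d; rewrite !mulmxBl !mulmxBr mulmxDl mulmxDr.
move: (T *m (C *m d)) (T *m (S *m d)) => u v.
by apply/matrixP => i j; rewrite !(addmxE, oppmxE); ring.
Qed.

Lemma addr_eq_subr (V : zmodType) (a b d : V) : a + b = d -> b = d - a.
Proof. by move=> <-; rewrite addrC addKr. Qed.

Lemma mxder_rowE (K : comNzRingType) m q (u : 'rV[{fps K[m]}]_q) j :
  mxder j u = row j (jac u).
Proof. by apply/rowP => l; rewrite !mxE. Qed.

Lemma mxder_sum_X (K : comNzRingType) m q s (F : 'I_m -> 'M[{fps K[m]}]_(q, s)) j :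
  mxder j (\sum_i fpsX K i *: F i) = F j + \sum_i fpsX K i *: mxder j (F i).
Proof.
rewrite mxder_sum; under eq_bigr do rewrite mxderZ fps_derX.
rewrite big_split /=; congr (_ + _); rewrite (bigD1 j) //= eqxx scale1r big1 ?addr0 //.
by move=> i ne; rewrite eq_sym (negPf ne) scale0r.
Qed.

(* Contraction of the Maurer-Cartan equation with the Euler vector field. *)
Lemma euler_maurer_cartan (K : fieldType) n (G : formal_group K n)
    (w : 'M[{fps K[n]}]_n) (v : 'rV[{fps K[n]}]_n) :
  (forall i j, mxder i (row j w) - mxder j (row i w)
               = - (row j w *m ad_mx (fg_lie G) (row i w))) ->
  fid n *m w = v -> euler w + w = jac v - w *m ad_mx (fg_lie G) v.
Proof.
move=> mc xw; apply/row_matrixP => j.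
have ew : euler (row j w) = row j (euler w).
  rewrite /euler linear_sum; apply: eq_bigr => i _.
  by rewrite linearZ; congr (_ *: _); apply/rowP => l; rewrite !mxE.
have {}mc i : mxder i (row j w)
   = mxder j (row i w) - row j w *m ad_mx (fg_lie G) (row i w).
  by have /eqP := mc i j; rewrite subr_eq addrC => /eqP.
have sw : \sum_i fpsX K i *: row i w = v.
  by rewrite -xw mulmx_sum_row; apply: eq_bigr => i _; rewrite mxE.
have sdw : \sum_i fpsX K i *: mxder j (row i w) = row j (jac v) - row j w.
  apply: addr_eq_subr; rewrite -mxder_rowE -sw.
  by rewrite (mxder_sum_X (fun i => row i w)).
have sad : \sum_i fpsX K i *: (row j w *m ad_mx (fg_lie G) (row i w))
    = row j w *m ad_mx (fg_lie G) v.
  rewrite -sw ad_mx_sum mulmx_sumr; apply: eq_bigr => i _.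
  by rewrite ad_mxZ scalemxAr.
rewrite linearD linearB /= -ew row_mul {1}/euler.
under eq_bigr do rewrite mc scalerBr.
by rewrite sumrB sdw sad addrAC subrK.
Qed.

Lemma euler_plus1_unique (K : fieldType) (char0 : [pchar K] =i pred0) m q s
    (D : 'M[{fps K[m]}]_s) (B u v : 'M[{fps K[m]}]_(q, s)) : mord 1 D ->
  euler u + u = B - u *m D -> euler v + v = B - v *m D -> u = v.
Proof.
move=> D1 eu ev; apply/eqP; rewrite -subr_eq0; apply/eqP.
apply: (euler_plus1_eq0 char0) => d hd.
rewrite eulerB addrACA -opprD eu ev opprB addrC addrA subrK -opprB -mulmxBl.
by apply: mordN; rewrite -addn1; apply: mordM.
Qed.

Lemma euler_plus1_const_mul (K : fieldType) m q s (A : 'M[{fps K[m]}]_(q, s))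
    (u D : 'M_s) : euler A = 0 -> euler u + u = 1%:M - u *m D ->
  euler (A *m u) + A *m u = A - A *m u *m D.
Proof.
move=> eA e; rewrite eulerM eA mul0mx add0r -mulmxDr e mulmxBr mulmx1 mulmxA.
exact: erefl.
Qed.

Lemma tr_mul_swap (R : comNzRingType) n (T X X' Y Y' : 'M[R]_n) :
  X^T *m T = T *m X' -> Y^T *m T = T *m Y' -> (X *m Y)^T *m T = T *m Y' *m X'.
Proof.
by move=> hX hY; rewrite trmx_mul -(mulmxA Y^T) hX mulmxA hY.
Qed.

Lemma tr_sub_mul (R : comNzRingType) n (A T U Phi : 'M[R]_n) : A^T *m T = U ->
  (A - 1%:M)^T *m (T *m Phi) *m (A - 1%:M) = (U - T) *m Phi *m (A - 1%:M).
Proof.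
move=> e; have -> : (A - 1%:M)^T = A^T - 1%:M by rewrite linearB /= trmx1.
by rewrite mulmxA mulmxBl mul1mx e.
Qed.

Lemma tr_mul_eq (R : comNzRingType) n (W P U V : 'M[R]_n) :
  W^T = U -> P *m W = V -> W^T *m P *m W = U *m V.
Proof. by move=> <- <-; rewrite mulmxA. Qed.

Section ExpVee.
Variable K : fieldType.
Hypothesis char0 : [pchar K] =i pred0.
Variables (n : nat) (G : formal_group K n) (E : 'rV[{fps K[n]}]_n).
Hypothesis E_exp : is_exponential G E.
Variable t : 'M[K]_n.
Local Notation c := (fg_lie G).
Hypotheses (t_sym : t^T = t) (t_inv : forall l, ad_tensor c l t = 0).

Local Notation xi := (vee t).
Local Notation X := (E \of xi).
Local Notation D := (ad_mx c xi).
Local Notation T := (tens n t).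
Local Notation h := (mx_series (exp_half K) D).
Local Notation h' := (mx_series (exp_mhalf K) D).
Local Notation S := (mx_series (sinhc_half K) D).
Local Notation C := (mx_series (cosh_half K) D).
Local Notation W := (log_der G X).
Local Notation Phi := (mx_series (phi K) D).
Let pE := pointed_exp E_exp.

Lemma pointed_vee : pointed xi.
Proof. exact: (pointed_mulmx _ (@pointed_fid K n)). Qed.
Let pxi := pointed_vee.

Lemma pointed_exp_vee : pointed X.
Proof. exact: pointed_comp. Qed.
Let pX := pointed_exp_vee.

Lemma jac_vee : jac xi = T.
Proof.
apply/matrixP => i j; rewrite mxE /vee mxE raddf_sum (bigD1 i) //=.
rewrite fps_derM !mxE fps_derC mulr0 addr0 fps_derX eqxx mul1r big1 ?addr0 //.
move=> k ne; rewrite fps_derM !mxE fps_derC mulr0 addr0 fps_derX.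
by rewrite eq_sym (negPf ne) mul0r.
Qed.

Lemma vee_of m (u : 'rV[{fps K[m]}]_n) : pointed u -> xi \of u = u *m tens m t.
Proof. by move=> hu; rewrite (mx_compM hu) (fid_of hu) (mx_comp_const _ hu). Qed.

Lemma euler_vee : euler xi = xi.
Proof. by rewrite euler_row jac_vee. Qed.

Lemma fid_log_der_exp_vee : fid n *m W = xi.
Proof.
rewrite (log_der_of G pE pxi) jac_vee mulmxA -/(vee t).
have := congr1 (fun A => A \of xi) (exp_log_der char0 E_exp).
by rewrite /= (mx_compM pxi) (fid_of pxi).
Qed.

Lemma mord_ad_vee : mord 1 D.
Proof.
move=> i j; apply: ford1; rewrite mxE fps_coef_sum big1 // => k _.
by rewrite fps_coefM0 pxi mul0r.
Qed.
Let D1 := mord_ad_vee.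

Lemma euler_ad_vee : euler D = D.
Proof.
rewrite -{2}euler_vee /euler ad_mx_sum; apply: eq_bigr => i _.
by rewrite mxder_ad_mx ad_mxZ.
Qed.
Let eD := euler_ad_vee.

Lemma euler_Ad_exp_vee : euler (Ad G X) = D *m Ad G X.
Proof.
rewrite -{2}fid_log_der_exp_vee mulmx_sum_row ad_mx_sum mulmx_suml.
apply: eq_bigr => i _; rewrite (der_Ad G i pX) scalemxAl -ad_mxZ.
by rewrite mxE.
Qed.

Lemma euler_log_der_exp_vee : euler W + W = T - W *m D.
Proof.
rewrite -jac_vee; apply: euler_maurer_cartan fid_log_der_exp_vee => i j.
exact: maurer_cartan.
Qed.

Lemma Ad_exp_vee : Ad G X = h *m h.
Proof.
have hC := mx_seriesC D1 (exp_half K).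
have e2 : euler (h *m h) = D *m (h *m h).
  apply: mx_half_inj => //; rewrite eulerM addrACA -mulmxDl -mulmxDr.
  by rewrite (euler_exp char0 D1 eD) mulmxA -hC mulmxA.
apply/eqP; rewrite -subr_eq0; apply/eqP; apply: (euler_eq0 char0).
  rewrite mxcoefD mxcoefN mxcoef0_Ad // mxcoef0M !mx_series0.
  by rewrite /exp_half invr1 mulmx1 subrr.
move=> d hd; rewrite eulerB euler_Ad_exp_vee e2 -mulmxBr -add1n.
exact: mordM.
Qed.

Lemma Ad_inv_exp_vee : Ad G (ginv G X) = h' *m h'.
Proof.
have hh : h *m h' = 1%:M by apply: mx_expV.
have e : h' *m h' *m Ad G X = 1%:M.
  by rewrite Ad_exp_vee mulmxA -(mulmxA h') (mulmx1C hh) mulmx1 (mulmx1C hh).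
by rewrite -[LHS]mul1mx -e -mulmxA (AdKV G pX) mulmx1.
Qed.

Lemma log_der_exp_vee : W = T *m S *m h'.
Proof.
have hh : h *m h' = 1%:M by apply: mx_expV.
have sC := mx_seriesC D1 (sinhc_half K).
have h'C := mx_seriesC D1 (exp_mhalf K).
have e : euler (S *m h') + S *m h' = 1%:M - S *m h' *m D.
  apply: mx_half_inj => //.
  have -> : S *m h' *m D = (h - h') *m h'.
    by rewrite -mulmxA -h'C mulmxA -sC (mx_sinh char0 D1).
  have -> : euler (S *m h') + S *m h' = C *m h' + S *m euler h'.
    by rewrite eulerM addrAC -mulmxDl (euler_sinhc char0 D1 eD).
  rewrite addrACA -mulmxDl -mulmxDr (mx_cosh D1) (euler_mexp char0 D1 eD).
  rewrite mulmxN mulmxA -sC (mx_sinh char0 D1) mulmxDl mulmxBl hh.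
  move: (h' *m h') (1%:M : 'M[{fps K[n]}]_n) => u v.
  by apply/matrixP => i j; rewrite !(addmxE, oppmxE); ring.
rewrite -mulmxA; apply: (euler_plus1_unique char0 D1 euler_log_der_exp_vee).
exact: (euler_plus1_const_mul (euler_const n t) e).
Qed.

Lemma kks_tens : kks c *m T = D.
Proof.
apply/matrixP => i k; rewrite !mxE.
under eq_bigr => j _ do rewrite !mxE mulr_suml.
rewrite exchange_big /=.
under [RHS]eq_bigr => a _ do rewrite !mxE mulr_suml.
rewrite [RHS]exchange_big /=; apply: eq_bigr => l _.
have e : \sum_a (c i a l * t a k + c i a k * t l a) = 0.
  by have /matrixP/(_ l k) := t_inv i; rewrite !mxE.
transitivity (fpsX K l * fpsC n (\sum_a c i a l * t a k)).
  rewrite rmorph_sum mulr_sumr; apply: eq_bigr => a _.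
  by rewrite rmorphM /=; ring.
have -> : \sum_a c i a l * t a k = \sum_a c a i k * t l a.
  apply/eqP; rewrite -subr_eq0 -sumrB -[X in _ == X]e; apply/eqP.
  by apply: eq_bigr => a _; rewrite (fg_lieN G a i k) mulNr opprK.
rewrite rmorph_sum mulr_sumr; apply: eq_bigr => a _.
rewrite !mxE rmorphM /=; ring.
Qed.

Lemma trmx_kks : (kks c)^T = - kks c.
Proof.
apply/matrixP => i j; rewrite !mxE -sumrN; apply: eq_bigr => l _.
by rewrite fg_lieN rmorphN mulNr.
Qed.

Lemma kks_log_der_exp_vee : kks c *m W = 1%:M - Ad G (ginv G X).
Proof.
rewrite log_der_exp_vee Ad_inv_exp_vee !mulmxA kks_tens (mx_sinh char0 D1).
by rewrite mulmxBl (mx_expV char0 D1 eD).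
Qed.

(* Functions of [z = ad xi]; transposing across [t] changes [z] into [-z], and
   the identity is
   [(e^z - 1) phi(z) (e^-z - 1) = ((e^z - 1)/z) (1 - e^-z) - (e^z - e^-z)/2]. *)
Lemma rho_AM_identity (A := Ad G (ginv G X)) :
  let N := (A - 1%:M)^T *m rho_AM c t *m (A - 1%:M) in
  N + N = W^T *m kks c *m W + W^T *m kks c *m W - (A^T *m T - T *m A).
Proof.
move=> N.
have DT : D^T *m T = - (T *m D) by apply: ad_invariant.
have hT : h'^T *m T = T *m h.
  rewrite (tr_mx_series D1 _ DT); congr (_ *m _); apply: eq_mx_series => m.
  by rewrite /exp_mhalf mulrA -exprMn mulrNN mulr1 expr1n mul1r.
have sT : S^T *m T = T *m S.
  rewrite (tr_mx_series D1 _ DT); congr (_ *m _); apply: eq_mx_series => m.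
  by rewrite /sinhc_half -signr_odd; case: (odd m); rewrite ?mulr0 ?mul1r.
have Tsym : T^T = T by rewrite /tens map_trmx t_sym.
have AE : A = h' *m h' by apply: Ad_inv_exp_vee.
have AT : A^T *m T = T *m h *m h.
  rewrite AE; exact: (tr_mul_swap hT hT).
have WT : W^T = T *m h *m S.
  rewrite log_der_exp_vee -mulmxA trmx_mul Tsym; exact: (tr_mul_swap sT hT).
have NE : N = (T *m h *m h - T) *m Phi *m (A - 1%:M) := tr_sub_mul Phi AT.
have WPW := tr_mul_eq WT kks_log_der_exp_vee.
have hh : h *m h' = 1%:M by apply: mx_expV.
have sC := mx_seriesC D1 (sinhc_half K).
have Sh := mx_series_commute D1 (sinhc_half K) (exp_half K).
have Sh' := mx_series_commute D1 (sinhc_half K) (exp_mhalf K).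
have Ch := mx_series_commute D1 (cosh_half K) (exp_half K).
have Ch' := mx_series_commute D1 (cosh_half K) (exp_mhalf K).
exact: (half_exp_algebra NE WPW AT AE hh sC Sh Sh' Ch Ch' (mx_sinh char0 D1)
  (mx_cosh D1) (mx_phi D1)).
Qed.

End ExpVee.

(** * Poisson maps and multiplicative bivectors *)

Section PoissonMaps.
Variable K : comNzRingType.

Lemma poisson_bracketE n (P : 'M[{fps K[n]}]_n) (f h : {fps K[n]}) :
  poisson_bracket P f h
  = ((\row_(i < n) fps_der i f) *m P *m (\row_(i < n) fps_der i h)^T) 0 0.
Proof.
rewrite mxE /poisson_bracket exchange_big; apply: eq_bigr => j _.
by rewrite !mxE mulr_suml; apply: eq_bigr => i _; rewrite !mxE; ring.
Qed.

Lemma grad_comp m p (f : {fps K[p]}) (u : 'rV[{fps K[m]}]_p) : pointed u ->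
  \row_(i < m) fps_der i (fps_comp f u)
  = (\row_(i < p) fps_der i f \of u) *m (jac u)^T.
Proof.
move=> hu; apply/rowP => i; rewrite !mxE fps_der_comp //.
by apply: eq_bigr => j _; rewrite !mxE mulrC.
Qed.

Lemma poisson_map_jac m p (P : 'M[{fps K[m]}]_m) (Q : 'M[{fps K[p]}]_p)
    (u : 'rV[{fps K[m]}]_p) : pointed u ->
  Q \of u = (jac u)^T *m P *m jac u -> poisson_map P Q u.
Proof.
move=> hu e; split=> // f h; rewrite !poisson_bracketE !grad_comp //.
have -> : forall A : 'M[{fps K[p]}]_1, fps_comp (A 0 0) u = (A \of u) 0 0.
  by move=> A; rewrite mxE.
rewrite !(mx_compM hu) e mx_comp_tr; move: (_ \of u) (_ \of u) => v w.
by rewrite trmx_mul trmxK !mulmxA.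
Qed.

Lemma jac_poisson_map m p (P : 'M[{fps K[m]}]_m) (Q : 'M[{fps K[p]}]_p)
    (u : 'rV[{fps K[m]}]_p) : poisson_map P Q u ->
  Q \of u = (jac u)^T *m P *m jac u.
Proof.
move=> [hu e]; apply/matrixP => i j; have := e (fpsX K i) (fpsX K j).
have delta q (S : 'M[{fps K[q]}]_q) k l : poisson_bracket S (fpsX K k) (fpsX K l) = S k l.
  rewrite /poisson_bracket (bigD1 k) //= [X in _ + X]big1 => [|a ne]; last first.
    by rewrite big1 // => b _; rewrite fps_derX (negPf ne) mulr0 mul0r.
  rewrite addr0 (bigD1 l) //= big1 => [|b ne]; last first.
    by rewrite [fps_der b _]fps_derX (negPf ne) mulr0.
  by rewrite !fps_derX !eqxx !mulr1 addr0.
rewrite delta !(fps_compX hu) => eij; rewrite mxE eij poisson_bracketE.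
have -> : \row_i0 fps_der i0 (u 0 i) = row i (jac u)^T.
  by apply/rowP => a; rewrite !mxE.
have -> : \row_i0 fps_der i0 (u 0 j) = row j (jac u)^T.
  by apply/rowP => a; rewrite !mxE.
rewrite tr_row trmxK -!row_mul; move: (_ *m P) => S.
by rewrite !mxE; apply: eq_bigr => a _; rewrite !mxE.
Qed.

End PoissonMaps.

Lemma mx_comp_sandwich (K : comNzRingType) m p q s (A : 'M[{fps K[p]}]_(q, s))
    (B : 'M_(q, q)) (C : 'M_(q, s)) (u : 'rV[{fps K[m]}]_p) : pointed u ->
  (A^T *m B *m C) \of u = (A \of u)^T *m (B \of u) *m (C \of u).
Proof. by move=> hu; rewrite !(mx_compM hu) mx_comp_tr. Qed.

Lemma mxderN (K : comNzRingType) m (j : 'I_m) q s (A : 'M[{fps K[m]}]_(q, s)) :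
  mxder j (- A) = - mxder j A.
Proof. by apply/matrixP => a b; rewrite !mxE raddfN. Qed.

Lemma mxcoef0_der_sandwich (K : comNzRingType) m (j : 'I_m) q s
    (A : 'M[{fps K[m]}]_(q, s)) (B : 'M_(q, q)) (C : 'M_(q, s)) :
  mxcoef 0%MM (mxder j (A^T *m B *m C))
  = (mxcoef 0%MM (mxder j A))^T *m mxcoef 0%MM B *m mxcoef 0%MM C
    + (mxcoef 0%MM A)^T *m mxcoef 0%MM (mxder j B) *m mxcoef 0%MM C
    + (mxcoef 0%MM A)^T *m mxcoef 0%MM B *m mxcoef 0%MM (mxder j C).
Proof.
by rewrite !mxderM mxder_tr mulmxDl !mxcoefD !mxcoef0M !mxcoef_tr.
Qed.

Lemma cocycle_algebra (R : comNzRingType) n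
    (N1 N2 L L' PX PY LX LX' LY LY' B B' : 'M[R]_n) :
  N1 *m L = LX *m B -> N2 *m L = LY -> N1 *m L' = LX' *m B' -> N2 *m L' = LY' ->
  L^T *m (N1^T *m PX *m N1 + N2^T *m PY *m N2) *m L'
  = B^T *m (LX^T *m PX *m LX') *m B' + LY^T *m PY *m LY'.
Proof.
move=> e1 e2 e1' e2'.
have -> : L^T *m (N1^T *m PX *m N1 + N2^T *m PY *m N2) *m L'
   = (N1 *m L)^T *m PX *m (N1 *m L') + (N2 *m L)^T *m PY *m (N2 *m L').
  by rewrite !trmx_mul mulmxDr mulmxDl !mulmxA.
by rewrite e1 e2 e1' e2' trmx_mul !mulmxA.
Qed.

Lemma coboundary_algebra (R : comNzRingType) n (S AX AX' B B' : 'M[R]_n) :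
  S - (AX *m B)^T *m S *m (AX' *m B')
  = B^T *m (S - AX^T *m S *m AX') *m B' + (S - B^T *m S *m B').
Proof.
rewrite trmx_mul mulmxBr mulmxBl !mulmxA.
move: (B^T *m S *m B') (B^T *m AX^T *m S *m AX' *m B') => u v.
by apply/matrixP => i j; rewrite !(addmxE, oppmxE); ring.
Qed.

Lemma mxsub_cocycle (R : comNzRingType) n (U V B B' U' V' : 'M[R]_n) :
  B^T *m U *m B' + U' - (B^T *m V *m B' + V') = B^T *m (U - V) *m B' + (U' - V').
Proof.
rewrite mulmxBr mulmxBl; move: (B^T *m U *m B') (B^T *m V *m B') => u v.
by apply/matrixP => i j; rewrite !(addmxE, oppmxE); ring.
Qed.

Section PoissonLieCocycles.
Variable K : fieldType.
Hypothesis char0 : [pchar K] =i pred0.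
Variables (n : nat) (G : formal_group K n) (H : formal_poisson_lie_group K n).
Local Notation c := (fg_lie G).
Hypothesis H_lin : forall i j l, plg_linearization H i j l = c i j l.
Local Notation P := (plg_bivector H).
Local Notation X := (lsubmx (fid (n + n)) : 'rV[{fps K[n + n]}]_n).
Local Notation Y := (rsubmx (fid (n + n)) : 'rV[{fps K[n + n]}]_n).
Let pX := @pointed_lfid K n n.
Let pY := @pointed_rfid K n n.
Let pf := @pointed_fid K n.
Let p0 := @pointed0 K n n.

Lemma fg_mul_XY : fg_mul H = gmul H X Y.
Proof. by rewrite gmulE hsubmxK mx_comp_fid. Qed.

Lemma jac_fg_mul : jac (gmul H X Y) = col_mx (mul_dl H X Y) (mul_dr H X Y).
Proof.
rewrite (jac_gmul H pX pY) jac_lfid jac_rfid.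
by rewrite !(add_col_mx, mul_col_mx, mul1mx, mul0mx, addr0, add0r).
Qed.

Lemma plg_bivectorM :
  P \of gmul H X Y = (mul_dl H X Y)^T *m (P \of X) *m mul_dl H X Y
                   + (mul_dr H X Y)^T *m (P \of Y) *m mul_dr H X Y.
Proof.
have := jac_poisson_map (plg_multiplicative H); rewrite fg_mul_XY => ->.
rewrite /poisson_prod jac_fg_mul tr_col_mx mul_row_block !mulmx0 addr0 add0r.
exact: mul_row_col.
Qed.

Lemma plg_bivector0 : mxcoef 0%MM P = 0.
Proof.
have pXY := pointed_gmul H pX pY.
have := congr1 (mxcoef 0%MM) plg_bivectorM.
rewrite mxcoefD !mxcoef0M !mxcoef_tr !(mxcoef0_comp P) // mxcoef0_mul_dl // mxcoef0_mul_dr //.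
rewrite trmx1 mul1mx mulmx1 => /esym/addr_eq_subr e.
by rewrite e subrr.
Qed.

Definition lin_matrix j : 'M[K]_n := \matrix_(i, k) c i k j.

Lemma plg_bivector1 j : mxcoef 0%MM (mxder j P) = lin_matrix j.
Proof.
apply/matrixP => i k; rewrite !mxE -H_lin /plg_linearization.
by rewrite /fps_der /= add0m mnm0E mulr1n.
Qed.

Section Morphism.
Variables (A : 'M[K]_n) (f : 'rV[{fps K[n]}]_n).
Hypothesis f_mor : is_group_morphism H G A f.

Lemma pointed_morphism : pointed f. Proof. by case: f_mor. Qed.
Let hf := pointed_morphism.

Lemma morphism_XY : f \of gmul H X Y = gmul G (f \of X) (f \of Y).
Proof. by case: f_mor => _ _; rewrite fg_mul_XY. Qed.

Lemma log_der_morphism :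
  mul_dl H X Y *m (log_der G f \of gmul H X Y)
    = (log_der G f \of X) *m Ad G (ginv G (f \of Y)) /\
  mul_dr H X Y *m (log_der G f \of gmul H X Y) = log_der G f \of Y.
Proof.
have pXY := pointed_gmul H pX pY.
have hfX := pointed_comp pX hf; have hfY := pointed_comp pY hf.
have := log_der_of G hf pXY; rewrite morphism_XY (log_der_mul G hfX hfY).
rewrite (log_der_of G hf pX) (log_der_of G hf pY) jac_fg_mul jac_lfid jac_rfid.
move: (log_der G f \of X) (log_der G f \of Y) (log_der G f \of _) (Ad G _).
move=> lX lY lXY B.
rewrite !(add_col_mx, mul_col_mx, mul1mx, mul0mx, addr0, add0r).
by move/eq_col_mx => [-> ->].
Qed.

Lemma Ad_inv_coef1 j : mxcoef 0%MM (mxder j (Ad G (ginv G f)))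
  = - \sum_l A j l *: ad_basis G l.
Proof.
have hif := pointed_ginv G hf; have lf : lin_part f = A by case: f_mor.
rewrite (der_Ad G j hif) mxcoef0M (mxcoef0_Ad G hif) mulmx1.
have := mxcoef0_log_der G hif; rewrite (lin_part_ginv G hf) lf.
move: (log_der G _) => th e; apply/matrixP => a b.
rewrite !mxE fps_coef_sum summxE -sumrN; apply: eq_bigr => l _.
have := congr1 (fun B : 'M[K]_n => B j l) e; rewrite !mxE => ejl.
by rewrite fps_coefM0 ejl /= eqxx mulNr.
Qed.

End Morphism.

(* Both sides are 1-cocycles on [H], hence determined by their differentials at
   the unit, which agree by the hypothesis on [s]. *)
Lemma plg_cocycle (A A' s : 'M[K]_n) (f f' : 'rV[{fps K[n]}]_n) :
  is_group_morphism H G A f -> is_group_morphism H G A' f' ->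
  (forall j, A^T *m lin_matrix j *m A'
     = (\sum_l A j l *: ad_basis G l)^T *m s + s *m \sum_l A' j l *: ad_basis G l) ->
  (log_der G f)^T *m P *m log_der G f'
  = tens n s - (Ad G (ginv G f))^T *m tens n s *m Ad G (ginv G f').
Proof.
move=> mf mf' cond; have hf := pointed_morphism mf; have hf' := pointed_morphism mf'.
have hif := pointed_ginv G hf; have hif' := pointed_ginv G hf'.
have pXY := pointed_gmul H pX pY.
have hfX := pointed_comp pX hf; have hfY := pointed_comp pY hf.
have hfX' := pointed_comp pX hf'; have hfY' := pointed_comp pY hf'.
pose Lam := (log_der G f)^T *m P *m log_der G f'.
pose F := tens n s - (Ad G (ginv G f))^T *m tens n s *m Ad G (ginv G f').
pose Delta := Lam - F.
pose B := Ad G (ginv G f) \of Y; pose B' := Ad G (ginv G f') \of Y.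
have BE : B = Ad G (ginv G (f \of Y)) by rewrite /B (Ad_of G hif pY) (ginv_of G hf pY).
have BE' : B' = Ad G (ginv G (f' \of Y)).
  by rewrite /B' (Ad_of G hif' pY) (ginv_of G hf' pY).
have LamM : Lam \of gmul H X Y = B^T *m (Lam \of X) *m B' + (Lam \of Y).
  have [e1 e2] := log_der_morphism mf; have [e1' e2'] := log_der_morphism mf'.
  rewrite -BE in e1; rewrite -BE' in e1'.
  rewrite /Lam (mx_comp_sandwich _ _ _ pXY) (mx_comp_sandwich _ _ _ pX).
  rewrite (mx_comp_sandwich _ _ _ pY) plg_bivectorM; exact: cocycle_algebra e1 e2 e1' e2'.
have FM : F \of gmul H X Y = B^T *m (F \of X) *m B' + (F \of Y).
  have comp m (u : 'rV[{fps K[m]}]_n) : pointed u -> F \of u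
      = tens m s - (Ad G (ginv G f) \of u)^T *m tens m s *m (Ad G (ginv G f') \of u).
    move=> hu; rewrite /F mx_compB (mx_comp_sandwich _ _ _ hu) (mx_comp_const s hu).
    exact: erefl.
  have AdXY (h : 'rV[{fps K[n]}]_n) C : is_group_morphism H G C h ->
      Ad G (ginv G h) \of gmul H X Y
      = (Ad G (ginv G h) \of X) *m (Ad G (ginv G h) \of Y).
    move=> mh; have hh := pointed_morphism mh; have hih := pointed_ginv G hh.
    have hX := pointed_comp pX hh; have hY := pointed_comp pY hh.
    rewrite (Ad_of G hih pXY) (Ad_of G hih pX) (Ad_of G hih pY).
    rewrite (ginv_of G hh pXY) (ginv_of G hh pX) (ginv_of G hh pY).
    rewrite (morphism_XY mh) (ginvM G hX hY) AdM //; exact: pointed_ginv.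
  rewrite (comp _ _ pXY) (comp _ _ pX) (comp _ _ pY) (AdXY _ _ mf) (AdXY _ _ mf').
  exact: coboundary_algebra.
have DM : Delta \of gmul H X Y = B^T *m (Delta \of X) *m B' + (Delta \of Y).
  have DE m (u : 'rV[{fps K[m]}]_n) : Delta \of u = (Lam \of u) - (F \of u).
    exact: mx_compB.
  rewrite !DE LamM FM; exact: mxsub_cocycle.
have dLam j : mxcoef 0%MM (mxder j Lam) = A^T *m lin_matrix j *m A'.
  rewrite /Lam mxcoef0_der_sandwich plg_bivector0 plg_bivector1.
  have -> : mxcoef 0%MM (log_der G f) = A by rewrite mxcoef0_log_der //; case: mf.
  have -> : mxcoef 0%MM (log_der G f') = A' by rewrite mxcoef0_log_der //; case: mf'.
  by rewrite !mulmx0 !mul0mx add0r addr0.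
have dF j : mxcoef 0%MM (mxder j F)
    = (\sum_l A j l *: ad_basis G l)^T *m s + s *m \sum_l A' j l *: ad_basis G l.
  rewrite /F mxderD mxderN (mxder_const j s) add0r mxcoefN mxcoef0_der_sandwich.
  rewrite (Ad_inv_coef1 mf) (Ad_inv_coef1 mf') (mxder_const j s) mxcoef_0.
  rewrite (mxcoef0_Ad G hif) (mxcoef0_Ad G hif') mxcoef0_const.
  move: (\sum_l _) (\sum_l _) => U U'.
  rewrite linearN /= trmx1 !mul1mx !mulmx1 addr0 mulNmx mulmxN -opprD opprK.
  exact: erefl.
have D1 j : mxcoef 0%MM (mxder j Delta) = 0.
  have -> : mxder j Delta = mxder j Lam - mxder j F.
    by rewrite -mxderN -mxderD.
  by rewrite mxcoefD mxcoefN dLam dF cond subrr.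
have dD l : mxder l Delta = 0.
  have Zj j : \sum_l mul_dl H 0 (fid n) j l *: mxder l Delta = 0.
    have h0 := pointed_row_mx p0 pf.
    have := congr1 (fun Z => mxder (lshift n j) Z \of row_mx 0 (fid n)) DM.
    rewrite /= (mxder_comp _ _ pXY) mxderD mxder_lY addr0.
    rewrite !mxderM mxder_lX mxder_tr !mxder_lY trmx0 !mul0mx mulmx0 add0r addr0.
    rewrite !(mx_compM h0) (mx_compA _ pX h0) (lfid_of p0 pf) mx_comp_at0 D1.
    rewrite map_mx0 mulmx0 mul0mx mx_comp_sum => e; apply: etrans _ e.
    apply: eq_bigr => k _.
    rewrite (mx_compZ _ _ h0) (mx_compA _ pXY h0) (gmul_of H pX pY h0).
    rewrite (lfid_of p0 pf) (rfid_of p0 pf) (gmul0g H pf) mx_comp_fid.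
    congr (_ *: _); rewrite jac_fg_mul col_mxEu.
    have -> : forall Z : 'M[{fps K[n + n]}]_n,
      fps_comp (Z j k) (row_mx 0 (fid n)) = (Z \of row_mx 0 (fid n)) j k.
      by move=> Z; rewrite mxE.
    by rewrite (mul_dl_of H pX pY h0) (lfid_of p0 pf) (rfid_of p0 pf).
  have inv : mul_dl H (fid n) (ginv H (fid n)) *m mul_dl H 0 (fid n) = 1%:M.
    apply: mulmx1C; have pi := pointed_ginv H pf.
    have [e _ _] := mul_d_assoc H p0 pf pi; rewrite (gmul0g H pf) (gmulgV H pf) in e.
    by rewrite e (mul_dlg0 H p0).
  move: inv Zj; move: (mul_dl H 0 (fid n)) (mul_dl H _ _) => Z Z' inv Zj.
  transitivity (\sum_j Z' l j *: (\sum_k Z j k *: mxder k Delta)); last first.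
    by rewrite big1 // => j _; rewrite Zj scaler0.
  under eq_bigr do rewrite scaler_sumr.
  rewrite exchange_big /=; have iE k : \sum_j Z' l j * Z j k = (l == k)%:R.
    by have /matrixP/(_ l k) := inv; rewrite !mxE.
  under eq_bigr do under eq_bigr do rewrite scalerA.
  under eq_bigr do rewrite -scaler_suml iE.
  rewrite (bigD1 l) //= eqxx scale1r big1 ?addr0 // => k ne.
  by rewrite eq_sym (negPf ne) scale0r.
suff : Delta = 0 by move/eqP; rewrite subr_eq0 => /eqP.
rewrite [LHS](mxder0_const char0 dD) mxcoefD mxcoefN mxcoefD mxcoefN !mxcoef0M.
rewrite !mxcoef_tr plg_bivector0 mulmx0 mul0mx mxcoef0_const !mxcoef0_Ad //.
by rewrite trmx1 mul1mx mulmx1 subrr subrr map_mx0.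
Qed.

End PoissonLieCocycles.

(** * The Semenov-Tian-Shansky bivector *)

Section CYBE.
Variables (K : fieldType) (n : nat) (G : formal_group K n) (r : 'M[K]_n).
Local Notation c := (fg_lie G).
Hypothesis r_cybe : forall i j l, cybe c r i j l = 0.

Let cN := fg_lieN G.

Lemma tr_sum_ad_mul (a : 'I_n -> K) (s : 'M[K]_n) x y :
  ((\sum_l a l *: ad_basis G l)^T *m s) x y = \sum_l \sum_m a l * c l m x * s m y.
Proof.
rewrite mxE exchange_big; apply: eq_bigr => m _.
rewrite mxE summxE mulr_suml; apply: eq_bigr => l _.
by rewrite !mxE.
Qed.

Lemma mul_sum_ad (a : 'I_n -> K) (s : 'M[K]_n) x y :
  (s *m \sum_l a l *: ad_basis G l) x y = \sum_l \sum_m a l * c l m y * s x m.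
Proof.
rewrite mxE exchange_big; apply: eq_bigr => m _.
rewrite summxE mulr_sumr; apply: eq_bigr => l _.
by rewrite !mxE mulrC.
Qed.

Lemma lin_matrix_sandwich j (A A' : 'M[K]_n) x y :
  (A^T *m lin_matrix G j *m A') x y = \sum_a \sum_b A a x * c a b j * A' b y.
Proof.
rewrite mxE exchange_big; apply: eq_bigr => b _.
by rewrite mxE mulr_suml; apply: eq_bigr => a _; rewrite !mxE.
Qed.

Let cybe_split i j l :
  \sum_a \sum_b r a j * r b l * c a b i + \sum_a \sum_b r i a * r b l * c a b j
  + \sum_a \sum_b r i a * r j b * c a b l = 0.
Proof.
rewrite -[RHS](r_cybe i j l) /cybe -!big_split; apply: eq_bigr => a _.
by rewrite -!big_split.
Qed.

Let dsumP (F F' : 'I_n -> 'I_n -> K) : (forall a b, F a b = F' a b) ->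
  \sum_a \sum_b F a b = \sum_a \sum_b F' a b.
Proof. by move=> e; apply: eq_bigr => a _; apply: eq_bigr => b _. Qed.
Let dsumN (F F' : 'I_n -> 'I_n -> K) : (forall a b, F a b = - F' a b) ->
  \sum_a \sum_b F a b = - \sum_a \sum_b F' a b.
Proof. by move=> e; rewrite -sumrN; apply: eq_bigr => a _; rewrite -sumrN; apply: eq_bigr. Qed.
Let dsumS (F F' : 'I_n -> 'I_n -> K) : (forall a b, F b a = F' a b) ->
  \sum_a \sum_b F a b = \sum_a \sum_b F' a b.
Proof. by move=> e; rewrite exchange_big; apply: dsumP. Qed.
Let dsumSN (F F' : 'I_n -> 'I_n -> K) : (forall a b, F b a = - F' a b) ->
  \sum_a \sum_b F a b = - \sum_a \sum_b F' a b.
Proof. by move=> e; rewrite exchange_big; apply: dsumN. Qed.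

Let tr_coef (M : 'M[K]_n) a b : M^T a b = M b a. Proof. by rewrite mxE. Qed.
Let opp_coef (M : 'M[K]_n) a b : (- M) a b = - M a b. Proof. by rewrite mxE. Qed.

(* The linearized coboundaries of the four components [L L], [L R], [R L], [R R]
   of the bivector; the classical Yang-Baxter equation is used with its three
   tensor factors permuted. *)
Lemma cybe_LL j : r^T *m lin_matrix G j *m r
  = (\sum_l r j l *: ad_basis G l)^T *m (- r) + (- r) *m \sum_l r j l *: ad_basis G l.
Proof.
apply/matrixP => x y; rewrite addmxE lin_matrix_sandwich tr_sum_ad_mul mul_sum_ad.
have e := cybe_split j x y.
rewrite (@dsumP _ (fun a b => r a x * r b y * c a b j)) => [|a b]; last by ring.
rewrite (@dsumN (fun l m => _ * (- r) m y) (fun a b => r j a * r b y * c a b x)); last first.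
  by move=> a b; rewrite opp_coef; ring.
rewrite (@dsumN (fun l m => _ * (- r) x m) (fun a b => r j a * r x b * c a b y)); last first.
  by move=> a b; rewrite opp_coef; ring.
by apply/eqP; rewrite -subr_eq0 opprD !opprK addrA e.
Qed.

Lemma cybe_LR j : r^T *m lin_matrix G j *m (- r^T)
  = (\sum_l r j l *: ad_basis G l)^T *m r^T + r^T *m \sum_l (- r^T) j l *: ad_basis G l.
Proof.
apply/matrixP => x y; rewrite addmxE lin_matrix_sandwich tr_sum_ad_mul mul_sum_ad.
have e := cybe_split y j x.
rewrite (@dsumS _ (fun a b => r y a * r b x * c a b j)); last first.
  by move=> a b; rewrite opp_coef tr_coef (cN b a); ring.
rewrite (@dsumSN (fun l m => _ * r^T m y) (fun a b => r y a * r j b * c a b x)); last first.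
  by move=> a b; rewrite tr_coef (cN b a); ring.
rewrite (@dsumN (fun l m => _ * r^T x m) (fun a b => r a j * r b x * c a b y)); last first.
  by move=> a b; rewrite opp_coef !tr_coef; ring.
by apply/eqP; rewrite -subr_eq0 opprD !opprK addrA addrC addrA e.
Qed.

Lemma cybe_RL j : (- r^T)^T *m lin_matrix G j *m r
  = (\sum_l (- r^T) j l *: ad_basis G l)^T *m (- r) + (- r) *m \sum_l r j l *: ad_basis G l.
Proof.
apply/matrixP => x y; rewrite addmxE lin_matrix_sandwich tr_sum_ad_mul mul_sum_ad.
have e := cybe_split x j y.
rewrite (@dsumN _ (fun a b => r x a * r b y * c a b j)); last first.
  by move=> a b; rewrite opp_coef tr_coef; ring.
rewrite (@dsumP (fun l m => _ * (- r) m y) (fun a b => r a j * r b y * c a b x)); last first.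
  by move=> a b; rewrite !opp_coef !tr_coef; ring.
rewrite (@dsumS (fun l m => _ * (- r) x m) (fun a b => r x a * r j b * c a b y)); last first.
  by move=> a b; rewrite opp_coef (cN b a); ring.
by apply/eqP; rewrite eq_sym -subr_eq0 opprK addrAC e.
Qed.

Lemma cybe_RR j : (- r^T)^T *m lin_matrix G j *m (- r^T)
  = (\sum_l (- r^T) j l *: ad_basis G l)^T *m (- r)
    + (- r) *m \sum_l (- r^T) j l *: ad_basis G l.
Proof.
apply/matrixP => x y; rewrite addmxE lin_matrix_sandwich tr_sum_ad_mul mul_sum_ad.
have e := cybe_split x y j.
rewrite (@dsumP _ (fun a b => r x a * r y b * c a b j)); last first.
  by move=> a b; rewrite !opp_coef !tr_coef; ring.
rewrite (@dsumSN (fun l m => _ * (- r) m y) (fun a b => r a y * r b j * c a b x)); last first.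
  by move=> a b; rewrite !opp_coef !tr_coef (cN b a); ring.
rewrite (@dsumSN (fun l m => _ * (- r) x m) (fun a b => r x a * r b j * c a b y)); last first.
  by move=> a b; rewrite !opp_coef !tr_coef (cN b a); ring.
by apply/eqP; rewrite -subr_eq0 opprD !opprK addrC e.
Qed.

End CYBE.

Lemma sts_b_algebra (R : comNzRingType) n (pL pR P r aL aR B : 'M[R]_n) :
  aR *m B = 1%:M -> B^T *m (r + r^T) *m B = r + r^T ->
  pL^T *m P *m pL = - r - aL^T *m (- r) *m aL ->
  pL^T *m P *m pR = r^T - aL^T *m r^T *m aR ->
  pR^T *m P *m pL = - r - aR^T *m (- r) *m aL ->
  pR^T *m P *m pR = - r - aR^T *m (- r) *m aR ->
  let A := aL *m B in
  ((pL - pR) *m B)^T *m P *m ((pL - pR) *m B)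
  = A^T *m r *m A + A^T *m r^T - r *m A - r^T.
Proof.
move=> aB tB eLL eLR eRL eRR A.
have aBT : B^T *m aR^T = 1%:M by rewrite -trmx_mul aB trmx1.
transitivity (B^T *m (pL^T *m P *m pL - pL^T *m P *m pR - pR^T *m P *m pL
   + pR^T *m P *m pR) *m B).
  have dT : (pL - pR)^T = pL^T - pR^T by rewrite linearB.
  rewrite trmx_mul dT !(mulmxDl, mulmxDr, mulmxN, mulNmx, mulmxA).
  move: (B^T *m pL^T *m P *m pL *m B) (B^T *m pL^T *m P *m pR *m B)
    (B^T *m pR^T *m P *m pL *m B) (B^T *m pR^T *m P *m pR *m B) => u v w x.
  by apply/matrixP => i j; rewrite !(addmxE, oppmxE); ring.
have -> : pL^T *m P *m pL - pL^T *m P *m pR - pR^T *m P *m pL + pR^T *m P *m pR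
  = - (r + r^T) + aL^T *m r *m aL + aL^T *m r^T *m aR - aR^T *m r *m aL
    + aR^T *m r *m aR.
  rewrite eLL eLR eRL eRR !mulmxN !mulNmx.
  move: (aL^T *m r *m aL) (aL^T *m r^T *m aR) (aR^T *m r *m aL) (aR^T *m r *m aR) r^T.
  by move=> u v w x r'; apply/matrixP => i j; rewrite !(addmxE, oppmxE); ring.
have E1 : B^T *m (aL^T *m r *m aL) *m B = A^T *m r *m A.
  by rewrite /A trmx_mul !mulmxA.
have E2 : B^T *m (aL^T *m r^T *m aR) *m B = A^T *m r^T.
  by rewrite /A trmx_mul -!mulmxA aB mulmx1.
have E3 : B^T *m (aR^T *m r *m aL) *m B = r *m A.
  by rewrite /A !mulmxA aBT mul1mx.
have E4 : B^T *m (aR^T *m r *m aR) *m B = r.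
  by rewrite !mulmxA aBT mul1mx -mulmxA aB mulmx1.
rewrite !(mulmxDr, mulmxDl, mulmxN, mulNmx) E1 E2 E3 E4 -mulmxDl -mulmxDr tB.
move: (A^T *m r *m A) (A^T *m r^T) (r *m A) r^T => u v w r'.
by apply/matrixP => i j; rewrite !(addmxE, oppmxE); ring.
Qed.

Lemma sandwich_expand (R : comNzRingType) n (th D W P B : 'M[R]_n) :
  ((th *m D + W) *m B)^T *m P *m ((th *m D + W) *m B)
  = B^T *m (D^T *m (th^T *m P *m th) *m D + D^T *m th^T *m (P *m W)
     + (W^T *m P) *m th *m D + W^T *m P *m W) *m B.
Proof.
have dT : (th *m D + W)^T = D^T *m th^T + W^T by rewrite linearD /= trmx_mul.
rewrite trmx_mul dT !(mulmxDr, mulmxDl, mulmxA).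
move: (B^T *m D^T *m th^T *m P *m th *m D *m B)
  (B^T *m D^T *m th^T *m P *m W *m B) (B^T *m W^T *m P *m th *m D *m B)
  (B^T *m W^T *m P *m W *m B) => u v w x.
by apply/matrixP => i j; rewrite !(addmxE, oppmxE); ring.
Qed.

Lemma sandwich_add (R : comNzRingType) n (B C U V : 'M[R]_n) :
  C *m U *m B + C *m V *m B = C *m (U + V) *m B.
Proof. by rewrite mulmxDr mulmxDl. Qed.

Lemma sandwich_double (R : comNzRingType) n (B C U V : 'M[R]_n) :
  U + U = V + V -> C *m U *m B + C *m U *m B = C *m V *m B + C *m V *m B.
Proof. by move=> e; rewrite -mulmxDl -mulmxDr e mulmxDr mulmxDl. Qed.

Lemma sts_a_algebra (R : comNzRingType) n
    (th A W P N rho r rAM B B' : 'M[R]_n) :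
  P^T = - P -> P *m W = 1%:M - A -> B' *m B = 1%:M ->
  (B'^T *m (r + r^T) *m B' = r + r^T) ->
  (A^T *m (r + r^T) *m A = r + r^T) ->
  th^T - th - th^T *m P *m th + rho = rAM ->
  rho + rho = B'^T *m (r - r^T) *m B' ->
  N = (A - 1%:M)^T *m rAM *m (A - 1%:M) ->
  N + N = W^T *m P *m W + W^T *m P *m W - (A^T *m (r + r^T) - (r + r^T) *m A) ->
  let dl := (th *m (A - 1%:M) + W) *m B in let Q := B' *m A *m B in
  let lhs := dl^T *m P *m dl in
  let rhs := Q^T *m r *m Q + Q^T *m r^T - r *m Q - r^T in
  lhs + lhs = rhs + rhs.
Proof.
move=> PT PW BB tB tA eq rho2 NE N2 dl Q lhs rhs.
have BB' := mulmx1C BB.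
have WP : W^T *m P = (A - 1%:M)^T.
  by rewrite -[LHS]trmxK trmx_mul trmxK PT mulNmx PW opprB.
have BBT : B^T *m B'^T = 1%:M by rewrite -trmx_mul BB trmx1.
pose D := A - 1%:M.
pose S := D^T *m rho *m D.
have lhsE : lhs = B^T *m (S - N + W^T *m P *m W) *m B.
  have -> : lhs = B^T *m (D^T *m (th^T *m P *m th) *m D + D^T *m th^T *m (P *m W)
     + (W^T *m P) *m th *m D + W^T *m P *m W) *m B.
    exact: sandwich_expand.
  rewrite PW WP -(opprB A) -/D /S NE -/D -eq; congr (_ *m (_ + _) *m _).
  rewrite mulmxN !(mulmxDr, mulmxDl, mulmxN, mulNmx) !mulmxA.
  move: (D^T *m th^T *m P *m th *m D) (D^T *m th^T *m D) (D^T *m th *m D)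
    (D^T *m rho *m D) => u v w x.
  by apply/matrixP => i j; rewrite !(addmxE, oppmxE); ring.
pose r' := B'^T *m r *m B'; pose s' := B'^T *m r^T *m B'.
have rE : r = B^T *m r' *m B.
  by rewrite /r' !mulmxA BBT mul1mx -mulmxA BB mulmx1.
have sE : r^T = B^T *m s' *m B.
  by rewrite /s' !mulmxA BBT mul1mx -mulmxA BB mulmx1.
have t'E : r' + s' = r + r^T by rewrite -mulmxDl -mulmxDr.
have rho2' : rho + rho = r' - s' by rewrite rho2 mulmxBr mulmxBl.
have QT (Z : 'M_n) : Q^T *m (B^T *m Z *m B) = B^T *m (A^T *m Z) *m B.
  by rewrite /Q !trmx_mul !mulmxA -(mulmxA _ B'^T) (mulmx1C BBT) mulmx1.
have QQ (Z : 'M_n) : B^T *m Z *m B *m Q = B^T *m (Z *m A) *m B.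
  by rewrite /Q !mulmxA -(mulmxA _ B) BB' mulmx1.
have rhsE : rhs = B^T *m (A^T *m r' *m A + A^T *m s' - r' *m A - s') *m B.
  have q1 : Q^T *m r *m Q = B^T *m (A^T *m r' *m A) *m B by rewrite {1}rE QT QQ.
  have q2 : Q^T *m r^T = B^T *m (A^T *m s') *m B by rewrite {1}sE QT.
  have q3 : r *m Q = B^T *m (r' *m A) *m B by rewrite {1}rE QQ.
  by rewrite /rhs q1 q2 q3 [X in _ - X]sE !(mulmxDr, mulmxDl, mulmxN, mulNmx).
rewrite lhsE rhsE; apply: sandwich_double.
have SS : S + S = D^T *m (r' - s') *m D by rewrite -rho2'; apply: sandwich_add.
have -> : S - N + W^T *m P *m W + (S - N + W^T *m P *m W)
   = (S + S) - (N + N) + (W^T *m P *m W + W^T *m P *m W).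
  by move: (W^T *m P *m W) => w; apply/matrixP => i j; rewrite !(addmxE, oppmxE); ring.
rewrite SS N2 -t'E.
have tA' : A^T *m r' *m A + A^T *m s' *m A = r' + s'.
  by rewrite sandwich_add t'E tA -t'E.
have DT : D^T = A^T - 1%:M by rewrite linearB /= trmx1.
rewrite DT /D !(mulmxN, mulNmx, mulmxDr, mulmxDl, mulmx1, mul1mx).
have -> : A^T *m s' *m A = r' + s' - A^T *m r' *m A by rewrite -tA' addrC addKr.
move: (A^T *m r' *m A) (A^T *m r') (A^T *m s') (r' *m A) (s' *m A) (W^T *m P *m W).
move=> u v w x y z; clear; move: r' s' => r' s'.
by apply/matrixP => i j; rewrite !(addmxE, oppmxE); ring.
Qed.

(** * Conjugation of exponentials *)

Section PartialEuler.
Variables (K : fieldType) (p q : nat).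
Hypothesis char0 : [pchar K] =i pred0.
Local Notation X := (lsubmx (fid (p + q)) : 'rV[{fps K[p + q]}]_p).
Local Notation Y := (rsubmx (fid (p + q)) : 'rV[{fps K[p + q]}]_q).
Let pX := @pointed_lfid K p q.
Let p0 := @pointed0 K (p + q) q.

Lemma comp_row_mx0 (f : {fps K[p + q]}) (m : 'X_{1..p + q}) :
  fps_comp f (row_mx X 0) m = if [forall j, m (rshift p j) == 0%N] then f m else 0.
Proof.
have h0 := pointed_row_mx pX p0.
elim/fps_ind: f m => [a|i|f g hf hg|f g hf hg|f h] m.
- rewrite fps_compC //; case: forallP => // hm.
  rewrite /=; case: eqP => // em; case: hm => j; rewrite em.
  by rewrite mnm0E.
- rewrite fps_compX // mxE; case: splitP => k ek.
    have -> : X 0 k = fpsX K i by rewrite !mxE; congr (fpsX K _); apply: val_inj.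
    case: forallP => // hm; rewrite /=; case: eqP => // em; case: hm => j.
    rewrite em mnm1E eqb0; apply/eqP => e; have := congr1 val e; rewrite /= ek => e'.
    by have := ltn_ord k; rewrite e' ltnNge leq_addr.
  rewrite mxE fps_coef0; case: forallP => // /(_ k) /eqP hm.
  rewrite /=; case: eqP => // em; move: hm; rewrite em mnm1E.
  have -> : i = rshift p k by apply: val_inj.
  by rewrite eqxx.
- by rewrite fps_compD !fps_coefD hf hg; case: ifP => // _; rewrite addr0.
- rewrite fps_compM // !fps_coefM; case: forallP => [hm|hm].
    apply: eq_bigr => -[d1 d2] /eqP em.
    have h12 j : d1 (rshift p j) = 0%N /\ d2 (rshift p j) = 0%N.
      have mE : m (rshift p j) = (d1 (rshift p j) + d2 (rshift p j))%N.
        by rewrite -mnmDE -em.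
      by have := hm j; rewrite mE addn_eq0 => /andP[/eqP-> /eqP->].
    rewrite hf hg; have -> : [forall j, d1 (rshift p j) == 0%N].
      by apply/forallP => j; case: (h12 j) => ->.
    by have -> : [forall j, d2 (rshift p j) == 0%N];
      first by apply/forallP => j; case: (h12 j) => _ ->.
  rewrite big1 // => -[d1 d2] /eqP em; rewrite hf hg.
  case: forallP => [h1|]; last by rewrite mul0r.
  case: forallP => [h2|]; last by rewrite mulr0.
  case: hm => j; have -> : m (rshift p j) = (d1 (rshift p j) + d2 (rshift p j))%N.
    by rewrite -mnmDE -em.
  by rewrite (eqP (h1 j)) (eqP (h2 j)).
have [g hg og] := h (mdeg m).+1.
rewrite -(subrK g f); move: (f - g) og => e oe.
rewrite fps_compD !fps_coefD hg (ford_comp _ oe) // oe // !add0r.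
exact: erefl.
Qed.

Lemma partial_eulerE s (u : 'rV[{fps K[p + q]}]_s) :
  row_mx 0 Y *m jac u = \sum_j Y 0 j *: mxder (rshift p j) u.
Proof.
rewrite mulmx_sum_row big_split_ord /= big1 ?add0r => [|i _].
  by apply: eq_bigr => j _; rewrite row_mxEr mxder_rowE.
by rewrite row_mxEl mxE scale0r.
Qed.

Lemma partial_euler_eq0 s (u : 'rV[{fps K[p + q]}]_s) : pointed u ->
  row_mx 0 Y *m jac u = 0 -> u \of row_mx (fid p) 0 = 0 -> u = 0.
Proof.
move=> hu e u0; have pf := @pointed_fid K p; have p0' := @pointed0 K p q.
have h0 := pointed_row_mx pf p0'.
have uE : u \of row_mx X 0 = 0.
  have := congr1 (fun A => A \of X) u0.
  rewrite /= (mx_compA _ h0 pX) mx_comp_row (fid_of pX) !mx_comp0.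
  by [].
apply/rowP => a; apply: fpsP => m; rewrite mxE fps_coef0.
have := congr1 (fun A : 'rV[{fps K[p + q]}]_s => A 0 a m) uE.
rewrite !mxE comp_row_mx0 fps_coef0; case: forallP => // hm _.
have [j mj] : exists j, m (rshift p j) != 0%N.
  by apply/existsP; rewrite -negb_forall; apply/forallP.
have := congr1 (fun A : 'rV[{fps K[p + q]}]_s => A 0 a m) e.
rewrite partial_eulerE summxE fps_coef_sum.
have termE i : (Y 0 i *: mxder (rshift p i) u) 0 a m = u 0 a m *+ m (rshift p i).
  by rewrite !mxE coef_X_der.
rewrite (eq_bigr _ (fun i _ => termE i)) sumrMnr (bigD1 j) //= mxE fps_coef0.
case: (m (rshift p j)) mj => // k _.
by rewrite addSn => /(mulrn_eq0 char0).
Qed.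

End PartialEuler.

Lemma mulmx_kill (R : comNzRingType) q m n (e : 'M[R]_(q, m)) (Z W : 'M_(m, n))
    (A B C : 'M_n) : e *m Z = 0 ->
  e *m ((Z *m A + W) *m B - Z *m C) = e *m W *m B.
Proof.
move=> eZ; rewrite mulmxBr mulmxDl mulmxDr !mulmxA eZ !mul0mx subr0 add0r.
exact: erefl.
Qed.

Section ExpConjugation.
Variable K : fieldType.
Hypothesis char0 : [pchar K] =i pred0.
Variables (n : nat) (G : formal_group K n) (E : 'rV[{fps K[n]}]_n).
Hypothesis E_exp : is_exponential G E.
Local Notation "u ** v" := (gmul G u v) (at level 40, left associativity).
Local Notation inv := (ginv G).
Local Notation Z := (lsubmx (fid (n + n)) : 'rV[{fps K[n + n]}]_n).
Local Notation Y := (rsubmx (fid (n + n)) : 'rV[{fps K[n + n]}]_n).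
Let pE := pointed_exp E_exp.
Let pZ := @pointed_lfid K n n.
Let pY := @pointed_rfid K n n.
Let pf := @pointed_fid K n.
Let p0 := @pointed0 K n n.
Local Notation e := (row_mx 0 Y : 'rV[{fps K[n + n]}]_(n + n)).

(* Along [Y d/dY] both sides have logarithmic derivative [Y Ad(Z)]. *)
Lemma exp_conj m (u v : 'rV[{fps K[m]}]_n) : pointed u -> pointed v ->
  u ** (E \of v) ** inv u = E \of (v *m Ad G u).
Proof.
move=> hu hv.
pose W1 := Z ** (E \of Y) ** inv Z; pose V := Y *m Ad G Z; pose W2 := E \of V.
have pEY := pointed_comp pY pE; have pZE := pointed_gmul G pZ pEY.
have piZ := pointed_ginv G pZ; have pW1 : pointed W1 := pointed_gmul G pZE piZ.
have pV : pointed V := pointed_mulmx _ pY.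
have pW2 : pointed W2 := pointed_comp pV pE; have piW2 := pointed_ginv G pW2.
have expE k (w : 'rV[{fps K[k]}]_n) : pointed w -> w *m (log_der G E \of w) = w.
  move=> hw; have := congr1 (fun A => A \of w) (exp_log_der char0 E_exp).
  by rewrite /= (mx_compM hw) (fid_of hw).
have eZ : e *m log_der G Z = 0.
  rewrite log_derE jac_lfid mulmxA mul_row_col mul0mx mulmx0 addr0.
  exact: mul0mx.
have eW1 : e *m log_der G W1 = V.
  rewrite /W1 (log_der_mul G pZE piZ) (log_der_inv G pZ) (ginvK G pZ).
  rewrite (log_der_mul G pZ pEY) (mulmx_kill _ _ _ _ eZ).
  rewrite (log_der_of G pE pY) mulmxA jac_rfid.
  by rewrite mul_row_col mul0mx mulmx1 add0r expE.
have eV : e *m jac V = V.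
  rewrite partial_eulerE [RHS]mulmx_sum_row.
  have AZ : Ad G Z = Ad G (fid n) \of Z by rewrite (Ad_of G pf pZ) (fid_of pZ).
  apply: eq_bigr => j _; congr (_ *: _).
  rewrite /V AZ mxderM mxder_rX mulmx0 addr0 mxder_rowE jac_rfid rowKd.
  by rewrite -row_mul mul1mx.
have eW2 : e *m log_der G W2 = V by rewrite (log_der_of G pE pV) mulmxA eV expE.
pose D := W1 ** inv W2; have pD : pointed D := pointed_gmul G pW1 piW2.
have D0 : D = 0.
  apply: (partial_euler_eq0 char0 pD).
    have eD : e *m log_der G D = 0.
      rewrite (log_der_mul G pW1 piW2) (log_der_inv G pW2) (ginvK G pW2).
      by rewrite -mulmxBl mulmxA mulmxBr eW1 eW2 subrr mul0mx.
    have := congr1 (fun A => A *m mul_dr G D 0) eD.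
    by rewrite log_derE !mulmxA -mulmxA (mul_dr_inv G pD) mulmx1 mul0mx.
  have h0 := pointed_row_mx pf p0.
  rewrite /D /W1 /W2 (gmul_of G pW1 piW2 h0) (gmul_of G pZE piZ h0).
  rewrite (gmul_of G pZ pEY h0) (ginv_of G pZ h0) (ginv_of G pW2 h0).
  rewrite (mx_compA _ pY h0) (mx_compA _ pV h0) (mx_compM h0).
  rewrite (lfid_of pf p0) (rfid_of pf p0) mul0mx.
  have E0 : E \of (0 : 'rV[{fps K[n]}]_n) = 0.
    by rewrite mx_comp_at0 (mxcoef0_pointed pE) map_mx0.
  by rewrite E0 (ginv0 G) (gmulg0 G pf) (gmulgV G pf) (gmulg0 G p0).
have W12 : W1 = W2.
  rewrite -(gmul0g G pW2) -D0 /D (gmulKV G pW1 pW2).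
  exact: erefl.
have hw := pointed_row_mx hu hv.
have := congr1 (fun A => A \of row_mx u v) W12.
rewrite /W1 /W2 (gmul_of G pZE piZ hw) (gmul_of G pZ pEY hw) (ginv_of G pZ hw).
rewrite (mx_compA _ pY hw) (mx_compA _ pV hw) (mx_compM hw) (Ad_of G pZ hw).
by rewrite (lfid_of hu hv) (rfid_of hu hv).
Qed.

End ExpConjugation.

(** * The maps [a], [b] and the gauge action *)

Lemma jac_row_mul (K : comNzRingType) m q s (u : 'rV[{fps K[m]}]_q)
    (M : 'M[{fps K[m]}]_(q, s)) i :
  row i (jac (u *m M)) = row i (jac u) *m M + u *m mxder i M.
Proof. by rewrite -!mxder_rowE mxderM. Qed.

Lemma formal_inverse_comp (K : comNzRingType) m p q
    (u : 'rV[{fps K[m]}]_p) (u' : 'rV[{fps K[p]}]_m)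
    (v : 'rV[{fps K[p]}]_q) (v' : 'rV[{fps K[q]}]_p) :
  pointed u -> pointed v -> formal_inverse u u' -> formal_inverse v v' ->
  formal_inverse (v \of u) (u' \of v').
Proof.
move=> hu hv [hu' uu' u'u] [hv' vv' v'v]; split; first exact: pointed_comp.
  rewrite (mx_compA _ hu (pointed_comp hv' hu')) -(mx_compA u hu' hv') uu'.
  by rewrite (fid_of hv').
rewrite (mx_compA _ hv' (pointed_comp hu hv)) -(mx_compA v' hv hu) v'v.
by rewrite (fid_of hu).
Qed.

Lemma inverse_unique (K : comNzRingType) m p q (b : 'rV[{fps K[m]}]_p)
    (b' : 'rV[{fps K[p]}]_m) (y : 'rV[{fps K[q]}]_m) :
  pointed b -> pointed y -> formal_inverse b b' -> b' \of (b \of y) = y.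
Proof. by move=> hb hy [hb' _ bb]; rewrite -(mx_compA b' hb hy) bb (fid_of hy). Qed.

Lemma gauge_poisson_algebra (R : comNzRingType) n (P be B : 'M[R]_n) :
  P^T = - P -> be^T - be - be^T *m P *m be = 0 ->
  ((1%:M - be *m P) *m B^T)^T *m P *m ((1%:M - be *m P) *m B^T) = B *m P *m B^T.
Proof.
move=> PT ham.
have dT : (1%:M - be *m P)^T = 1%:M + P *m be^T.
  by rewrite linearB /= trmx1 trmx_mul PT mulNmx opprK.
have key : P *m be *m P = P *m be^T *m P - P *m be^T *m P *m be *m P.
  have := congr1 (fun Z => P *m Z *m P) ham.
  rewrite mulmx0 mul0mx !(mulmxDr, mulmxDl, mulmxN, mulNmx, mulmxA) => /eqP.
  by rewrite addrAC subr_eq0 => /eqP.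
rewrite trmx_mul dT trmxK !(mulmxDr, mulmxDl, mulmxN, mulNmx, mulmxA, mulmx1).
have := congr1 (fun Z => B *m Z *m B^T) key; rewrite mulmxBr mulmxBl !mulmxA => ->.
move: (B *m P *m B^T) (B *m P *m be^T *m P *m B^T)
  (B *m P *m be^T *m P *m be *m P *m B^T) => u v w.
by apply/matrixP => i j; rewrite !(addmxE, oppmxE); ring.
Qed.

Lemma gauge_ham_algebra (R : comNzRingType) n (P be B th : 'M[R]_n) :
  P^T = - P -> be^T - be - be^T *m P *m be = 0 ->
  let Th := (1%:M - be *m P) *m B^T *m th *m B + be in
  Th^T - Th - Th^T *m P *m Th
  = B^T *m (th^T - th - th^T *m (B *m P *m B^T) *m th) *m B.
Proof.
move=> PT ham Th; pose N := B^T *m th *m B.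
have ThE : Th = N - be *m P *m N + be.
  by rewrite /Th /N !(mulmxDl, mulNmx, mul1mx, mulmxA).
have NT : N^T = B^T *m th^T *m B by rewrite /N !trmx_mul trmxK mulmxA.
have -> : B^T *m (th^T - th - th^T *m (B *m P *m B^T) *m th) *m B
    = N^T - N - N^T *m P *m N.
  by rewrite NT /N !(mulmxDr, mulmxDl, mulmxN, mulNmx, mulmxA).
clearbody N; clear NT; clearbody Th.
have ThT : Th^T = N^T + N^T *m P *m be^T + be^T.
  rewrite ThE; have -> : (N - be *m P *m N + be)^T = N^T - (be *m P *m N)^T + be^T.
    by rewrite linearD /= linearB.
  by rewrite !trmx_mul PT mulNmx mulmxN opprK mulmxA.
have b1 : be^T = be + be^T *m P *m be.
  by apply/eqP; rewrite -subr_eq0 opprD addrA ham.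
rewrite ThT ThE; clear ThT ThE; move: N => M.
have e1 : M^T *m P *m be^T = M^T *m P *m be + M^T *m P *m be^T *m P *m be.
  by rewrite {1}b1 mulmxDr !mulmxA.
have e2 : be^T *m P *m M = be *m P *m M + be^T *m P *m be *m P *m M.
  by rewrite {1}b1 !mulmxDl.
have e3 : M^T *m P *m be^T *m P *m M
   = M^T *m P *m be *m P *m M + M^T *m P *m be^T *m P *m be *m P *m M.
  by rewrite {1}e1 !mulmxDl.
rewrite !(mulmxDr, mulmxDl, mulmxN, mulNmx, mulmxA); move: e1 e2 e3 b1.
move: M^T be^T (be *m P *m M) (be^T *m P *m be) (M^T *m P *m be) (M^T *m P *m M)
  (be^T *m P *m M) (M^T *m P *m be^T) (M^T *m P *m be *m P *m M)
  (be^T *m P *m be *m P *m M) (M^T *m P *m be^T *m P *m be)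
  (M^T *m P *m be^T *m P *m M) (M^T *m P *m be^T *m P *m be *m P *m M).
move=> M' be' m11 m10 m9 m8 m7 m6 m5 m4 m3 m2 m1 -> -> -> ->.
by apply/matrixP => i j; rewrite !(addmxE, oppmxE); ring.
Qed.

Lemma sandwichD (R : comNzRingType) n (B U V M : 'M[R]_n) :
  B^T *m (U + V^T *m M *m V) *m B = B^T *m U *m B + (V *m B)^T *m M *m (V *m B).
Proof. by rewrite mulmxDr mulmxDl trmx_mul !mulmxA. Qed.

Lemma sandwich_conj (R : comNzRingType) n (A B T Z : 'M[R]_n) :
  A *m B = 1%:M -> B^T *m T *m B = T ->
  B^T *m (T *m (B *m Z *m A)) *m B = T *m Z.
Proof. by move=> AB tB; rewrite !mulmxA -mulmxA AB mulmx1 tB. Qed.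

Lemma sandwich_cancel (R : comNzRingType) m n (b : 'M[R]_(m, n)) (g : 'M[R]_(n, m))
    (U V : 'M[R]_m) : b *m g = 1%:M -> b^T *m U *m b = b^T *m V *m b -> U = V.
Proof.
move=> bg e; have gb : g^T *m b^T = 1%:M by rewrite -trmx_mul bg trmx1.
have := congr1 (fun Z => g^T *m Z *m g) e.
rewrite !mulmxA gb !mul1mx -!mulmxA bg !mulmx1.
by [].
Qed.

Lemma Ad_inv_div (K : comNzRingType) n (G : formal_group K n) m
    (u v : 'rV[{fps K[m]}]_n) : pointed u -> pointed v ->
  Ad G (ginv G (gmul G u (ginv G v))) = Ad G (ginv G u) *m Ad G v.
Proof.
move=> hu hv; have hiv := pointed_ginv G hv.
rewrite (ginvM G hu hiv) (ginvK G hv).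
exact: (AdM G hv (pointed_ginv G hu)).
Qed.

Lemma log_der_div (K : comNzRingType) n (G : formal_group K n) m
    (u v : 'rV[{fps K[m]}]_n) : pointed u -> pointed v ->
  log_der G (gmul G u (ginv G v)) = (log_der G u - log_der G v) *m Ad G v.
Proof.
move=> hu hv; have hiv := pointed_ginv G hv.
rewrite (log_der_mul G hu hiv) (log_der_inv G hv) (ginvK G hv).
by rewrite mulmxBl.
Qed.

Section Main.
Variable K : fieldType.
Hypothesis char0 : [pchar K] =i pred0.
Variables (n : nat) (G : formal_group K n) (r : 'M[K]_n).
Local Notation c := (fg_lie G).
Hypothesis r_qt : quasitriangular c r.
Hypothesis t_nondeg : r + r^T \in unitmx.
Variable E : 'rV[{fps K[n]}]_n.
Hypothesis E_exp : is_exponential G E.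
Local Notation "u ** v" := (gmul G u v) (at level 40, left associativity).
Local Notation inv := (ginv G).
Local Notation t := (r + r^T).
Local Notation xi := (vee t).
Local Notation X := (E \of xi).
Local Notation P := (kks c).

Let pE := pointed_exp E_exp.
Let t_inv l : ad_tensor c l t = 0. Proof. by case: r_qt. Qed.
Let t_sym : t^T = t. Proof. by rewrite linearD /= trmxK addrC. Qed.
Let pxi : pointed xi := pointed_vee t.
Let pX : pointed X := pointed_exp_vee E_exp t.
Let tensD m : tens m t = tens m r + (tens m r)^T.
Proof. by rewrite /tens map_trmx -map_mxD. Qed.

Let Ad_t m (u : 'rV[{fps K[m]}]_n) : pointed u ->
  (Ad G u)^T *m (tens m r + (tens m r)^T) *m Ad G u = tens m r + (tens m r)^T.
Proof. by move=> hu; rewrite -tensD; apply: Ad_invariant. Qed.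

(* Semenov-Tian-Shansky bivector at [u], translated to the unit from the left. *)
Definition sts m (u : 'rV[{fps K[m]}]_n) : 'M[{fps K[m]}]_n :=
  (Ad G (inv u))^T *m tens m r *m Ad G (inv u) + (Ad G (inv u))^T *m (tens m r)^T
  - tens m r *m Ad G (inv u) - (tens m r)^T.

Lemma sts_of m p (u : 'rV[{fps K[p]}]_n) (w : 'rV[{fps K[m]}]_p) :
  pointed u -> pointed w -> sts u \of w = sts (u \of w).
Proof.
move=> hu hw; have hiu := pointed_ginv G hu.
have cr : tens p r \of w = tens m r := mx_comp_const r hw.
have eA : Ad G (inv u) \of w = Ad G (inv (u \of w)).
  by rewrite (Ad_of G hiu hw) (ginv_of G hu hw).
rewrite /sts -eA -cr; move: (Ad G (inv u)) (tens p r) => A R.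
by rewrite !(mx_compD, mx_compN) !(mx_compM hw) !mx_comp_tr.
Qed.

Section Dual.
Variable H : formal_poisson_lie_group K n.
Hypothesis H_lin : forall i j l, plg_linearization H i j l = c i j l.
Variables L R : 'rV[{fps K[n]}]_n.
Hypothesis L_mor : is_group_morphism H G r L.
Hypothesis R_mor : is_group_morphism H G (- r^T) R.
Local Notation b := (b_map G L R).
Let hL : pointed L := pointed_morphism L_mor.
Let hR : pointed R := pointed_morphism R_mor.
Let hiR := pointed_ginv G hR.

Lemma pointed_b_map : pointed b.
Proof. exact: pointed_gmul. Qed.
Let hb := pointed_b_map.

Lemma b_map_push : (log_der G b)^T *m plg_bivector H *m log_der G b = sts b.
Proof.
have cyb : forall i j l, cybe c r i j l = 0 by case: r_qt.
have tr_r : tens n r^T = (tens n r)^T by rewrite /tens map_trmx.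
have tensN : tens n (- r) = - tens n r by rewrite /tens map_mxN.
have eLL := plg_cocycle char0 H_lin L_mor L_mor (cybe_LL cyb).
have eLR := plg_cocycle char0 H_lin L_mor R_mor (cybe_LR cyb).
have eRL := plg_cocycle char0 H_lin R_mor L_mor (cybe_RL cyb).
have eRR := plg_cocycle char0 H_lin R_mor R_mor (cybe_RR cyb).
rewrite tensN in eLL; rewrite tensN in eRL; rewrite tensN in eRR; rewrite tr_r in eLR.
have lb := log_der_div G hL hR.
have Ab := Ad_inv_div G hL hR.
rewrite /sts /b_map; move: (log_der G _) lb (Ad G (inv (L ** inv R))) Ab => W -> A ->.
exact: (sts_b_algebra (AdV G hR) (Ad_t hR) eLL eLR eRL eRR).
Qed.

Lemma lin_part_b_map : lin_part b = t.
Proof.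
rewrite (lin_part_gmul G hL hiR) (lin_part_ginv G hR).
by case: L_mor => _ -> _; case: R_mor => _ -> _; rewrite opprK.
Qed.

Lemma b_map_inverse : exists b', formal_inverse b b'.
Proof. by apply: (inverse_fun (B := invmx t)) => //; rewrite lin_part_b_map mulVmx. Qed.

Lemma b_map_of m (y : 'rV[{fps K[m]}]_n) : pointed y ->
  gmul G (L \of y) (inv (R \of y)) = b \of y.
Proof. by move=> hy; rewrite (gmul_of G hL hiR hy) (ginv_of G hR hy). Qed.

(* [b] sends the bivector of [G^*] to [sts] and is etale, so that [y] is Poisson
   as soon as [b o y] sends [Q] to [sts]. *)
Lemma poisson_map_of_sts m (Q : 'M[{fps K[m]}]_m) (a : 'rV[{fps K[m]}]_n)
    (y : 'rV[{fps K[m]}]_n) : pointed y -> b \of y = a ->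
  (log_der G a)^T *m Q *m log_der G a = sts a -> poisson_map Q (plg_bivector H) y.
Proof.
move=> hy by_a ea; apply: poisson_map_jac => //.
have [b' [hb' _ bb]] := b_map_inverse.
pose be := log_der G b \of y.
pose ga := (mul_dr G b 0 *m (jac b' \of b)) \of y.
have bega : be *m ga = 1%:M.
  rewrite /be /ga -(mx_compM hy) log_derE -mulmxA (mulmxA (mul_dr G _ _)) (mul_dr_inv G hb).
  rewrite mul1mx -(jac_comp b' hb) bb jac_fid.
  exact: mx_comp1.
have la : log_der G a = jac y *m be by rewrite -by_a (log_der_of G hb hy).
apply: (sandwich_cancel bega).
have := congr1 (fun A => A \of y) b_map_push.
rewrite /= (sts_of hb hy) by_a (mx_comp_sandwich _ _ _ hy) -/be => ->.
rewrite -ea la; clear la bega; clearbody be; move: (jac y) => j.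
by rewrite trmx_mul !mulmxA.
Qed.

End Dual.

Section AMap.
Variable g : 'rV[{fps K[n]}]_n.
Hypothesis hg : pointed g.
Hypothesis g_eq : vertex_IRF_eq c G r g.
Local Notation a := (a_map G E r g).
Let hig := pointed_ginv G hg.
Let hgX := pointed_gmul G hg pX.

Lemma pointed_a_map : pointed a.
Proof. exact: pointed_gmul. Qed.

Lemma lin_part_a_map : lin_part a = t.
Proof.
rewrite (lin_part_gmul G hgX hig) (lin_part_gmul G hg pX) (lin_part_ginv G hg).
rewrite addrAC subrr add0r lin_part_comp // -mxcoef0_jac jac_vee mxcoef0_const.
by case: E_exp => _ -> _; rewrite mulmx1.
Qed.

Lemma a_map_inverse : exists a', formal_inverse a a'.
Proof.
apply: (inverse_fun (B := invmx t)); first exact: pointed_a_map.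
by rewrite lin_part_a_map mulVmx.
Qed.

Lemma a_map_push : (log_der G a)^T *m P *m log_der G a = sts a.
Proof.
pose A := Ad G (inv X); pose W := log_der G X; pose th := log_der G g.
have hiX := pointed_ginv G pX.
have la : log_der G a = (th *m (A - 1%:M) + W) *m Ad G g.
  rewrite /a_map (log_der_mul G hgX hig) (log_der_inv G hg) (ginvK G hg).
  rewrite (log_der_mul G hg pX) -/A -/W -/th mulmxBr mulmx1 -mulmxBl.
  by rewrite addrAC.
have Aa : Ad G (inv a) = Ad G (inv g) *m A *m Ad G g.
  rewrite /a_map (ginvM G hgX hig) (ginvK G hg) (ginvM G hg pX).
  have hh := pointed_gmul G hiX hig.
  by rewrite (AdM G hg hh) (AdM G hiX hig) /A.
have two2 (Z : 'M[K]_n) : (2^-1 *: Z) + (2^-1 *: Z) = Z.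
  rewrite -scalerDl -mulr2n -[2^-1 *+ 2]mulr_natl mulfV ?scale1r //.
  exact: (natr_neq0 char0 1).
pose rho := Ad2 G (inv g) (tens n (2^-1 *: (r - r^T))).
have rho2 : rho + rho = (Ad G (inv g))^T *m (tens n r - (tens n r)^T) *m Ad G (inv g).
  rewrite /rho /Ad2 sandwich_add /tens -map_mxD two2.
  by rewrite map_mxB map_trmx.
have N2 := rho_AM_identity char0 E_exp t_sym t_inv.
rewrite tensD in N2.
rewrite la /sts Aa; apply: (mx_half_inj char0).
exact: (sts_a_algebra (trmx_kks G) (kks_log_der_exp_vee char0 E_exp t_inv)
  (AdV G hg) (Ad_t hig) (Ad_t hiX) g_eq rho2 (erefl _) N2).
Qed.

End AMap.

Section Gauge.
Variable al : 'rV[{fps K[n]}]_n.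
Hypothesis hal : pointed al.
Hypothesis al_ham : ham_defect c G al = 0.
Local Notation tau := (coad_map G al).
Local Notation B := (Ad G (inv al)).
Local Notation be := (log_der G al).
Local Notation x := (fid n : 'rV[{fps K[n]}]_n).
Let hial := pointed_ginv G hal.

Lemma pointed_coad_map : pointed tau.
Proof. exact: (pointed_mulmx _ (@pointed_fid K n)). Qed.
Let htau := pointed_coad_map.

Lemma mul_tr_ad_mx m (y v : 'rV[{fps K[m]}]_n) :
  y *m (ad_mx c v)^T = v *m \matrix_(i, j) \sum_l fpsC m (c i j l) * y 0 l.
Proof.
apply/rowP => j; rewrite mxE.
under eq_bigr => l _ do rewrite !mxE mulr_sumr.
rewrite exchange_big mxE; apply: eq_bigr => a _.
by rewrite mxE mulr_sumr; apply: eq_bigr => l _; ring.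
Qed.

Lemma fid_tr_ad_mx (v : 'rV[{fps K[n]}]_n) : x *m (ad_mx c v)^T = v *m P.
Proof.
rewrite mul_tr_ad_mx; congr (_ *m _); apply/matrixP => i j; rewrite !mxE.
by apply: eq_bigr => l _; rewrite mxE.
Qed.

Lemma jac_coad_map : jac tau = (1%:M - be *m P) *m B^T.
Proof.
apply/row_matrixP => i; rewrite /coad_map jac_row_mul jac_fid mxder_tr.
have -> : mxder i B = B *m ad_mx c (- row i be).
  rewrite (der_Ad G i hial) (ad_Ad G _ hial); congr (_ *m ad_mx _ _).
  rewrite (log_der_inv G hal).
  have -> : row i (- (be *m Ad G al)) = - (row i be *m Ad G al).
    rewrite -row_mul; move: (be *m Ad G al) => Z.
    by apply/rowP => k; rewrite !mxE.
  by rewrite mulNmx -mulmxA (AdKV G hal) mulmx1.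
rewrite trmx_mul mulmxA fid_tr_ad_mx -mulmxDl [RHS]row_mul.
have -> : row i (1%:M - be *m P) = row i 1%:M - row i (be *m P).
  by move: (be *m P) => Z; apply/rowP => k; rewrite !mxE.
by rewrite mulNmx (row_mul i be P).
Qed.

Lemma kks_coad_map : P \of tau = B *m P *m B^T.
Proof.
apply/row_matrixP => i; pose e : 'rV[{fps K[n]}]_n := row i 1%:M.
have eM m (Z : 'M[{fps K[n]}]_(n, m)) : row i Z = e *m Z by rewrite -row_mul mul1mx.
have -> : row i (P \of tau) = tau *m (ad_mx c e)^T.
  rewrite mul_tr_ad_mx eM; congr (_ *m _); apply/matrixP => k j.
  rewrite !mxE fps_comp_sum; apply: eq_bigr => l _.
  by rewrite fps_compM // fps_compC // fps_compX.
rewrite /coad_map -mulmxA -trmx_mul (ad_Ad G e hial) trmx_mul mulmxA fid_tr_ad_mx.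
by rewrite eM !mulmxA.
Qed.

Lemma coad_map_poisson_iso : poisson_iso P P tau.
Proof.
split.
  apply: poisson_map_jac => //; rewrite kks_coad_map jac_coad_map.
  by rewrite (gauge_poisson_algebra B (trmx_kks G) al_ham).
split=> //; apply: (inverse_fun (B := 1%:M)) => //.
rewrite -mxcoef0_jac jac_coad_map mxcoef0M mxcoef_tr (mxcoef0_Ad G hial) trmx1.
rewrite mulmx1 mul1mx mxcoefD mxcoefN mxcoef0_1 mxcoef0M.
have -> : mxcoef 0%MM P = 0.
  apply/matrixP => i j; rewrite !mxE fps_coef_sum big1 // => l _.
  by rewrite fps_coefCM (_ : fpsX K l 0%MM = 0) ?mulr0 //= eq_sym -mdeg_eq0 mdeg1.
by rewrite mulmx0 subr0.
Qed.

Lemma vee_coad_map : xi \of tau = xi *m Ad G al.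
Proof.
rewrite (vee_of t htau) /coad_map /vee -!mulmxA; congr (_ *m _).
have := Ad_invariant char0 t_inv hial; rewrite -/(tens n t).
move=> /(congr1 (fun Z => Z *m Ad G al)).
by rewrite -mulmxA (AdV G hal) mulmx1.
Qed.

Variable g : 'rV[{fps K[n]}]_n.
Hypothesis hg : pointed g.
Let hgt := pointed_comp htau hg.

Lemma pointed_gauge : pointed (gauge G al g).
Proof. exact: pointed_gmul. Qed.

Lemma a_map_gauge : a_map G E r (gauge G al g) = a_map G E r g \of tau.
Proof.
have hig := pointed_ginv G hg; have hgX := pointed_gmul G hg pX.
have hXt := pointed_comp htau pX; have higt := pointed_ginv G hgt.
rewrite /a_map (gmul_of G hgX hig htau) (gmul_of G hg pX htau) (ginv_of G hg htau).
rewrite (mx_compA E pxi htau) vee_coad_map -(exp_conj char0 E_exp hal pxi).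
rewrite /gauge (ginvM G hgt hal).
rewrite (gmulA G (pointed_gmul G (pointed_gmul G hgt hal) pX) hial higt).
rewrite (gmulA G hgt (pointed_gmul G hal pX) hial).
by rewrite (gmulA G hgt hal pX).
Qed.

Hypothesis g_eq : vertex_IRF_eq c G r g.

Lemma vertex_IRF_gauge : vertex_IRF_eq c G r (gauge G al g).
Proof.
pose Th := log_der G g \of tau.
have lg : log_der G (gauge G al g) = (1%:M - be *m P) *m B^T *m Th *m B + be.
  by rewrite /gauge (log_der_mul G hgt hal) (log_der_of G hg htau) jac_coad_map.
have Ag : Ad G (inv (gauge G al g)) = Ad G (inv (g \of tau)) *m B.
  rewrite /gauge (ginvM G hgt hal) (AdM G hial (pointed_ginv G hgt)).
  exact: erefl.
pose r0 := 2^-1 *: (r - r^T).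
have hig := pointed_ginv G hg.
have D1 : mord 1 (ad_mx c xi) := mord_ad_vee G t.
have ADa : ad_mx c (xi *m Ad G al) = B *m ad_mx c xi *m Ad G al.
  rewrite -[RHS]mulmxA (ad_Ad G xi hal) mulmxA (AdV G hal) mul1mx.
  exact: erefl.
have Dtau : ad_mx c xi \of tau = B *m ad_mx c xi *m Ad G al.
  rewrite -ADa -vee_coad_map; apply/matrixP => i j; rewrite !mxE fps_comp_sum.
  apply: eq_bigr => l _; rewrite fps_compM // fps_compC //.
  by rewrite [in RHS]mxE.
have rhoT : rho_AM c t \of tau
    = tens n t *m (B *m mx_series (phi K) (ad_mx c xi) *m Ad G al).
  rewrite /rho_AM (mx_compM htau) (mx_comp_const t htau) (mx_series_of _ D1 htau).
  rewrite Dtau (mx_series_conj D1 _ (AdKV G hal)); exact: erefl.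
have hamT : ham_defect c G g \of tau
    = Th^T - Th - Th^T *m (B *m P *m B^T) *m Th.
  rewrite /ham_defect /Th -kks_coad_map; move: (log_der G g) P => th Q.
  by rewrite mx_compB mx_compB (mx_comp_sandwich _ _ _ htau) mx_comp_tr.
have Ad2T : Ad2 G (inv g) (tens n r0) \of tau = Ad2 G (inv (g \of tau)) (tens n r0).
  rewrite /Ad2 (mx_comp_sandwich _ _ _ htau) (mx_comp_const r0 htau).
  rewrite (Ad_of G hig htau) (ginv_of G hg htau); exact: erefl.
have eqT := congr1 (fun A => A \of tau) g_eq.
rewrite /= mx_compD hamT Ad2T rhoT in eqT.
rewrite /vertex_IRF_eq {1}/ham_defect lg.
rewrite (gauge_ham_algebra B Th (trmx_kks G) al_ham) -/r0.
have tB := Ad_invariant char0 t_inv hial.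
rewrite /Ad2 Ag; move: eqT tB; rewrite /Ad2 /rho_AM.
move: (Th^T - _ - _) (Ad G (inv (g \of tau))) (tens n r0) => U V R0 eqT tB.
transitivity (B^T *m (U + V^T *m R0 *m V) *m B).
  exact: esym (sandwichD _ _ _ _).
rewrite eqT; exact: (sandwich_conj _ (AdKV G hal) tB).
Qed.

End Gauge.

Lemma Map0P (u : 'rV[{fps K[n]}]_n) : Map0 E u <-> pointed u.
Proof.
split=> [[v hv ->]|hu]; first exact: pointed_comp.
have linE : 1%:M *m lin_part E = 1%:M by case: E_exp => _ -> _; rewrite mulmx1.
have [E' [hE' EE _]] := inverse_fun pE linE.
exists (E' \of u); first exact: pointed_comp.
by rewrite -(mx_compA E hE' hu) EE (fid_of hu).
Qed.

End Main.

Section Gstar.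
Variables (K : fieldType) (n : nat) (G : formal_group K n) (r : 'M[K]_n).
Hypothesis char0 : [pchar K] =i pred0.
Local Notation c := (fg_lie G).
Hypothesis r_qt : quasitriangular c r.
Hypothesis t_nondeg : r + r^T \in unitmx.
Variable E : 'rV[{fps K[n]}]_n.
Hypothesis E_exp : is_exponential G E.
Variable H : formal_poisson_lie_group K n.
Hypothesis H_lin : forall i j l, plg_linearization H i j l = c i j l.
Variables L R : 'rV[{fps K[n]}]_n.
Hypothesis L_mor : is_group_morphism H G r L.
Hypothesis R_mor : is_group_morphism H G (- r^T) R.
Local Notation a := (a_map G E r).
Local Notation b := (b_map G L R).

Let hb : pointed b := pointed_b_map L_mor R_mor.

Lemma gstar_eq g y b' : is_gstar c G E H L R r g y -> formal_inverse b b' ->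
  y = b' \of a g.
Proof.
move=> [[[hy _] _] ->] bK; rewrite (b_map_of L_mor R_mor hy).
by rewrite (inverse_unique hb hy bK).
Qed.

Lemma is_gstar_inverse g b' : pointed g -> vertex_IRF_eq c G r g ->
  formal_inverse b b' -> is_gstar c G E H L R r g (b' \of a g).
Proof.
move=> hg g_eq bK; have [hb' bb' b'b] := bK.
have ha := pointed_a_map r E_exp hg.
have hy : pointed (b' \of a g) := pointed_comp ha hb'.
have by_a : b \of (b' \of a g) = a g.
  by rewrite -(mx_compA b hb' ha) bb' (fid_of ha).
split; last by rewrite (b_map_of L_mor R_mor hy) by_a.
split.
  apply: (poisson_map_of_sts char0 r_qt t_nondeg H_lin L_mor R_mor hy by_a).
  exact: (a_map_push char0 r_qt E_exp hg g_eq).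
split; first exact: hy.
have [a' aK] := a_map_inverse t_nondeg E_exp hg.
exists (a' \of b); apply: (formal_inverse_comp ha hb' aK).
by split.
Qed.

End Gstar.

Theorem proposition0p3
  (k : fieldType) (char_k : [pchar k] =i pred0)
  (gg : vectType k) (br : gg -> gg -> gg) (br_lie : lie_bracket br)
  (n : nat) (e : n.-tuple gg) (e_basis : basis_of fullv e)
  (r : 'M[k]_n) (r_qt : quasitriangular (structure_constants br e) r)
  (t_nondeg : r + r^T \in unitmx)
  (* the formal group G, with its exponential *)
  (G : formal_group k n)
  (G_lie : forall i j l, fg_lie G i j l = structure_constants br e i j l)
  (E : 'rV[{fps k[n]}]_n) (E_exp : is_exponential G E)
  (* the formal Poisson-Lie group G^* *)
  (H : formal_poisson_lie_group k n)
  (H_lie : forall i j l,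
     fg_lie H i j l = dual_constants (structure_constants br e) r i j l)
  (H_lin : forall i j l,
     plg_linearization H i j l = structure_constants br e i j l)
  (* the formal group morphisms L, R : G^* -> G *)
  (L R : 'rV[{fps k[n]}]_n)
  (L_mor : is_group_morphism H G r L)
  (R_mor : is_group_morphism H G (- r^T) R)
  (g : 'rV[{fps k[n]}]_n) (g_Map0 : Map0 E g)
  (g_eq : vertex_IRF_eq (structure_constants br e) G r g) :
  let c := structure_constants br e in
  [/\ exists! y, is_gstar c G E H L R r g y,
      formal_iso (a_map G E r g),
      formal_iso (b_map G L R),
      forall y binv, is_gstar c G E H L R r g y ->
        formal_inverse (b_map G L R) binv -> y = binv \of a_map G E r g
    & forall al, Map0_ham c G E al ->
        [/\ poisson_iso (kks c) (kks c) (coad_map G al),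
            Map0 E (gauge G al g),
            vertex_IRF_eq c G r (gauge G al g)
          & forall y y', is_gstar c G E H L R r g y ->
              is_gstar c G E H L R r (gauge G al g) y' ->
              y' = y \of coad_map G al]].
Proof.
move=> c.
have cE : structure_constants br e = fg_lie G.
  by apply/boolp.funext => i; apply/boolp.funext => j; apply/boolp.funext => l; rewrite G_lie.
rewrite {}/c.
move: (structure_constants br e) cE r_qt H_lin g_eq {G_lie H_lie}.
move=> _ -> r_qt H_lin g_eq.
have hg : pointed g by apply/(Map0P E_exp).
have ha := pointed_a_map r E_exp hg.
have hb := pointed_b_map L_mor R_mor.
have [b' bK] := b_map_inverse t_nondeg L_mor R_mor.
have [hb' _ _] := bK.
split.
- exists (b' \of a_map G E r g).
  split; first exact: (is_gstar_inverse char_k r_qt t_nondeg E_exp H_lin).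
  by move=> y /(gstar_eq L_mor R_mor)/(_ bK).
- by split; [exact: ha|exact: (a_map_inverse t_nondeg E_exp hg)].
- by split; [exact: hb|exists b'].
- by move=> y binv; exact: (gstar_eq L_mor R_mor).
move=> al [al_Map0 al_ham].
have hal : pointed al by apply/(Map0P E_exp).
have htau := pointed_coad_map G al.
split.
- exact: coad_map_poisson_iso.
- by apply/(Map0P E_exp); exact: pointed_gauge.
- exact: (vertex_IRF_gauge char_k r_qt hal al_ham hg g_eq).
move=> y y' /(gstar_eq L_mor R_mor)/(_ bK) -> /(gstar_eq L_mor R_mor)/(_ bK) ->.
rewrite (a_map_gauge char_k r_qt E_exp hal hg) (mx_compA b' ha htau).
exact: erefl.
Qed.
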